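(* There is an absolute constant $a>0$ such that the following holds. Let $\alpha\ge 0$, $\epsilon\ge 0$ with $\max\{\alpha,\epsilon\}>0$, and let the force be sufficiently smooth and of form (A) or (B) (see context), with associated bound $G$: - in case (A), assume that there exists a scalar function $g(x,s)$, independent of $\Omega$, such that $\frac1\Omega\,\partial_t\big[g(x,\Omega t)\big]=(\mathrm{rot}\,F)(x_1+\Omega t,x_2)$ and $\sup_s\|g(\cdot,s)\|_{C^3(\mathbb{T}^2)}\le G$, where $G$ is independent of $\Omega$; - in case (B), $G$ is a number with $\|\mathrm{rot}\,f\|_{C^3(\mathbb{T}^2)}\le G$. Let $0<\delta\le\frac14(\alpha+a\epsilon)$, let $\Omega$ be sufficiently large (depending on $\alpha,\epsilon,G,\delta$), and let $v_{per}$ be a regular solution of $$v_t+v\cdot\nabla v-\epsilon\Delta v+\alpha v+\nabla p=F_\Omega,\qquad \mathrm{div}\,v=0,\qquad \int_{\mathbb{T}^2}v\,dx=0, \qquad ( * )$$ periodic in time with period $T_{per}=2\pi/\Omega$ and satisfying $\|v_{per}\|_{L_\infty(T_{per}\mathbb{S}^1;W^1_\infty(\mathbb{T}^2))}\le\delta$. Let $p_0>3$ and let $v(t)$, $t\ge0$, be a solution of $( * )$ with initial datum $v_0\in W^2_{p_0}(\mathbb{T}^2)$, where $\mathrm{div}\,v_0=0$ and $\int_{\mathbb{T}^2}v_0\,dx=0$. Then there is a constant $C$ such that $$\|v(t)-v_{per}(t)\|_{L_2(\mathbb{T}^2)}\le C e^{-\frac{(\alpha+\epsilon)t}{2}}\qquad\text{for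 all } t\ge 0 .$$ Moreover, $v_{per}$ is unique: it is the only regular $T_{per}$-periodic-in-time solution of $( * )$.
   Context: $\mathbb{T}^2=[0,2\pi]^2$ with periodic boundary conditions, and $x=(x_1,x_2)$. For a vector field $v=(v_1,v_2)$, $\mathrm{rot}\,v=\partial_{x_1}v_2-\partial_{x_2}v_1$. $T_{per}\mathbb{S}^1$ denotes the circle of length $T_{per}$, so functions on it are $T_{per}$-periodic in time. $W^k_q$ denotes the usual Sobolev space of functions with $k$ spatial derivatives in $L_q$. The force $F_\Omega(x,t)$, $\Omega>0$, has one of the following two forms. (A) $F_\Omega(x,t)=F(x_1+\Omega t,x_2)$, where $F:\mathbb{T}^2\to\mathbb{R}^2$ is a time-independent vector field with $\int_{\mathbb{T}^2}F\,dx=0$ whose Fourier coefficients satisfy $\hat F_k=0$ for all $k=(0,k_2)$. (This is the system for the perturbation $v-\Omega\hat e_1$ of a constant background flow $\Omega\hat e_1$, after the Galilean change of variables.) (B) $F_\Omega(x,t)=f(x)\sin\Omega t$, where $f:\mathbb{T}^2\to\mathbb{R}^2$ satisfies $\int_{\mathbb{T}^2}f\,dx=0$. ''Sufficiently smooth'' means: there is an absolute integer $m$ such that the result holds for all $F$ (respectively $f$) of class $C^m$. ''Regular'' time-periodic solutions have $v\in L_\infty(T_{per}\mathbb{S}^1;W^1_\infty(\mathbb{T}^2))$ and satisfy the equations almost everywhere for some pressure $p$; equivalently, with $\omega=\mathrm{rot}\,v$, one has $\omega_t+v\cdot\nabla\omega-\epsilon\Delta\omega+\alpha\omega=\mathrm{rot}\,F_\Omega$.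 Under the stated hypotheses a solution $v_{per}$ as in the claim exists for all sufficiently large $\Omega$. For initial data $v_0\in W^2_{p_0}(\mathbb{T}^2)$ as in the claim, the system $( * )$ has a global-in-time solution. *)

(* Defs.v *)
From HB Require Import structures.
From mathcomp Require Import all_boot all_order all_algebra.
From mathcomp Require Import complex.
From mathcomp Require Import all_classical all_reals all_analysis.

Set Implicit Arguments.
Unset Strict Implicit.
Unset Printing Implicit Defensive.
Import Order.TTheory GRing.Theory Num.Theory.
Import numFieldNormedType.Exports.
Local Open Scope classical_set_scope.
Local Open Scope ring_scope.

(* Functions on the torus are functions on the plane that are 2pi-periodic in each coordinate, integrated
   over one period cell.  Space points are x = (x_1, x_2) : R * R, space-time
   points are (t, x) : R * (R * R).  The index i : 'I_2 stands for the
   coordinate x_(i+1), and vector fields are families of components. *)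

Section Torus.
Context {R : realType}.
Implicit Types (u g phi : R * R -> R).

Definition periodic2 u := forall x1 x2,
  u (x1 + 2 * pi, x2) = u (x1, x2) /\ u (x1, x2 + 2 * pi) = u (x1, x2).

Definition cell : set (R * R) := `[0, 2 * pi]%classic `*` `[0, 2 * pi]%classic.

Definition leb2 : set (measurableTypeR R * measurableTypeR R) -> \bar R :=
  (@lebesgue_measure R \x @lebesgue_measure R)%E.

HB.instance Definition _ := Measure.on leb2.

Let leb2_sigma_finite : sigma_finite setT leb2.
Proof.
have /sigma_finiteP[F [TF ndF Foo]] := sigma_finiteT (@lebesgue_measure R).
exists (fun n => F n `*` F n).
  rewrite -setXTT TF predeqE => -[x y]; split.
    move=> [/= [n _ Fnx] [k _ Gky]]; exists (maxn n k) => //; split.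
    - by move: x Fnx; exact/subsetPset/ndF/leq_maxl.
    - by move: y Gky; exact/subsetPset/ndF/leq_maxr.
  by move=> [n _ []/= ? ?]; split; exists n.
move=> k; have [? ?] := Foo k.
split; first exact: measurableX.
by rewrite /leb2 product_measure1E// lte_mul_pinfty// ge0_fin_numE.
Qed.

(* The library does not infer that a product measure is sigma-finite, which is
   needed to form the product leb3. *)
HB.instance Definition _ :=
  @Measure_isSigmaFinite.Build _ _ _ leb2 leb2_sigma_finite.

Definition leb3 :
    set (measurableTypeR R * (measurableTypeR R * measurableTypeR R)) ->
    \bar R :=
  (@lebesgue_measure R \x leb2)%E.

HB.instance Definition _ := Measure.on leb3.

Definition space_dir (i : 'I_2) : R * R := ((i == 0)%:R, (i == 1)%:R).

Definition time_dir : R * (R * R) := (1, (0, 0)).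

(* On a finite-dimensional V, Ck k f says that f is of class C^k: the iterated
   directional derivatives up to order k exist and are continuous. *)
Fixpoint Ck {V : normedModType R} (k : nat) (f : V -> R) : Prop :=
  continuous f /\
  match k with
  | 0 => True
  | k'.+1 => forall e : V, (forall x, derivable f x e) /\ Ck k' ('D_e f)
  end.

(* For f of class C^k: the C^k norm (maximum over the partial derivatives of
   order at most k of their sup norms) is at most M. *)
Fixpoint Ck_norm_le (k : nat) (M : R) (f : R * R -> R) : Prop :=
  (forall x, `|f x| <= M) /\
  match k with
  | 0 => True
  | k'.+1 => forall i, Ck_norm_le k' M ('D_(space_dir i) f)
  end.

Definition L1_torus u :=
  periodic2 u /\ leb2.-integrable cell (EFin \o u).

Definition test_torus phi := periodic2 phi /\ forall k, Ck k phi.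

Definition weak_partial (i : 'I_2) u g :=
  [/\ L1_torus u, L1_torus g &
   forall phi, test_torus phi ->
     \int[leb2]_(x in cell) (u x * 'D_(space_dir i) phi x) =
     - \int[leb2]_(x in cell) (g x * phi x)].

Definition weak_laplacian u g :=
  [/\ L1_torus u, L1_torus g &
   forall phi, test_torus phi ->
     \int[leb2]_(x in cell)
       (u x * \sum_(i < 2) 'D_(space_dir i) ('D_(space_dir i) phi) x) =
     \int[leb2]_(x in cell) (g x * phi x)].

(* The closed ball of radius M in W^k_q(T^2), 1 <= q <= +oo, for the norm
   max_{|beta| <= k} || D^beta u ||_{L_q}. *)
Fixpoint sobolev_ball (k : nat) (q : \bar R) (M : R) u : Prop :=
  [/\ periodic2 u, measurable_fun setT u,
      ('N[leb2]_q[EFin \o (u \_ cell)] <= M%:E)%E &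
   match k with
   | 0 => True
   | k'.+1 => forall i, exists2 g, weak_partial i u g & sobolev_ball k' q M g
   end].

Definition sobolev (k : nat) (q : \bar R) u := exists M, sobolev_ball k q M u.

Definition fourier_coef u (k : int * int) : R[i] :=
  let phase (x : R * R) := k.1%:~R * x.1 + k.2%:~R * x.2 in
  let c := ((2 * pi) ^+ 2)^-1 in
  Complex (c * \int[leb2]_(x in cell) (u x * cos (phase x)))
          (- (c * \int[leb2]_(x in cell) (u x * sin (phase x)))).

Definition vfield := 'I_2 -> R * R -> R.
Implicit Types (v : vfield).

Definition mean_zero v := forall j, \int[leb2]_(x in cell) v j x = 0.

Definition div_free v := exists2 g : vfield,
  forall i, weak_partial i (v i) (g i) &
  {ae leb2, forall x, \sum_(i < 2) g i x = 0}.

Definition rot2 v : R * R -> R :=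
  fun x => 'D_(space_dir 0) (v 1) x - 'D_(space_dir 1) (v 0) x.

Definition L2norm v : \bar R :=
  let euclid := fun x => Num.sqrt (\sum_(j < 2) v j x ^+ 2) in
  ('N[leb2]_(2%:E)[EFin \o (euclid \_ cell)])%E.

Definition force_A (m : nat) (G : R) (F : R -> R -> vfield) :=
  exists F0 : vfield,
  [/\ forall j, periodic2 (F0 j) /\ Ck m (F0 j),
      mean_zero F0,
      forall j (k : int * int), k.1 = 0 -> fourier_coef (F0 j) k = 0,
      exists g : R * R -> R -> R,
        [/\ forall s, periodic2 (g ^~ s),
            forall (Omega t : R) x, 0 < Omega ->
              let h := fun tau : R => g x (Omega * tau) in
              derivable h t 1 /\
              Omega^-1 * derive1 h t = rot2 F0 (x.1 + Omega * t, x.2) &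
            forall s, Ck 3 (g ^~ s) /\ Ck_norm_le 3 G (g ^~ s)] &
      forall Omega t j x, F Omega t j x = F0 j (x.1 + Omega * t, x.2)].

Definition force_B (m : nat) (G : R) (F : R -> R -> vfield) :=
  exists f : vfield,
  [/\ forall j, periodic2 (f j) /\ Ck m (f j),
      mean_zero f,
      Ck 3 (rot2 f) /\ Ck_norm_le 3 G (rot2 f) &
      forall Omega t j x, F Omega t j x = f j x * sin (Omega * t)].

End Torus.
Arguments vfield : clear implicits.

Section Flow.
Context {R : realType}.

Definition stfun := R * (R * R) -> R.

(* Time-dependent vector fields. *)
Definition flow := 'I_2 -> stfun.

Definition slice (v : flow) (t : R) : vfield R := fun j x => v j (t, x).

Implicit Types (I : set R) (v : flow) (F : R -> vfield R).

(* Smooth functions on I° x T^2 with compact support. *)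
Definition test_flow I (phi : stfun) :=
  [/\ forall t, periodic2 (fun x => phi (t, x)),
      forall k, Ck k phi &
      exists a b : R, `[a, b]%classic `<=` I° /\
        forall t x, ~ `[a, b]%classic t -> phi (t, x) = 0].

Definition L1loc I (u : stfun) :=
  (forall t, I t -> periodic2 (fun x => u (t, x))) /\
  forall a b : R, `[a, b]%classic `<=` I° ->
    leb3.-integrable (`[a, b]%classic `*` cell) (EFin \o u).

Definition weak_dt I (u g : stfun) :=
  [/\ L1loc I u, L1loc I g &
   forall phi, test_flow I phi ->
     \int[leb3]_(z in I `*` cell) (u z * 'D_time_dir phi z) =
     - \int[leb3]_(z in I `*` cell) (g z * phi z)].

(* The equation at one instant, for almost every x, with ut the value of v_t.
   Lu is the weak form of epsilon Delta u: the factor epsilon stays inside so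
   that no second derivative of u is required when epsilon = 0. *)
Definition momentum_eq (alpha epsilon : R) (f u ut : vfield R)
    (p : R * R -> R) :=
  exists (Du : 'I_2 -> vfield R) (Lu Dp : vfield R),
  [/\ forall i j, weak_partial i (u j) (Du i j),
      forall j, weak_laplacian (fun x => epsilon * u j x) (Lu j),
      forall j, weak_partial j p (Dp j) &
      forall j, {ae leb2, forall x,
        ut j x + \sum_(i < 2) u i x * Du i j x - Lu j x + alpha * u j x
        + Dp j x = f j x}].

(* t |-> v(t) is continuous on I with values in L_2(T^2): this selects the
   representative of v that is defined at every time. *)
Definition L2_continuous I v := forall t, I t ->
  L2norm (fun j x => v j (s, x) - v j (t, x)) @[s --> within I (nbhs t)]
    --> 0%E.

Definition solution (alpha epsilon : R) F I v :=
  [/\ forall j, measurable_fun (I `*` setT) (v j),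
      L2_continuous I v,
      forall t, I t -> mean_zero (slice v t),
      {ae (@lebesgue_measure R), forall t, I t -> div_free (slice v t)} &
      exists (vt : flow) (p : stfun),
        [/\ forall j, weak_dt I (v j) (vt j),
            measurable_fun (I `*` setT) p &
            {ae (@lebesgue_measure R), forall t, I t ->
               momentum_eq alpha epsilon (F t) (slice v t) (slice vt t)
                 (fun x => p (t, x))}]].

(* The norm of v in L_oo(I; W^1_oo(T^2)) is at most M. *)
Definition Linf_W1inf_le I (M : R) v :=
  {ae (@lebesgue_measure R), forall t, I t ->
     forall j, sobolev_ball 1 +oo%E M (slice v t j)}.

(* A function on the circle of length T is a T-periodic function on the line. *)
Definition regular_periodic_solution (alpha epsilon : R) F (T : R) v :=
  [/\ forall j t x, v j (t + T, x) = v j (t, x),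
      exists M, Linf_W1inf_le setT M v &
      solution alpha epsilon F setT v].

(* Solution for t >= 0, with the same regularity on bounded time intervals. *)
Definition cauchy_solution (alpha epsilon : R) F (v0 : vfield R) v :=
  [/\ forall T, exists M, Linf_W1inf_le `[0, T]%classic M v,
      solution alpha epsilon F `[0, +oo[%classic v &
      forall j, {ae leb2, forall x, v j (0, x) = v0 j x}].

End Flow.
Arguments flow : clear implicits.

(* Main.v *)
Require Import Defs.
From HB Require Import structures.
From mathcomp Require Import all_boot all_order all_algebra.
From mathcomp Require Import complex.
From mathcomp Require Import all_classical all_reals all_analysis.
From mathcomp Require Import measurable_realfun ess_sup_inf.
From mathcomp Require Import ring lra.
Import Order.TTheory GRing.Theory Num.Theory.
Import numFieldNormedType.Exports.
Local Open Scope classical_set_scope.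
Local Open Scope ring_scope.
Set Implicit Arguments.
Unset Strict Implicit.
Unset Printing Implicit Defensive.

(** The difference [w] of two solutions driven by the same force satisfies an
    equation in which the force cancels, so the absolute constant can be taken
    to be 1 and neither the size of [Omega] nor the time periodicity matters.
    Let [a_k(t)] be the coefficients of [w(t)] in the real trigonometric basis.
    Testing the equation with smooth functions of time times basis functions
    shows that the [a_k] are absolutely continuous, with derivatives given by
    the coefficients of [w_t]; so the truncated energy
    [E_N = sum_(|k| <= N) a_k^2] may be differentiated.  Pressure does not
    contribute since [w] is divergence free, transport by [v] vanishes in the
    limit [N -> oo], the diffusion term gives [- 2 epsilon E_N] by Poincare's
    inequality (the smallest nonzero eigenvalue is 1), and the stretching term
    [w . grad v_per] contributes at most [4 * delta * |w|^2].  Hence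
      [E_N' + (alpha + epsilon) E_N <= r_N]
    with [r_N >= 0] bounded and tending to 0 for almost every time, and dominated
    convergence makes [exp((alpha + epsilon) t) |w(t)|^2] nonincreasing along
    almost all times.  Continuity in [L_2] extends the bound to all times.  When
    both solutions are entire and bounded, letting the initial time tend to
    [-oo] gives [w = 0]. *)

(** * Smooth functions of one or several variables *)

(** Multiplying the equation by [w] is not directly legitimate: the weak time derivative, the weak
    Laplacian and the pressure gradient are tested on smooth functions only, and [w] is merely
    Lipschitz-like in space. Finitely many harmonics are smooth, and partial derivatives permute the
    real harmonics up to a factor. Hence truncation commutes with differentiation, and pressure and
    diffusion are handled exactly, mode by mode. The price is advection, whose cancellation concerns
    [w] and not its truncation: it returns only as N grows, separately at each good time and without
    a rate, which is why an error r_N with a bound uniform in time is carried.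

    The factor 4 has this origin: the four products w_i (D_i v_j) w_j are each at most
    (delta/2)(|w_i|^2 + |w_j|^2), which adds up to 2 delta |w|^2, and differentiating |w|^2 doubles
    it.

    Density of trigonometric polynomials is proved for a weighted L2 norm: convergence of
    truncations is an L2 matter, but uniqueness of weak derivatives concerns functions that are only
    integrable. *)

Lemma is_derive_line {R : realType} {V : normedModType R} (f : V -> R) (x e : V) (d : R) :
  is_derive (0 : R) (1 : R) (fun h : R => f (h *: e + x)) d -> is_derive x e f d.
Proof.
move=> [df <-]; constructor; first exact/derivable1P.
rewrite /derive; set g1 := fun h => h^-1 *: _; set g2 := fun h => h^-1 *: _.
suff -> : g1 = g2 by [].
by apply/funext => h; rewrite /g1 /g2 /= addr0 scale0r add0r /GRing.scale /= mulr1.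
Qed.

Lemma is_derive_comp_affine {R : realType} {V : normedModType R} (L : V -> R)
    (f f' : R -> R) (c : R) (x e : V) :
  (forall h u v, L (h *: u + v) = h * L u + L v) ->
  (forall y, is_derive y (1 : R) f (f' y)) ->
  is_derive x e (fun z => f (L z + c)) (L e * f' (L x + c)).
Proof.
move=> Lin df; apply: is_derive_line.
rewrite (_ : (fun h : R => _) = f \o (fun h => h * L e + (L x + c))); last first.
  by apply/funext => h /=; rewrite Lin addrA.
set g := fun h : R => _.
have dg : is_derive (0 : R) (1 : R) g (L e).
  have -> : g = (L e \*o id) + cst (L x + c) by apply/funext => h; rewrite /g /= mulrC.
  by apply: is_derive_eq; rewrite addr0 /GRing.scale /= mulr1.
have dfg : is_derive (g 0) (1 : R) f (f' (L x + c)).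
  by rewrite /g mul0r add0r; exact: df.
by rewrite mulrC; apply: is_derive1_comp.
Qed.

Lemma CkS {R : realType} {V : normedModType R} k (f : V -> R) : Ck k.+1 f -> Ck k f.
Proof.
elim: k f => [|k IH] f; first by case.
move=> [cf df]; split => // e; have [d1 d2] := df e; split => //; exact: IH.
Qed.

Lemma Ck_continuous {R : realType} {V : normedModType R} k (f : V -> R) : Ck k f -> continuous f.
Proof. by case: k => [[]|k []]. Qed.

Lemma CkD {R : realType} {V : normedModType R} k (f g : V -> R) :
  Ck k f -> Ck k g -> Ck k (f \+ g).
Proof.
elim: k f g => [|k IH] f g.
  by move=> [cf _] [cg _]; split => // x; apply: cvgD; [exact: cf|exact: cg].
move=> [cf df] [cg dg]; split; first by move=> x; apply: cvgD; [exact: cf|exact: cg].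
move=> e; have [f1 f2] := df e; have [g1 g2] := dg e; split.
  by move=> x; apply: derivableD.
have -> : 'D_e (f \+ g) = 'D_e f \+ 'D_e g by apply/funext => x /=; rewrite -deriveD.
exact: IH.
Qed.

Lemma CkM {R : realType} {V : normedModType R} k (f g : V -> R) :
  Ck k f -> Ck k g -> Ck k (f \* g).
Proof.
elim: k f g => [|k IH] f g.
  by move=> [cf _] [cg _]; split => // x; apply: cvgM; [exact: cf|exact: cg].
move=> cf' cg'; have [cf df] := cf'; have [cg dg] := cg'.
split; first by move=> x; apply: cvgM; [exact: cf|exact: cg].
move=> e; have [f1 f2] := df e; have [g1 g2] := dg e; split.
  by move=> x; apply: derivableM.
have -> : 'D_e (f \* g) = (f \* 'D_e g) \+ (g \* 'D_e f).
  by apply/funext => x /=; rewrite -[RHS]deriveM.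
by apply: CkD; apply: IH => //; exact: CkS.
Qed.

Lemma Ck_cst {R : realType} {V : normedModType R} k (c : R) : Ck k (fun=> c : R) (V := V).
Proof.
have cc a : continuous (fun _ : V => a : R) by move=> x; exact: cvg_cst.
elim: k c => [|k IH] c; split => // e; split.
  by move=> x; apply: derivable_cst.
by have -> : 'D_e (fun _ : V => c) = (fun=> 0) by apply/funext => x; exact: derive_cst.
Qed.

Lemma CkZ {R : realType} {V : normedModType R} k (c : R) (f : V -> R) :
  Ck k f -> Ck k (fun x => c * f x).
Proof. by move=> h; apply: (CkM (Ck_cst k c) h). Qed.

Lemma Ck_sum {R : realType} {V : normedModType R} k (I : Type) (r : seq I) (f : I -> V -> R) :
  (forall i, Ck k (f i)) -> Ck k (fun x => \sum_(i <- r) f i x).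
Proof.
move=> h; elim: r => [|i r IH].
  by under eq_fun do rewrite big_nil; exact: Ck_cst.
by under eq_fun do rewrite big_cons; exact: CkD.
Qed.

(** The whole sequence [df] of successive derivatives is given, so differentiating only shifts the
    index [n] and produces the constant [L e]. Induction on [k] with [n] free then needs no
    higher-order chain rule. *)
Lemma Ck_comp_affine {R : realType} {V : normedModType R} (L : V -> R) (df : nat -> R -> R) (c : R) k n :
  (forall h u v, L (h *: u + v) = h * L u + L v) -> continuous L ->
  (forall m y, is_derive y (1 : R) (df m) (df m.+1 y)) ->
  Ck k (fun z => df n (L z + c)).
Proof.
move=> Lin Lc dfS.
have cc m : continuous (fun z => df m (L z + c)).
  move=> z; apply: (@continuous_comp _ _ _ (fun z => L z + c) (df m)).
    by apply: cvgD; [exact: Lc|exact: cvg_cst].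
  apply: differentiable_continuous; apply/derivable1_diffP.
  by have [] := dfS m (L z + c).
elim: k n => [|k IH] n; first by split.
split => // e.
have D z := is_derive_comp_affine c z e Lin (dfS n); split; first by move=> x; case: (D x).
have -> : 'D_e (fun z => df n (L z + c)) = (fun z => L e * df n.+1 (L z + c)).
  by apply/funext => z; case: (D z).
exact: CkZ.
Qed.

(** For a monomial with n > 0, y / n <= exp (y / n), and raising this to the power n gives y^n <=
    n^n exp y. *)
Lemma poly_le_expR {R : realType} (p : {poly R}) :
  exists C : R, forall y, 0 <= y -> `|p.[y]| <= C * expR y.
Proof.
have mono n (y : R) : 0 <= y -> y ^+ n <= n%:R ^+ n * expR y.
  move=> y0; case: n => [|n]; first by rewrite !expr0 mul1r; apply: le_trans (expR_ge1Dx y); rewrite lerDl.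
  have n0 : 0 < n.+1%:R :> R by rewrite ltr0n.
  rewrite -{2}[y](mulfVK (lt0r_neq0 n0)) mulrC expRM_natr -exprMn.
  rewrite lerXn2r// ?nnegrE ?mulr_ge0 ?expR_ge0//.
  rewrite -[leLHS](mulfVK (lt0r_neq0 n0)) ler_pM2r//.
  by apply: le_trans (expR_ge1Dx _); rewrite lerDr.
exists (\sum_(i < size p) `|p`_i| * i%:R ^+ i) => y y0.
rewrite horner_coef mulr_suml; apply: le_trans (ler_norm_sum _ _ _) _.
apply: ler_sum => i _; rewrite normrM -mulrA ler_wpM2l//.
by rewrite normrX ger0_norm//; exact: mono.
Qed.

Definition flat {R : realType} (p : {poly R}) (x : R) : R :=
  if 0 < x then p.[x^-1] * expR (- x^-1) else 0.

Lemma flat_bound {R : realType} (p : {poly R}) : exists C : R, forall x, `|flat p x| <= C * `|x|.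
Proof.
have [C HC] := poly_le_expR (p * 'X).
exists C => x; rewrite /flat; case: ifPn => x0; last first.
  have C0 : 0 <= C by have := HC 0 (lexx _); rewrite expR0 mulr1; exact: le_trans.
  by rewrite normr0 mulr_ge0.
have y0 : 0 < x^-1 by rewrite invr_gt0.
rewrite (gtr0_norm x0) normrM (gtr0_norm (expR_gt0 _)) expRN.
rewrite ler_pdivrMr ?expR_gt0// mulrAC -ler_pdivrMr// -[X in _ / X]invrK invrK.
apply: le_trans (HC _ (ltW y0)); rewrite hornerM hornerX normrM.
by rewrite (gtr0_norm y0).
Qed.

Lemma is_derive_flat {R : realType} (p : {poly R}) (x : R) :
  is_derive x (1 : R) (flat p) (flat ('X^2 * (p - p^`())) x).
Proof.
have [x0|x0|->] := ltgtP x 0.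
- have -> : flat ('X^2 * (p - p^`())) x = 0 by rewrite /flat ltNge (ltW x0).
  suff : \near x, cst (0 : R) x = flat p x by move/near_eq_is_derive; apply.
  near=> y; rewrite /flat ltNge ifF//=; apply/negbTE; rewrite negbK ltW//.
  by near: y; exact: lt_nbhsl.
- have -> : flat ('X^2 * (p - p^`())) x =
      (p.[x^-1] *: (expR (- x^-1) * (x^-1) ^+ 2) + expR (- x^-1) *: (p^`().[x^-1] * - (x^-1) ^+ 2)).
    rewrite /flat x0 hornerM hornerXn hornerD hornerN /GRing.scale /=; ring.
  have xn0 : x != 0 by rewrite gt_eqF.
  have dV : is_derive x (1 : R) (fun y : R => y^-1) (- (x^-1) ^+ 2).
    apply: is_derive_eq; first exact: (is_deriveV xn0 (is_derive_id x 1)).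
    by rewrite /GRing.scale /= mulr1 exprVn.
  suff : \near x, ((fun y => p.[y^-1]) * (fun y => expR (- y^-1))) x = flat p x.
    move/near_eq_is_derive; apply.
    have dN : is_derive x (1 : R) (fun y : R => - y^-1) ((x^-1) ^+ 2).
      by apply: is_derive_eq; rewrite opprK.
    have dE : is_derive x (1 : R) (fun y => expR (- y^-1)) (expR (- x^-1) * (x^-1) ^+ 2).
      exact: is_derive1_comp.
    have dP : is_derive x (1 : R) (fun y => p.[y^-1]) (p^`().[x^-1] * - (x^-1) ^+ 2).
      exact: is_derive1_comp.
    exact: is_deriveM.
  near=> y; rewrite /flat ifT//; near: y; exact: lt_nbhsr.
- have -> : flat ('X^2 * (p - p^`())) 0 = 0 by rewrite /flat ltxx.
  (* The difference quotient at 0 is [flat p z / z = flat (p * 'X) z], which tends to 0 by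
     [flat_bound]; so both the function and its derivative vanish at 0. *)
  apply/is_derive1_caratheodory; exists (flat (p * 'X)); split => [z||].
  + rewrite /flat ltxx !subr0; case: ifPn => z0; last by rewrite mul0r.
    by rewrite hornerM hornerX mulrAC mulfVK// gt_eqF.
  + apply/cvgrPdist_le => e e0; have [C HC] := flat_bound (p * 'X).
    have C0 : 0 < `|C| + 1 by rewrite ltr_pwDr.
    near=> y; rewrite {1}/flat ltxx sub0r normrN; apply: le_trans (HC y) _.
    apply: (@le_trans _ _ ((`|C| + 1) * `|y|)).
      by rewrite ler_wpM2r// (le_trans (ler_norm _))// lerDl.
    rewrite mulrC -ler_pdivlMr//; near: y.
    exists (e / (`|C| + 1)); first by rewrite /= divr_gt0.
    by move=> z; rewrite /= sub0r normrN => /ltW.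
  + by rewrite /flat ltxx.
Unshelve. all: by end_near. Qed.

Lemma is_derive_continuous {R : realType} (f f' : R -> R) :
  (forall x, is_derive x (1 : R) f (f' x)) -> continuous f.
Proof.
by move=> df x; apply: differentiable_continuous; apply/derivable1_diffP; case: (df x).
Qed.

(** Integrating from [s - 1], a point to the left of the support of [f], makes the primitive vanish
    before [s] and leaves room for the fundamental theorem at [s] itself. *)
Lemma continuous_antiderivative {R : realType} (f : R -> R) (s : R) :
  continuous f -> (forall x, x < s -> f x = 0) ->
  exists2 F, (forall x, is_derive x (1 : R) F (f x)) & (forall x, x < s -> F x = 0).
Proof.
move=> cf f0; exists (fun x => \int[lebesgue_measure]_(t in `[s - 1, x]) f t).
  move=> x; have [xs|xs] := ltP x s.
    rewrite f0//.
    suff : \near x, cst (0 : R) x = \int[lebesgue_measure]_(t in `[s - 1, x]) f t.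
      by move/near_eq_is_derive; apply.
    near=> y; under eq_Rintegral => t.
      rewrite inE/= in_itv/= => /andP[_ ty]; rewrite f0; last first.
        by apply: le_lt_trans ty _; near: y; exact: lt_nbhsl.
      over.
    by rewrite Rintegral_cst//= mul0r.
  have ci : lebesgue_measure.-integrable `[s - 1, x + 1] (EFin \o f).
    apply: continuous_compact_integrable; first exact: segment_compact.
    exact: continuous_subspaceT.
  have sx : s - 1 < x by apply: lt_le_trans xs; rewrite ltrBlDr ltrDl.
  have xx : x < x + 1 by rewrite ltrDl.
  have [dF FE] := continuous_FTC1_closed xx ci sx (cf x).
  by constructor => //; rewrite -derive1E.
move=> x xs; under eq_Rintegral => t.
  rewrite inE/= in_itv/= => /andP[_ ty]; rewrite f0; last exact: le_lt_trans xs.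
  over.
by rewrite Rintegral_cst//= mul0r.
Unshelve. all: by end_near. Qed.

Lemma Rintegral_FTC2 {R : realType} (F f : R -> R) (a b : R) : a <= b ->
  (forall x, is_derive x (1 : R) F (f x)) -> continuous f ->
  \int[lebesgue_measure]_(x in `[a, b]) f x = F b - F a.
Proof.
rewrite le_eqVlt => /predU1P[-> _ _|ab dF cf].
  by rewrite set_itv1 Rintegral_set1 subrr.
have cF := is_derive_continuous dF.
rewrite /Rintegral (@continuous_FTC2 _ f F)//.
- exact: continuous_subspaceT.
- split; first by move=> x _; case: (dF x).
    by apply: cvg_at_right_filter; exact: cF.
  by apply: cvg_at_left_filter; exact: cF.
- by move=> x _; rewrite derive1E; case: (dF x).
Qed.

(** Smoothness is stated after composition with any continuous linear form, so that a profile of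
    time alone can later be read as a smooth function on space-time. *)
Definition smooth1 {R : realType} (H : R -> R) := forall (V : normedModType R) (L : V -> R) k,
  (forall (c : R) (u v : V), L (c *: u + v) = c * L u + L v) -> continuous L ->
  Ck k (fun z => H (L z)).

Definition is_step {R : realType} (s s' : R) (H h : R -> R) :=
  [/\ forall x, is_derive x (1 : R) H (h x),
      continuous h, (forall x, 0 <= h x) /\ (forall x, 0 <= H x <= 1),
      (forall x, x <= s -> H x = 0) /\ (forall x, s' <= x -> H x = 1) &
      (forall x, x <= s -> h x = 0) /\ (forall x, s' <= x -> h x = 0)] /\ smooth1 H.

(** The step is the normalised primitive of the bump exp (-1/(x - s)) exp (-1/(s' - x)), which is
    supported in [s, s']. *)
Lemma smooth_step {R : realType} (s s' : R) : s < s' -> exists H h : R -> R, is_step s s' H h.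
Proof.
move=> ss'.
(* [df m] is the m-th derivative of x |-> exp (-1/x), extended by 0 to x <= 0. *)
pose df m := flat (iter m (fun p : {poly R} => 'X^2 * (p - p^`())) 1).
have dfS m y : is_derive y (1 : R) (df m) (df m.+1 y) by exact: is_derive_flat.
pose r x := df 0 (x - s) * df 0 (- x + s').
have df0 x : 0 <= df 0 x.
  by rewrite /df /flat /=; case: ifP => // _; rewrite hornerC mul1r expR_ge0.
have df00 x : x <= 0 -> df 0 x = 0 by rewrite /df /flat ltNge => ->.
have rge0 x : 0 <= r x by rewrite mulr_ge0.
have rs x : x <= s -> r x = 0 by move=> xs; rewrite /r df00 ?mul0r// subr_le0.
have rs' x : s' <= x -> r x = 0.
  by move=> xs; rewrite /r [X in _ * X]df00 ?mulr0// addrC subr_le0.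
have rpos x : s < x < s' -> 0 < r x.
  move=> /andP[sx xs]; rewrite /r /df /flat /= subr_gt0 sx [- x + _]addrC subr_gt0 xs !hornerC !mul1r.
  by rewrite mulr_gt0 ?expR_gt0.
have rC (V : normedModType R) (L : V -> R) k :
     (forall h u v, L (h *: u + v) = h * L u + L v) -> continuous L ->
     Ck k (fun z => r (L z)).
  move=> Lin Lc; apply: CkM; first exact: Ck_comp_affine.
  apply: (@Ck_comp_affine _ _ (fun z => - L z)) => //.
    by move=> h u v; rewrite Lin opprD mulrN.
  by move=> z; apply: cvgN; exact: Lc.
have cr : continuous r.
  by apply: (@Ck_continuous _ _ 0); apply: (rC _ (id : R -> R) 0) => // x; exact: cvg_id.
have [F dF F0] := continuous_antiderivative cr (fun x xs => rs x (ltW xs)).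
have cF := is_derive_continuous dF.
have MV a b : a <= b -> exists2 c, c \in `[a, b]%R & F b - F a = r c * (b - a).
  move=> ab; apply: MVT_segment => //; exact: continuous_subspaceT.
have Fmono a b : a <= b -> F a <= F b.
  by move=> ab; have [c _ E] := MV _ _ ab; rewrite -subr_ge0 E mulr_ge0// subr_ge0.
have Fs x : x <= s -> F x = 0.
  move=> xs; have x1 : x - 1 <= x by rewrite lerBlDr lerDl.
  have [c] := MV _ _ x1; rewrite in_itv/= => /andP[_ cx]; rewrite rs ?mul0r; last exact: le_trans xs.
  move/eqP; rewrite subr_eq0 => /eqP ->; apply: F0.
  by apply: lt_le_trans xs; rewrite ltrBlDr ltrDl.
have Fs' x : s' <= x -> F x = F s'.
  move=> xs; have [c] := MV _ _ xs; rewrite in_itv/= => /andP[cx _]; rewrite rs'// mul0r.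
  by move/eqP; rewrite subr_eq0 => /eqP ->.
(* The mean value theorem yields an interior point, where [r] is positive; the normalising constant
   [F s'] is therefore nonzero. *)
have Fpos : 0 < F s'.
  have [] := @MVT R F r s s' ss' (fun x _ => dF x).
    exact: continuous_subspaceT.
  move=> c; rewrite in_itv /= => cs; rewrite (Fs s)// subr0 => ->.
  by rewrite mulr_gt0 ?rpos// subr_gt0.
exists (fun x => (F s')^-1 * F x), (fun x => (F s')^-1 * r x); split; first split; last 2 first.
- by split => x xs; [rewrite rs// mulr0|rewrite rs'// mulr0].
- move=> V L [|k] Lin Lc; apply: CkZ.
    split => //; move=> z; apply: (@continuous_comp _ _ _ L F); [exact: Lc|exact: cF].
  have D z e := is_derive_comp_affine 0 z e Lin dF.
  have E : (fun z => F (L z + 0)) = (fun z => F (L z)) by apply/funext => z; rewrite addr0.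
  rewrite E in D; split; first by move=> z; apply: (@continuous_comp _ _ _ L F); [exact: Lc|exact: cF].
  move=> e; split; first by move=> x; case: (D x e).
  have -> : 'D_e (fun z => F (L z)) = (fun z => L e * r (L z)).
    by apply/funext => z; case: (D z e) => _ ->; rewrite addr0.
  by apply: CkZ; exact: rC.
- by move=> x; exact: (is_deriveZ (F s')^-1 (dF x)).
- by move=> x; apply: cvgM; [exact: cvg_cst|exact: cr].
- split; first by move=> x; rewrite mulr_ge0// invr_ge0 ltW.
  move=> x; rewrite mulr_ge0 ?invr_ge0 ?(ltW Fpos)//=; last first.
    have [xs|/ltW xs] := leP x s; first by rewrite Fs.
    by rewrite -(Fs s)// Fmono.
  rewrite mulrC ler_pdivrMr// mul1r; have [xs|/ltW xs] := leP x s'; first exact: Fmono.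
  by rewrite Fs'.
- split => x xs; first by rewrite (Fs x)// mulr0.
  by rewrite (Fs' x)// mulVf// gt_eqF.
Qed.

(** * Bounded functions in L2 and orthonormal projections *)

Section BoundedL2.
Context d (T : measurableType d) (R : realType).
Variables (mu : {measure set T -> \bar R}) (D : set T).
Implicit Types (f g h : T -> R).
Hypotheses (mD : measurable D) (fD : (mu D < +oo)%E).

(** On a set of finite measure the essentially bounded functions form an algebra on which [ip] is
    finite. This much L2 theory suffices, since the solutions and their gradients are bounded at
    almost every time. *)
Definition ae_bounded (f : T -> R) (M : R) :=
  measurable_fun D f /\ {ae mu, forall x, D x -> `|f x| <= M}.

Definition bounded_fun (f : T -> R) := exists M, ae_bounded f M.

Definition ip (f g : T -> R) : R := \int[mu]_(x in D) (f x * g x).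

Lemma bounded_fun_measurable f : bounded_fun f -> measurable_fun D f.
Proof. by move=> [M []]. Qed.

Lemma bounded_fun_everywhere f M : measurable_fun D f -> (forall x, D x -> `|f x| <= M) ->
  bounded_fun f.
Proof. by move=> mf h; exists M; split => //; exact: aeW. Qed.

Lemma bounded_fun_cst (c : R) : bounded_fun (fun=> c).
Proof. by apply: (@bounded_fun_everywhere _ `|c|). Qed.

Lemma ae_boundedD f g M N : ae_bounded f M -> ae_bounded g N -> ae_bounded (f \+ g) (M + N).
Proof.
move=> [mf Mf] [mg Ng]; split; first exact: measurable_funD.
apply: filterS2 Mf Ng => x h1 h2 Dx.
by rewrite (le_trans (ler_normD _ _))// lerD ?h1 ?h2.
Qed.

Lemma ae_boundedM f g M N : ae_bounded f M -> ae_bounded g N -> ae_bounded (f \* g) (M * N).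
Proof.
move=> [mf Mf] [mg Ng]; split; first exact: measurable_funM.
apply: filterS2 Mf Ng => x h1 h2 Dx.
by rewrite normrM ler_pM ?h1 ?h2.
Qed.

Lemma bounded_funD f g : bounded_fun f -> bounded_fun g -> bounded_fun (f \+ g).
Proof. by move=> [M h1] [N h2]; exists (M + N); exact: ae_boundedD. Qed.

Lemma bounded_funM f g : bounded_fun f -> bounded_fun g -> bounded_fun (f \* g).
Proof. by move=> [M h1] [N h2]; exists (M * N); exact: ae_boundedM. Qed.

Lemma bounded_funZ (c : R) f : bounded_fun f -> bounded_fun (fun x => c * f x).
Proof. by move=> h; exact: bounded_funM (bounded_fun_cst c) h. Qed.

Lemma bounded_funB f g : bounded_fun f -> bounded_fun g -> bounded_fun (f \- g).
Proof.
move=> h1 /(bounded_funZ (-1)) h2; have := bounded_funD h1 h2.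
by congr bounded_fun; apply/funext => x /=; rewrite mulN1r.
Qed.

Lemma bounded_fun_sum (I : Type) (r : seq I) (f : I -> T -> R) :
  (forall i, bounded_fun (f i)) -> bounded_fun (fun x => \sum_(i <- r) f i x).
Proof.
move=> h; elim: r => [|i r IH].
  by under eq_fun do rewrite big_nil; exact: bounded_fun_cst.
by under eq_fun do rewrite big_cons; exact: bounded_funD.
Qed.

Lemma integrable_bounded_funM f g : mu.-integrable D (EFin \o f) -> bounded_fun g ->
  mu.-integrable D (EFin \o (f \* g)).
Proof.
move=> /integrableP[mf If] [M [mg Mg]].
have mf' : measurable_fun D f by exact/measurable_EFinP.
apply/integrableP; split; first by apply/measurable_EFinP; exact: measurable_funM.
have : (\int[mu]_(x in D) (`|M|%:E * `|(EFin \o f) x|) < +oo)%E.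
  rewrite ge0_integralZl ?lte_mul_pinfty//.
  by apply: measurableT_comp => //.
apply: le_lt_trans; apply: ae_ge0_le_integral => //.
- by apply: measurableT_comp => //; apply/measurable_EFinP; exact: measurable_funM.
- by apply: emeasurable_funM => //; apply: measurableT_comp => //.
apply: filterS Mg => x h Dx /=.
rewrite -EFinM lee_fin normrM mulrC ler_wpM2r//.
by apply: le_trans (h Dx) _; exact: ler_norm.
Qed.

Lemma bounded_fun_integrable f : bounded_fun f -> mu.-integrable D (EFin \o f).
Proof.
move=> bf; have h1 : mu.-integrable D (EFin \o (cst 1 : T -> R)).
  apply: measurable_bounded_integrable => //.
  by exists 1; split => // x x1 y _ /=; rewrite normr1 ltW.
have := integrable_bounded_funM h1 bf.
by congr integrable; apply/funext => x /=; rewrite mul1r.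
Qed.

Lemma ip_integrable f g : bounded_fun f -> bounded_fun g ->
  mu.-integrable D (EFin \o (f \* g)).
Proof. by move=> bf bg; apply: bounded_fun_integrable; exact: bounded_funM. Qed.

Lemma ipC f g : ip f g = ip g f.
Proof. by apply: eq_Rintegral => x _; rewrite mulrC. Qed.

Lemma ipDl f g h : bounded_fun f -> bounded_fun g -> bounded_fun h ->
  ip (f \+ g) h = ip f h + ip g h.
Proof.
move=> bf bg bh; rewrite /ip; under eq_Rintegral do rewrite mulrDl.
by rewrite RintegralD//; exact: ip_integrable.
Qed.

Lemma ipZl c f h : bounded_fun f -> bounded_fun h -> ip (fun x => c * f x) h = c * ip f h.
Proof.
move=> bf bh; rewrite /ip; under eq_Rintegral do rewrite -mulrA.
by rewrite RintegralZl//; exact: ip_integrable.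
Qed.

Lemma ipBl f g h : bounded_fun f -> bounded_fun g -> bounded_fun h ->
  ip (f \- g) h = ip f h - ip g h.
Proof.
move=> bf bg bh; rewrite /ip; under eq_Rintegral do rewrite mulrBl.
by rewrite RintegralB//; exact: ip_integrable.
Qed.

Lemma ipDr f g h : bounded_fun f -> bounded_fun g -> bounded_fun h ->
  ip h (f \+ g) = ip h f + ip h g.
Proof. by move=> *; rewrite ipC ipDl// !(ipC h). Qed.

Lemma ipBr f g h : bounded_fun f -> bounded_fun g -> bounded_fun h ->
  ip h (f \- g) = ip h f - ip h g.
Proof. by move=> *; rewrite ipC ipBl// !(ipC h). Qed.

Lemma ipZr c f h : bounded_fun f -> bounded_fun h -> ip h (fun x => c * f x) = c * ip h f.
Proof. by move=> *; rewrite ipC ipZl// ipC. Qed.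

Lemma ip_suml (I : Type) (r : seq I) (f : I -> T -> R) h :
  (forall i, bounded_fun (f i)) -> bounded_fun h ->
  ip (fun x => \sum_(i <- r) f i x) h = \sum_(i <- r) ip (f i) h.
Proof.
move=> bf bh; elim: r => [|i r IH].
  rewrite big_nil /ip; under eq_Rintegral do rewrite big_nil mul0r.
  by rewrite Rintegral_cst// mul0r.
rewrite big_cons -IH -ipDl//; last exact: bounded_fun_sum.
by apply: eq_Rintegral => x _; rewrite big_cons.
Qed.

Lemma ip_ge0 f : 0 <= ip f f.
Proof. by apply: Rintegral_ge0 => x _; rewrite -expr2 sqr_ge0. Qed.

Lemma ip_sqrD f g : bounded_fun f -> bounded_fun g ->
  ip (f \+ g) (f \+ g) = ip f f + 2 * ip f g + ip g g.
Proof.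
move=> bf bg; have bfg := bounded_funD bf bg.
by rewrite ipDl// !ipDr// (ipC g f); ring.
Qed.

Lemma ip_sqrB f g : bounded_fun f -> bounded_fun g ->
  ip (f \- g) (f \- g) = ip f f - 2 * ip f g + ip g g.
Proof.
move=> bf bg; have bfg := bounded_funB bf bg.
by rewrite ipBl// !ipBr// (ipC g f); ring.
Qed.

Lemma ip_CS f g : bounded_fun f -> bounded_fun g -> ip f g ^+ 2 <= ip f f * ip g g.
Proof.
move=> bf bg; have key c : 0 <= ip f f - 2 * c * ip f g + c ^+ 2 * ip g g.
  have bcg := bounded_funZ c bg.
  have := ip_ge0 (f \- (fun x => c * g x)).
  rewrite ip_sqrB// ipZr// ipZl// ipZr// => h; apply: le_trans h _.
  by rewrite le_eqVlt; apply/orP; left; apply/eqP; ring.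
have [g0|gn0] := eqVneq (ip g g) 0.
  rewrite g0 mulr0 exprn_even_le0//=; apply/eqP; apply/eqP.
  apply/negPn/negP => fg0.
  (* When [ip g g = 0] the quadratic in [c] is affine, and this value of [c] would make it equal to
     -1. *)
  have := key ((ip f f + 1) / (2 * ip f g)); rewrite g0 mulr0 addr0.
  rewrite (_ : 2 * _ * _ = ip f f + 1); last by field.
  by rewrite opprD addrA subrr sub0r oppr_ge0 ler10.
have g0 : 0 < ip g g by rewrite lt0r gn0 ip_ge0.
have h := key (ip f g / ip g g); have := mulr_ge0 h (ltW g0).
move: gn0; move: (ip f f) (ip f g) (ip g g) => a b c c0.
have -> : (a - 2 * (b / c) * b + (b / c) ^+ 2 * c) * c = a * c - b ^+ 2 by field.
by rewrite subr_ge0.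
Qed.

Section Projection.
Variables (I : finType) (e : I -> T -> R).
Hypotheses (be : forall i, bounded_fun (e i))
  (e_orth : forall i j, i != j -> ip (e i) (e j) = 0)
  (e_norm : forall i f, bounded_fun f -> ip f (e i) * ip (e i) (e i) = ip f (e i)).

(** The hypothesis [e_norm] says that each [e i] is a unit vector or is orthogonal to every bounded
    function. Null vectors may thus stay in the family, which spares an exclusion of the harmonics
    built on sin 0. *)
Definition proj f x := \sum_i ip f (e i) * e i x.

Lemma bounded_fun_comb (c : I -> R) : bounded_fun (fun x => \sum_i c i * e i x).
Proof. by apply: bounded_fun_sum => i; exact: bounded_funZ. Qed.

Lemma bounded_fun_proj f : bounded_fun (proj f).
Proof. exact: bounded_fun_comb. Qed.

Lemma ip_combl c f : bounded_fun f ->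
  ip (fun x => \sum_i c i * e i x) f = \sum_i c i * ip (e i) f.
Proof.
move=> bf; rewrite ip_suml//; last by move=> i; exact: bounded_funZ.
by apply: eq_bigr => i _; rewrite ipZl.
Qed.

Lemma ip_proj_basis f j : bounded_fun f -> ip (proj f) (e j) = ip f (e j).
Proof.
move=> bf; rewrite /proj ip_combl// (bigD1 j)//= big1 ?addr0 ?e_norm// => i ij.
by rewrite e_orth// mulr0.
Qed.

Lemma ip_proj_comb f c : bounded_fun f ->
  ip (f \- proj f) (fun x => \sum_i c i * e i x) = 0.
Proof.
move=> bf; have bp := bounded_fun_proj f; have bb := bounded_funB bf bp.
rewrite ipC ip_combl// big1// => i _.
by rewrite ipC ipBl// ip_proj_basis// subrr mulr0.
Qed.

Lemma ip_projl f g : bounded_fun f -> bounded_fun g ->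
  ip (proj f) g = \sum_i ip f (e i) * ip g (e i).
Proof.
move=> bf bg; rewrite /proj ip_combl//; by apply: eq_bigr => i _; rewrite (ipC (e i)).
Qed.

Lemma ip_proj_proj f : bounded_fun f -> ip (proj f) (proj f) = \sum_i ip f (e i) ^+ 2.
Proof.
move=> bf; have bp := bounded_fun_proj f; rewrite ip_projl//.
by apply: eq_bigr => i _; rewrite ip_proj_basis// expr2.
Qed.

Lemma ip_proj_pythagoras f : bounded_fun f ->
  ip f f = \sum_i ip f (e i) ^+ 2 + ip (f \- proj f) (f \- proj f).
Proof.
move=> bf; have bp := bounded_fun_proj f; rewrite -ip_proj_proj// ip_sqrB//.
have := ip_proj_comb (fun i => ip f (e i)) bf; rewrite -/(proj f) ipBl// => /eqP.
by rewrite subr_eq0 => /eqP ->; ring.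
Qed.

Lemma bessel f : bounded_fun f -> \sum_i ip f (e i) ^+ 2 <= ip f f.
Proof. by move=> bf; rewrite (ip_proj_pythagoras bf) lerDl ip_ge0. Qed.

(** The competitor differs from [proj f] by a combination of the [e i], which is orthogonal to
    [f \- proj f]; Pythagoras concludes. *)
Lemma proj_best f c : bounded_fun f ->
  ip (f \- proj f) (f \- proj f) <=
  ip (f \- (fun x => \sum_i c i * e i x)) (f \- (fun x => \sum_i c i * e i x)).
Proof.
move=> bf; have bp := bounded_fun_proj f; have bc := bounded_fun_comb c.
set p := fun x => _; have bfp := bounded_funB bf bp.
have -> : f \- p = (f \- proj f) \+ (fun x => \sum_i (ip f (e i) - c i) * e i x).
  apply/funext => x /=; rewrite /p /proj -addrA; congr (_ + _).
  under [X in _ + X]eq_bigr do rewrite mulrBl; rewrite sumrB; ring.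
have bq := bounded_fun_comb (fun i => ip f (e i) - c i).
rewrite (ip_sqrD bfp bq).
by rewrite ip_proj_comb// mulr0 addr0 lerDl ip_ge0.
Qed.

End Projection.
End BoundedL2.

(** * Fubini's theorem on boxes *)

Section FubiniBox.
Context d1 d2 (X : measurableType d1) (Y : measurableType d2) (R : realType).
Variables (m1 : {sigma_finite_measure set X -> \bar R})
  (m2 : {sigma_finite_measure set Y -> \bar R}).
Variables (A : set X) (B : set Y) (f : X * Y -> R).
Hypotheses (mA : measurable A) (mB : measurable B)
  (fi : (m1 \x m2)%E.-integrable (A `*` B) (EFin \o f)).

Let g := (f \_ (A `*` B)).

Let gi : (m1 \x m2)%E.-integrable setT (EFin \o g).
Proof.
have mAB : measurable (A `*` B) by exact: measurableX.
by rewrite /g -restrict_EFin; apply/integrable_restrict => //; rewrite setTI.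
Qed.

Let gE x : A x -> (fun y => g (x, y)) = (fun y => f (x, y)) \_ B.
Proof.
move=> Ax; apply/funext => y; rewrite /g !patchE in_setX/=.
by rewrite (mem_set Ax).
Qed.

Let gN x : ~ A x -> (fun y => g (x, y)) = cst 0.
Proof.
move=> Ax; apply/funext => y; rewrite /g !patchE in_setX/=.
by rewrite (memNset Ax).
Qed.

Lemma fubini_box_ae : {ae m1, forall x, A x -> m2.-integrable B (EFin \o (fun y => f (x, y)))}.
Proof.
have := ae_integrable1 gi; apply: filterS => x h Ax.
apply/(integrable_mkcond _ mB); rewrite restrict_EFin -gE//; exact: h.
Qed.

Let FE : (fun x => \int[m2]_y (EFin \o g) (x, y))%E =
   (fun x => \int[m2]_(y in B) (f (x, y))%:E)%E \_ A.
Proof.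
apply/funext => x; rewrite patchE; case: ifPn => Ax.
  rewrite [RHS]integral_mkcond; apply: eq_integral => y _ /=.
  have /= -> := congr1 (@^~ y) (gE (set_mem Ax)).
  by rewrite !patchE; case: ifP.
apply: integral0_eq => y _ /=.
have /= -> // : g (x, y) = cst 0 y by rewrite -(gN (_ : ~ A x))//; rewrite notin_setE in Ax.
Qed.

Let Fi : m1.-integrable A (fun x => \int[m2]_(y in B) (f (x, y))%:E)%E.
Proof.
have := integrable_fubini_F gi; rewrite /fubini_F FE => h.
by apply/(integrable_mkcond _ mA).
Qed.

(** The real inner integral may differ from the extended one only on slices that are not integrable,
    and these form a null set. This turns Fubini's theorem into a statement about real integrals. *)
Let FfinE : {ae m1, forall x, A x ->
  (\int[m2]_(y in B) (f (x, y))%:E = (\int[m2]_(y in B) f (x, y))%:E)%E}.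
Proof.
have := fubini_box_ae; apply: filterS => x h Ax.
by rewrite /Rintegral fineK//; apply: integrable_fin_num => //; exact: h.
Qed.

Lemma fubini_box_integrable :
  m1.-integrable A (EFin \o (fun x => \int[m2]_(y in B) f (x, y))).
Proof.
apply/integrableP; have [mF Fo] := integrableP _ _ _ Fi.
have mF' : measurable_fun A (EFin \o (fun x => \int[m2]_(y in B) f (x, y))).
  by apply/measurable_EFinP; apply: measurableT_comp mF => //; exact: measurable_fine.
split => //; apply: le_lt_trans Fo; apply: ae_ge0_le_integral => //.
- exact: measurableT_comp.
- exact: measurableT_comp.
by have := FfinE; apply: filterS => x h Ax; rewrite h.
Qed.

Lemma fubini_box :
  \int[(m1 \x m2)%E]_(z in A `*` B) f z = \int[m1]_(x in A) \int[m2]_(y in B) f (x, y).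
Proof.
rewrite {1}/Rintegral integral_mkcond.
have -> : (\int[m1 \x m2]_x ((fun z => (f z)%:E) \_ (A `*` B)) x =
          \int[m1 \x m2]_z (EFin \o g) z)%E.
  by apply: eq_integral => z _; rewrite /= /g restrict_EFin.
rewrite -(integral12_prod_meas1 gi) /fubini_F FE -integral_mkcond.
rewrite /Rintegral; congr fine; apply: ae_eq_integral => //.
- exact: measurable_int Fi.
- exact: measurable_int fubini_box_integrable.
Qed.

End FubiniBox.

(** * The period cell and its area *)

Section Cell.
Context {R : realType}.

Lemma pi2_gt0 : 0 < 2 * pi :> R.
Proof. by rewrite mulr_gt0// pi_gt0. Qed.

Lemma measurable_cell : measurable (cell : set (measurableTypeR R * measurableTypeR R)).
Proof. by apply: measurableX; exact: measurable_itv. Qed.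

Lemma leb2_cell : leb2 (cell : set (measurableTypeR R * measurableTypeR R)) = ((2 * pi) ^+ 2)%:E.
Proof.
rewrite /leb2 product_measure1E//=.
rewrite !lebesgue_measure_itv/= lte_fin pi2_gt0 sube0 -EFinM.
by rewrite expr2.
Qed.

Lemma leb2_cell_lty : (leb2 (cell : set (measurableTypeR R * measurableTypeR R)) < +oo)%E.
Proof. by rewrite leb2_cell ltry. Qed.

End Cell.

(** * The real trigonometric basis *)

Section Harmonics.
Context {R : realType}.
Implicit Types (k l : nat * bool).

Notation leb := (@lebesgue_measure R).
Notation I2pi := (`[0, 2 * pi]%classic : set R).

Definition trig (b : bool) (y : R) : R := if b then sin y else cos y.

Lemma trig_le1 b y : `|trig b y| <= 1.
Proof. by case: b; [exact: sin_max|exact: cos_max]. Qed.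

(** The constant 1 has squared norm 2 pi on the period, while cos (n x) and sin (n x) with n > 0
    have squared norm pi. *)
Definition harm_const (n : nat) : R :=
  if n == 0%N then (Num.sqrt (2 * pi))^-1 else (Num.sqrt pi)^-1.

(* L_2(0, 2 pi)-orthonormal, except for harm (0, true) = 0. *)
Definition harm k (x : R) : R := harm_const k.1 * trig k.2 (k.1%:R * x).

(** The signs are those of sin' = cos and cos' = - sin: differentiation exchanges the two parities
    and multiplies by this signed frequency. *)
Definition harm_freq k : R := if k.2 then k.1%:R else - k.1%:R.

Definition flip k : nat * bool := (k.1, ~~ k.2).

Lemma is_derive_harm k x : is_derive x (1 : R) (harm k) (harm_freq k * harm (flip k) x).
Proof.
case: k => n b; rewrite /harm /harm_freq /=.
have dn : is_derive x (1 : R) (fun y : R => n%:R * y) n%:R.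
  by apply: is_derive_eq (is_deriveZ (n%:R : R) (is_derive_id x 1)) _; rewrite /GRing.scale /= mulr1.
have dt : is_derive x (1 : R) (fun y => trig b (n%:R * y))
    ((if b then n%:R else - n%:R) * trig (~~ b) (n%:R * x)).
  case: b => /=.
    by rewrite mulrC; apply: is_derive1_comp.
  by rewrite mulNr -mulrN mulrC; apply: is_derive1_comp.
apply: is_derive_eq (is_deriveZ (harm_const n) dt) _; rewrite /GRing.scale /=; ring.
Qed.

Lemma continuous_harm k : continuous (harm k).
Proof. exact: is_derive_continuous (is_derive_harm k). Qed.

Lemma trig_natD2pi b n (y : R) : trig b (n%:R * (y + 2 * pi)) = trig b (n%:R * y).
Proof.
have -> : n%:R * (y + 2 * pi) = n%:R * y + (pi *+ 2) *+ n :> R by ring.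
move: (n%:R * y) => z; elim: n z => [|m IH] z; first by rewrite mulr0n addr0.
rewrite mulrS addrCA addrA [_ + z]addrC IH.
by case: b {IH} => /=; [rewrite sinD2pi|rewrite cosD2pi].
Qed.

Lemma harm_periodic k x : harm k (x + 2 * pi) = harm k x.
Proof. by rewrite /harm trig_natD2pi. Qed.

(** The two hypotheses say that [r] is an integer without naming one; they hold both for sums and
    for possibly negative differences of frequencies. A nonzero [r] gives a primitive with equal
    values at both ends. *)
Lemma int_trig (b : bool) (r : R) : sin (r * (2 * pi)) = 0 -> cos (r * (2 * pi)) = 1 ->
  \int[leb]_(x in I2pi) trig b (r * x) = if r == 0 then (if b then 0 else 2 * pi) else 0.
Proof.
move=> s0 c1; have p0 := @pi2_gt0 R; case: eqP => [->|/eqP r0].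
  have -> : \int[leb]_(x in I2pi) trig b (0 * x) = \int[leb]_(x in I2pi) (if b then 0 else 1).
    by apply: eq_Rintegral => x _; rewrite mul0r; case: b; rewrite /= ?sin0 ?cos0.
  rewrite Rintegral_cst//= lebesgue_measure_itv/= lte_fin p0 sube0/=.
  by case: b; rewrite ?mul0r ?mul1r.
have dr x : is_derive x (1 : R) (fun y : R => r * y) r.
  by apply: is_derive_eq (is_deriveZ r (is_derive_id x 1)) _; rewrite /GRing.scale /= mulr1.
pose F x := r^-1 * (if b then - cos (r * x) else sin (r * x)).
have dF x : is_derive x (1 : R) F (trig b (r * x)).
  have dG : is_derive x (1 : R) (fun y => if b then - cos (r * y) else sin (r * y))
      (r * trig b (r * x)).
    rewrite mulrC {F}; case: b => /=; last exact: is_derive1_comp.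
    rewrite -[sin _]opprK mulNr; apply: is_deriveN; exact: is_derive1_comp.
  by apply: is_derive_eq (is_deriveZ r^-1 dG) _; rewrite /GRing.scale /= mulKf.
rewrite (Rintegral_FTC2 (ltW p0) dF); last first.
  move=> x; apply: differentiable_continuous; apply/derivable1_diffP.
  case: b {F dF} => /=.
    by have := is_derive1_comp (is_derive_sin (r * x)) (dr x); case.
  by have := is_derive1_comp (is_derive_cos (r * x)) (dr x); case.
rewrite /F mulr0 s0 c1 sin0 cos0; case: b {F dF}; ring.
Qed.

Lemma sin_nat2pi n : sin (n%:R * (2 * pi)) = 0 :> R.
Proof. by have := trig_natD2pi true n 0; rewrite /= add0r mulr0 sin0. Qed.

Lemma cos_nat2pi n : cos (n%:R * (2 * pi)) = 1 :> R.
Proof. by have := trig_natD2pi false n 0; rewrite /= add0r mulr0 cos0. Qed.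

Lemma int_trigD b n m : \int[leb]_(x in I2pi) trig b ((n%:R + m%:R) * x) =
  if (n + m == 0)%N then (if b then 0 else 2 * pi) else 0.
Proof.
rewrite -natrD int_trig ?sin_nat2pi ?cos_nat2pi//.
by rewrite pnatr_eq0.
Qed.

Lemma int_trigB b n m : \int[leb]_(x in I2pi) trig b ((n%:R - m%:R) * x) =
  if (n == m)%N then (if b then 0 else 2 * pi) else 0.
Proof.
rewrite int_trig ?subr_eq0 ?eqr_nat//; rewrite mulrBl ?sinB ?cosB.
  by rewrite !sin_nat2pi !cos_nat2pi; ring.
by rewrite !sin_nat2pi !cos_nat2pi; ring.
Qed.

Lemma continuous_trigM b (r : R) : continuous (fun x : R => trig b (r * x)).
Proof.
move=> x; apply: (@continuous_comp _ _ _ (fun x => r * x) (trig b)).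
  by apply: cvgM; [exact: cvg_cst|exact: cvg_id].
by case: b; [exact: continuous_sin|exact: continuous_cos].
Qed.

Lemma continuous_I2pi_integrable (f : R -> R) : continuous f -> leb.-integrable I2pi (EFin \o f).
Proof.
move=> cf; apply: continuous_compact_integrable; first exact: segment_compact.
exact: continuous_subspaceT.
Qed.

(** The product-to-sum formulas reduce the product to frequencies n + m and n - m, with [d], [s],
    [t] depending on the parities. For n = m = 0 both terms contribute: they add up to 2 pi for two
    cosines and cancel for two sines. *)
Lemma int_trig_trig b c n m : \int[leb]_(x in I2pi) (trig b (n%:R * x) * trig c (m%:R * x)) =
  if (n == m) && (b == c) then (if n == 0%N then (if b then 0 else 2 * pi) else pi) else 0.
Proof.
have key (d : bool) (s t : R) :
  \int[leb]_(x in I2pi) (s * trig d ((n%:R + m%:R) * x) + t * trig d ((n%:R - m%:R) * x)) =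
    s * (if (n + m == 0)%N then (if d then 0 else 2 * pi) else 0) +
    t * (if (n == m)%N then (if d then 0 else 2 * pi) else 0).
  rewrite RintegralD//; last 2 first.
  - apply: continuous_I2pi_integrable => x.
    by apply: cvgM; [exact: cvg_cst|exact: continuous_trigM].
  - apply: continuous_I2pi_integrable => x.
    by apply: cvgM; [exact: cvg_cst|exact: continuous_trigM].
  rewrite !RintegralZl ?int_trigD ?int_trigB//;
    by apply: continuous_I2pi_integrable; exact: continuous_trigM.
have E (d : bool) (s t : R) : (forall x, trig b (n%:R * x) * trig c (m%:R * x) =
     s * trig d ((n%:R + m%:R) * x) + t * trig d ((n%:R - m%:R) * x)) ->
   \int[leb]_(x in I2pi) (trig b (n%:R * x) * trig c (m%:R * x)) =
   s * (if (n + m == 0)%N then (if d then 0 else 2 * pi) else 0) +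
    t * (if (n == m)%N then (if d then 0 else 2 * pi) else 0).
  by move=> h; rewrite -key; apply: eq_Rintegral => x _.
have nm0 : (n + m == 0)%N = (n == m) && (n == 0%N) by clear; case: n m => [|n] [|m]; rewrite ?andbF.
case: b c E => -[] E.
- rewrite (E false (- 2^-1) 2^-1).
    by rewrite nm0 andbT; case: (n == m); case: (n == 0%N) => /=; field.
  by move=> x /=; rewrite mulrDl mulrBl cosD cosB; field.
- rewrite (E true 2^-1 2^-1) ?andbF/=; first by do !case: ifP => _; ring.
  by move=> x /=; rewrite mulrDl mulrBl sinD sinB; field.
- rewrite (E true 2^-1 (- 2^-1)) ?andbF/=; first by do !case: ifP => _; ring.
  by move=> x /=; rewrite mulrDl mulrBl sinD sinB; field.
- rewrite (E false (2^-1) 2^-1).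
    by rewrite nm0 andbT; case: (n == m); case: (n == 0%N) => /=; field.
  by move=> x /=; rewrite mulrDl mulrBl cosD cosB; field.
Qed.

Lemma int_harm_harm k l : \int[leb]_(x in I2pi) (harm k x * harm l x) =
  ((k == l) && (k != (0%N, true)))%:R.
Proof.
case: k l => n b [m c]; rewrite /harm /=.
have -> : \int[leb]_(x in I2pi) (harm_const n * trig b (n%:R * x) * (harm_const m * trig c (m%:R * x)))
  = \int[leb]_(x in I2pi) ((harm_const n * harm_const m) * (trig b (n%:R * x) * trig c (m%:R * x))).
  by apply: eq_Rintegral => x _; ring.
rewrite RintegralZl//; last first.
  apply: continuous_I2pi_integrable => x.
  by apply: cvgM; exact: continuous_trigM.
rewrite int_trig_trig !xpair_eqE; case: eqP => [<-|_]; last by rewrite /= mulr0.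
case: (b =P c) => [_|_]; last by rewrite /= mulr0.
have p0 : 0 < pi :> R by exact: pi_gt0.
rewrite /harm_const /=; case: n => [|n] /=.
  case: b; rewrite /= ?mulr0// -invfM -expr2 sqr_sqrtr ?(ltW pi2_gt0)//.
  by rewrite mulVf// gt_eqF// pi2_gt0.
by rewrite -invfM -expr2 sqr_sqrtr ?(ltW p0)// mulVf// gt_eqF.
Qed.

Lemma harm0true x : harm (0%N, true) x = 0.
Proof. by rewrite /harm /= mul0r sin0 mulr0. Qed.

End Harmonics.

(** * Harmonics on the torus, truncation, and coefficients of weak derivatives *)

Section Torus.
Context {R : realType}.
Local Notation mode := ((nat * bool) * (nat * bool))%type.
Implicit Types (k l : mode) (i : 'I_2) (u g : R * R -> R).

Notation leb := (@lebesgue_measure R).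

Definition harm2 k (x : R * R) : R := harm k.1 x.1 * harm k.2 x.2.

Definition flip2 i k : mode := if i == 0 then (flip k.1, k.2) else (k.1, flip k.2).

Definition freq i k : R := harm_freq (if i == 0 then k.1 else k.2).

Lemma flip2K i : involutive (flip2 i).
Proof.
by move=> [[n b] [m c]]; rewrite /flip2; case: (i == 0); rewrite /flip /= negbK.
Qed.

Lemma freq_flip2 i k : freq i (flip2 i k) = - freq i k.
Proof.
case: k => [[n b] [m c]]; rewrite /freq /flip2; case: (i == 0) => /=.
  by rewrite /harm_freq /=; case: b; rewrite ?opprK.
by rewrite /harm_freq /=; case: c; rewrite ?opprK.
Qed.

Lemma is_derive_harm2 i k (x : R * R) :
  is_derive x (space_dir i) (harm2 k) (freq i k * harm2 (flip2 i k) x).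
Proof.
have d1 : is_derive x (space_dir i) (fun z : R * R => harm k.1 z.1)
    ((i == 0)%:R * (harm_freq k.1 * harm (flip k.1) x.1)).
  have := is_derive_comp_affine (L := fst) 0 x (space_dir i) (fun _ _ _ => erefl) (is_derive_harm k.1).
  by rewrite addr0; under eq_fun do rewrite addr0.
have d2 : is_derive x (space_dir i) (fun z : R * R => harm k.2 z.2)
    ((i == 1)%:R * (harm_freq k.2 * harm (flip k.2) x.2)).
  have := is_derive_comp_affine (L := snd) 0 x (space_dir i) (fun _ _ _ => erefl) (is_derive_harm k.2).
  by rewrite addr0; under eq_fun do rewrite addr0.
apply: is_derive_eq (is_deriveM d1 d2) _; rewrite /freq /flip2 /harm2 /GRing.scale /=.
by case: i {d1 d2} => -[|[|//]] ? /=; ring.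
Qed.

Lemma derive_harm2 i k : 'D_(space_dir i) (harm2 k) = (fun x => freq i k * harm2 (flip2 i k) x).
Proof. by apply/funext => x; case: (is_derive_harm2 i k x). Qed.

(** The m-th derivative of the cosine. The sine is the third one, so a single sequence of
    derivatives serves both parities in [Ck_comp_affine]. *)
Definition dtrig (m : nat) (y : R) : R := cos (y + m%:R * (pi / 2)).

Lemma is_derive_dtrig m (y : R) : is_derive y (1 : R) (dtrig m) (dtrig m.+1 y).
Proof.
have -> : dtrig m.+1 y = 1 * (- sin (id y + m%:R * (pi / 2))).
  by rewrite /dtrig -cosDpihalf mul1r; congr cos; ring.
apply: (is_derive_comp_affine (L := id)) => //.
Qed.

Lemma trig_dtrig b (y : R) : trig b y = dtrig (if b then 3 else 0) y.
Proof.
rewrite /dtrig; case: b => /=; last by rewrite mul0r addr0.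
rewrite (_ : _ + _ = y - pi / 2 + pi *+ 2); last by field.
by rewrite cosD2pi cosBpihalf.
Qed.

Lemma Ck_harm {V : normedModType R} (L : V -> R) (kk : nat * bool) n :
  (forall (h : R) (u v : V), L (h *: u + v) = h * L u + L v) -> continuous L ->
  Ck n (fun z => harm kk (L z)).
Proof.
move=> Lin Lc; apply: CkZ.
have -> : (fun z => trig kk.2 (kk.1%:R * L z)) =
   (fun z => dtrig (if kk.2 then 3 else 0) ((fun z => kk.1%:R * L z) z + 0)).
  by apply/funext => z; rewrite addr0 trig_dtrig.
apply: Ck_comp_affine; last by move=> *; exact: is_derive_dtrig.
  by move=> h u v; rewrite Lin; ring.
by move=> z; apply: cvgM; [exact: cvg_cst|exact: Lc].
Qed.

Lemma periodic2_harm2 k : periodic2 (harm2 k).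
Proof. by move=> x1 x2; rewrite /harm2 /= !harm_periodic. Qed.

Lemma test_torus_harm2 k : test_torus (harm2 k).
Proof.
split; first exact: periodic2_harm2.
move=> n; apply: CkM; apply: Ck_harm => //.
  by move=> x; exact: cvg_fst.
by move=> x; exact: cvg_snd.
Qed.

Lemma test_torus_comb (I : finType) (c : I -> R) (f : I -> R * R -> R) :
  (forall j, test_torus (f j)) -> test_torus (fun x => \sum_j c j * f j x).
Proof.
move=> h; split.
  by move=> x1 x2; split; apply: eq_bigr => j _; have [/(_ x1 x2)[h1 h2] _] := h j; rewrite ?h1 ?h2.
by move=> n; apply: Ck_sum => j; apply: CkZ; case: (h j).
Qed.

Lemma measurable_harm2 k : measurable_fun setT (harm2 k).
Proof.
apply: measurable_funM.
  apply: measurableT_comp; last exact: measurable_fst.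
  by apply: continuous_measurable_fun; exact: continuous_harm.
apply: measurableT_comp; last exact: measurable_snd.
by apply: continuous_measurable_fun; exact: continuous_harm.
Qed.

Definition harm2_bound k : R := `|harm_const k.1.1| * `|harm_const k.2.1|.

Lemma harm2_le k x : `|harm2 k x| <= harm2_bound k.
Proof.
rewrite /harm2 /harm2_bound !normrM.
by apply: ler_pM => //; rewrite ?ler_piMr// trig_le1.
Qed.

Notation bounded := (bounded_fun leb2 cell).
Notation "'<|' f , g '|>'" := (ip leb2 cell f g).

Lemma bounded_harm2 k : bounded (harm2 k).
Proof.
apply: (@bounded_fun_everywhere _ _ _ _ _ _ (harm2_bound k)).
  apply: measurable_funTS; exact: measurable_harm2.
by move=> x _; exact: harm2_le.
Qed.

Lemma ip_harm2 k l : <| harm2 k, harm2 l |> =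
  ((k == l) && (k.1 != (0%N, true)) && (k.2 != (0%N, true)))%:R.
Proof.
have bi := bounded_fun_integrable measurable_cell leb2_cell_lty
  (bounded_funM (bounded_harm2 k) (bounded_harm2 l)).
rewrite /ip /leb2 fubini_box//.
under eq_Rintegral => x _.
  rewrite (_ : \int[_]_(y in _) _ = (harm k.1 x * harm l.1 x) *
      \int[leb]_(y in `[0%R, 2 * pi]) (harm k.2 y * harm l.2 y)).
    over.
  rewrite -RintegralZl//; last first.
    apply: continuous_I2pi_integrable => y; apply: cvgM; exact: continuous_harm.
  by apply: eq_Rintegral => y _; rewrite /harm2 /=; ring.
rewrite RintegralZr//; last first.
  apply: continuous_I2pi_integrable => y; apply: cvgM; exact: continuous_harm.
rewrite !int_harm_harm -natrM mulnb.
case: k l {bi} => k1 k2 [l1 l2]; rewrite xpair_eqE /=.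
by congr ((nat_of_bool _)%:R); case: (k1 == l1); case: (k2 == l2) => /=; rewrite ?andbF ?andbT.
Qed.

Lemma ip_harm2_orth k l : k != l -> <| harm2 k, harm2 l |> = 0.
Proof. by rewrite ip_harm2 => /negbTE ->. Qed.

Lemma ip_harm2_norm k u : <| u, harm2 k |> * <| harm2 k, harm2 k |> = <| u, harm2 k |>.
Proof.
rewrite ip_harm2 eqxx /=; case: (boolP (_ && _)) => h; first by rewrite mulr1.
rewrite mulr0 /ip; apply/esym.
under eq_Rintegral => x _.
  rewrite (_ : harm2 k x = 0) ?mulr0; first by over.
  case: k h => k1 k2; rewrite /harm2 /= negb_and !negbK => /orP[] /eqP ->.
    by rewrite harm0true mul0r.
  by rewrite harm0true mulr0.
by rewrite Rintegral_cst ?mul0r//; exact: measurable_cell.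
Qed.

(** Both parities are kept for every frequency below N, so that the set of modes is closed under the
    flips caused by differentiation. *)
Definition modes (N : nat) := (('I_N * bool) * ('I_N * bool))%type.

Definition mode_val (N : nat) (k : modes N) : mode :=
  ((k.1.1 : nat, k.1.2), (k.2.1 : nat, k.2.2)).

Lemma mode_val_inj N : injective (@mode_val N).
Proof.
by move=> [[n b] [m c]] [[n' b'] [m' c']] [/val_inj -> -> /val_inj -> ->].
Qed.

Definition harmN N (k : modes N) := harm2 (mode_val k).

Definition fproj N := proj leb2 cell (@harmN N).

Lemma bounded_harmN N (k : modes N) : bounded (harmN k).
Proof. exact: bounded_harm2. Qed.

Lemma harmN_orth N (j k : modes N) : j != k -> <| harmN j, harmN k |> = 0.
Proof.
move=> jk; apply: ip_harm2_orth; apply: contra jk => /eqP h; apply/eqP; exact: mode_val_inj.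
Qed.

Lemma harmN_norm N (k : modes N) u : bounded u ->
  <| u, harmN k |> * <| harmN k, harmN k |> = <| u, harmN k |>.
Proof. by move=> _; exact: ip_harm2_norm. Qed.

Lemma bounded_fproj N u : bounded (fproj N u).
Proof. by apply: bounded_fun_proj => k; exact: bounded_harmN. Qed.

Lemma test_torus_fproj N u : test_torus (fproj N u).
Proof. by apply: test_torus_comb => k; exact: test_torus_harm2. Qed.

Definition flipN N i (k : modes N) : modes N :=
  if i == 0 then ((k.1.1, ~~ k.1.2), k.2) else (k.1, (k.2.1, ~~ k.2.2)).

Lemma mode_val_flipN N i (k : modes N) : mode_val (flipN i k) = flip2 i (mode_val k).
Proof. by rewrite /flipN /flip2; case: ifP. Qed.

Lemma flipNK N i : involutive (@flipN N i).
Proof.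
by move=> k; apply: mode_val_inj; rewrite !mode_val_flipN flip2K.
Qed.

Lemma is_derive_comb N (c : modes N -> R) i x :
  is_derive x (space_dir i) (fun x => \sum_k c k * harmN k x)
    (\sum_k c k * (freq i (mode_val k) * harm2 (flip2 i (mode_val k)) x)).
Proof.
have h : forall (s : seq (modes N)), is_derive x (space_dir i) (fun x => \sum_(k <- s) c k * harmN k x)
    (\sum_(k <- s) c k * (freq i (mode_val k) * harm2 (flip2 i (mode_val k)) x)).
  elim => [|k s IH].
    by rewrite big_nil; under eq_fun do rewrite big_nil; exact: is_derive_cst.
  rewrite big_cons; under eq_fun do rewrite big_cons.
  by apply: is_deriveD; exact: (is_deriveZ (c k) (is_derive_harm2 i (mode_val k) x)).
exact: h.
Qed.

Lemma L1_torusM u phi : L1_torus u -> bounded phi -> leb2.-integrable cell (EFin \o (u \* phi)).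
Proof. by move=> [_ ui] bphi; exact: (integrable_bounded_funM measurable_cell). Qed.

(** A weak derivative tested on harmonics alone. In this form it passes to differences by linearity
    of the coefficients, and by uniqueness of Fourier coefficients it still determines the
    derivative almost everywhere. *)
Definition coef_partial i u g := forall k,
  <| g, harm2 k |> = - (freq i k * <| u, harm2 (flip2 i k) |>).

Lemma weak_partial_coef i u g : weak_partial i u g -> coef_partial i u g.
Proof.
move=> + k => -[Lu Lg /(_ _ (test_torus_harm2 k))].
rewrite (_ : \int[_]_(x in _) _ = freq i k * <| u, harm2 (flip2 i k) |>).
  by move=> ->; rewrite opprK.
rewrite -RintegralZl//; first by apply: eq_Rintegral => x _; have [_ ->] := is_derive_harm2 i k x; ring.
  exact: measurable_cell.
exact: L1_torusM (bounded_harm2 _).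
Qed.

(** Truncation commutes with differentiation: reindexing the sum by [flipN] turns the coefficients
    of [g] into those of [u], the sign of the integration by parts being compensated by
    [freq_flip2]. *)
Lemma is_derive_fproj N i u g x : coef_partial i u g ->
  is_derive x (space_dir i) (fproj N u) (fproj N g x).
Proof.
move=> wug; suff -> : fproj N g x = \sum_(k : modes N) <| u, harmN k |> *
   (freq i (mode_val k) * harm2 (flip2 i (mode_val k)) x) by exact: is_derive_comb.
rewrite /fproj /proj (reindex_inj (inv_inj (@flipNK N i))) /=.
apply: eq_bigr => k _; rewrite /harmN mode_val_flipN.
by rewrite wug freq_flip2 flip2K; ring.
Qed.

Definition eigen k : R := \sum_(i < 2) freq i k ^+ 2.

Lemma laplacian_harm2 k x :
  \sum_(i < 2) 'D_(space_dir i) ('D_(space_dir i) (harm2 k)) x = - (eigen k * harm2 k x).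
Proof.
rewrite /eigen mulr_suml -sumrN; apply: eq_bigr => i _.
rewrite derive_harm2.
have [_ ->] := is_deriveZ (freq i k) (is_derive_harm2 i (flip2 i k) x).
by rewrite freq_flip2 flip2K /GRing.scale /=; ring.
Qed.

Lemma weak_laplacian_coef u g k : weak_laplacian u g ->
  <| g, harm2 k |> = - (eigen k * <| u, harm2 k |>).
Proof.
move=> [Lu Lg /(_ _ (test_torus_harm2 k))].
rewrite (_ : \int[_]_(x in _) _ = - eigen k * <| u, harm2 k |>).
  by rewrite mulNr => ->.
rewrite -RintegralZl//; first by apply: eq_Rintegral => x _; rewrite laplacian_harm2; ring.
  exact: measurable_cell.
exact: L1_torusM (bounded_harm2 _).
Qed.

(** If both frequencies are 0 the harmonic is constant and the mean-zero condition kills the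
    coefficient. Otherwise the eigenvalue n^2 + m^2 is a positive integer, hence at least 1. *)
Lemma poincare_coef u k : \int[leb2]_(x in cell) u x = 0 -> leb2.-integrable cell (EFin \o u) ->
  <| u, harm2 k |> ^+ 2 <= eigen k * <| u, harm2 k |> ^+ 2.
Proof.
move=> u0 ui.
have [k0|k0] := eqVneq (k.1.1 + k.2.1)%N 0%N.
  suff -> : <| u, harm2 k |> = 0 by rewrite expr0n mulr0.
  have [c hc] : exists c, forall x, harm2 k x = c.
    exists (harm2 k (0, 0)) => x; move: k0 => /eqP; rewrite addn_eq0 => /andP[/eqP k1 /eqP k2].
    by rewrite /harm2 /harm k1 k2 !mul0r.
  rewrite /ip; under eq_Rintegral do rewrite hc.
  by rewrite RintegralZr ?u0 ?mul0r//; exact: measurable_cell.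
suff h : 1 <= eigen k by rewrite -[leLHS]mul1r ler_wpM2r// sqr_ge0.
have E : eigen k = k.1.1%:R ^+ 2 + k.2.1%:R ^+ 2.
  rewrite /eigen big_ord_recl big_ord1 /freq /=.
  by rewrite /harm_freq; case: (k.1.2); case: (k.2.2); rewrite ?sqrrN.
rewrite E -!natrX -natrD ler1n; move: k0; rewrite -lt0n.
by case: (k.1.1) => [|n]; case: (k.2.1) => [|m].
Qed.

End Torus.

(** * Density of trigonometric polynomials *)

Section TrigPoly1.
Context {R : realType}.
Implicit Types (p q f g : R -> R).

Inductive tpoly1 : (R -> R) -> Prop :=
| tpoly1_trig n b : tpoly1 (fun x => trig b (n%:R * x))
| tpoly1_D f g : tpoly1 f -> tpoly1 g -> tpoly1 (f \+ g)
| tpoly1_Z c f : tpoly1 f -> tpoly1 (fun x => c * f x).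

Lemma tpoly1_lin f g a b : tpoly1 f -> tpoly1 g -> tpoly1 (fun x => a * f x + b * g x).
Proof. by move=> tf tg; apply: tpoly1_D; exact: tpoly1_Z. Qed.

Lemma tpoly1_cst (c : R) : tpoly1 (fun=> c).
Proof.
have := tpoly1_Z c (tpoly1_trig 0 false).
by congr tpoly1; apply/funext => x; rewrite /= mul0r cos0 mulr1.
Qed.

(** Multiplying frequency n + 1 by a harmonic of frequency 1 gives the frequencies n and n + 2, so
    negative frequencies never arise; frequency 0 is treated apart. *)
Lemma tpoly1_trigM b f : tpoly1 f -> tpoly1 (fun x => trig b x * f x).
Proof.
elim=> [n c|{}f g _ IHf _ IHg|c {}f _ IHf].
- case: n => [|n].
    rewrite (_ : (fun x => _) = (fun x => trig c 0 * trig b (1%:R * x))).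
      by apply: tpoly1_Z; exact: tpoly1_trig.
    by apply/funext => x; rewrite mul0r mul1r mulrC.
  have E (d : bool) (s t : R) : (forall x, trig b x * trig c (n.+1%:R * x) =
     s * trig d (n%:R * x) + t * trig d (n.+2%:R * x)) ->
     tpoly1 (fun x => trig b x * trig c (n.+1%:R * x)).
    move=> h; under eq_fun do rewrite h; apply: tpoly1_lin; exact: tpoly1_trig.
  have e1 (x : R) : n%:R * x = n.+1%:R * x - x by rewrite -natr1; ring.
  have e2 (x : R) : n.+2%:R * x = n.+1%:R * x + x by rewrite -[n.+2%:R]natr1; ring.
  case: b c E => -[] E.
  + apply: (E false 2^-1 (- 2^-1)) => x; rewrite e1 e2 /= cosB cosD; field => //.
  + apply: (E true (- 2^-1) (2^-1)) => x; rewrite e1 e2 /= sinB sinD; field => //.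
  + apply: (E true (2^-1) (2^-1)) => x; rewrite e1 e2 /= sinB sinD; field => //.
  + apply: (E false (2^-1) (2^-1)) => x; rewrite e1 e2 /= cosB cosD; field => //.
- rewrite (_ : (fun x => _) = (fun x => trig b x * f x) \+ (fun x => trig b x * g x)).
    exact: tpoly1_D.
  by apply/funext => x /=; rewrite mulrDr.
- rewrite (_ : (fun x => _) = (fun x => c * (trig b x * f x))); first exact: tpoly1_Z.
  by apply/funext => x /=; rewrite mulrCA.
Qed.

Lemma tpoly1_cosM (a b c : R) f : tpoly1 f -> tpoly1 (fun x => (a + b * cos (x - c)) * f x).
Proof.
move=> tf; have t1 := tpoly1_trigM false tf; have t2 := tpoly1_trigM true tf.
have := tpoly1_D (tpoly1_Z a tf) (tpoly1_lin (b * cos c) (b * sin c) t1 t2).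
by congr tpoly1; apply/funext => x /=; rewrite cosB; ring.
Qed.

Lemma tpoly1_exprM p n f : (forall g, tpoly1 g -> tpoly1 (p \* g)) -> tpoly1 f ->
  tpoly1 (fun x => p x ^+ n * f x).
Proof.
move=> hp tf; elim: n => [|n IH]; first by under eq_fun do rewrite expr0 mul1r.
by under eq_fun do rewrite exprS -mulrA; exact: hp IH.
Qed.

Lemma bernoulli_le (t : R) m : 0 <= t <= 1 -> 1 - m%:R * t <= (1 - t) ^+ m.
Proof.
move=> /andP[t0 t1]; elim: m => [|m IH]; first by rewrite mul0r subr0 expr0.
rewrite exprS; apply: (@le_trans _ _ ((1 - t) * (1 - m%:R * t))); last first.
  by rewrite ler_wpM2l// subr_ge0.
rewrite -subr_ge0 (_ : _ - _ = m%:R * t ^+ 2); first by rewrite mulr_ge0// sqr_ge0.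
by rewrite -natr1; ring.
Qed.

Lemma bernoulli_ge (t : R) m : 0 <= t -> 1 + m%:R * t <= (1 + t) ^+ m.
Proof.
move=> t0; elim: m => [|m IH]; first by rewrite mul0r addr0 expr0.
rewrite exprS; apply: (@le_trans _ _ ((1 + t) * (1 + m%:R * t))); last first.
  by rewrite ler_wpM2l// addr_ge0.
rewrite -subr_ge0 (_ : _ - _ = m%:R * t ^+ 2); first by rewrite mulr_ge0// sqr_ge0.
by rewrite -natr1; ring.
Qed.

(* The Brosowski-Deutsch polynomials (1 - t^n)^(K^n) converge to the indicator of K t < 1. *)
Definition brosowski (K n : nat) (t : R) := (1 - t ^+ n) ^+ (K ^ n)%N.

Lemma brosowski_itv K n t : 0 <= t <= 1 -> 0 <= brosowski K n t <= 1.
Proof.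
move=> /andP[t0 t1]; have h : 0 <= 1 - t ^+ n <= 1.
  by rewrite subr_ge0 exprn_ile1//= lerBlDr lerDl exprn_ge0.
case/andP: h => h0 h1.
by rewrite /brosowski exprn_ge0//= exprn_ile1.
Qed.

(** Bernoulli's inequality bounds the polynomial below by 1 - (K t)^n. *)
Lemma brosowski_cvg1 K t : 0 <= t <= 1 -> K%:R * t < 1 ->
  brosowski K n t @[n --> \oo] --> (1 : R).
Proof.
move=> t01 Kt; have /andP[t0 t1] := t01.
apply: (@squeeze_cvgr _ _ _ _ (fun n => 1 - (K%:R * t) ^+ n) (cst 1)).
- near=> n; rewrite (andP (brosowski_itv K n t01)).2 andbT.
  rewrite exprMn -natrX; apply: bernoulli_le.
  by rewrite exprn_ge0//= exprn_ile1.
- rewrite -[X in _ --> X]subr0; apply: cvgB; first exact: cvg_cst.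
  by apply: cvg_expr; rewrite ger0_norm// mulr_ge0.
- exact: cvg_cst.
Unshelve. all: by end_near. Qed.

(** With s = t^n and m = K^n, the product (1 - s)^m (1 + s)^m is at most 1, while (1 + s)^m >= m s =
    (K t)^n; so the polynomial is at most (K t)^(-n). *)
Lemma brosowski_cvg0 K t : 0 <= t <= 1 -> 1 < K%:R * t ->
  brosowski K n t @[n --> \oo] --> (0 : R).
Proof.
move=> t01 Kt; have /andP[t0 t1] := t01.
have Kt0 : 0 < K%:R * t by apply: lt_trans Kt.
apply: (@squeeze_cvgr _ _ _ _ (cst 0) (fun n => (K%:R * t)^-1 ^+ n)).
- near=> n; rewrite (andP (brosowski_itv K n t01)).1/=.
  rewrite exprVn -[leRHS]mul1r ler_pdivlMr ?exprn_gt0//.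
  have s0 : 0 <= t ^+ n by rewrite exprn_ge0.
  have s1 : t ^+ n <= 1 by rewrite exprn_ile1.
  apply: (@le_trans _ _ ((1 - t ^+ n) ^+ (K ^ n)%N * (1 + t ^+ n) ^+ (K ^ n)%N)).
    rewrite ler_wpM2l ?exprn_ge0 ?subr_ge0//.
    apply: le_trans (bernoulli_ge _ s0); rewrite exprMn -natrX lerDr//.
  rewrite -exprMn exprn_ile1//.
    by rewrite mulr_ge0 ?subr_ge0 ?addr_ge0.
  by rewrite (_ : _ * _ = 1 - (t ^+ n) ^+ 2) ?lerBlDr ?lerDl ?sqr_ge0//; ring.
- exact: cvg_cst.
- apply: cvg_expr; rewrite ger0_norm ?invr_ge0 ?ltW//.
  by rewrite invf_lt1.
Unshelve. all: by end_near. Qed.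

Lemma cos_near_lt (r y : R) : 0 <= r <= pi -> `|y| < r -> cos r < cos y.
Proof.
move=> /andP[r0 rpi] yr; rewrite -(cos_norm y) ltr_cos// in_itv/= ?r0 ?rpi//.
by rewrite normr_ge0/= (le_trans (ltW yr)).
Qed.

Lemma cos_far_lt (r y : R) : 0 <= r <= pi -> r < `|y| -> `|y| < 2 * pi - r -> cos y < cos r.
Proof.
move=> r0pi ry yr; have [ypi|piy] := leP `|y| pi.
  rewrite -(cos_norm y) ltr_cos// in_itv/= ?normr_ge0//.
have -> : cos y = cos (2 * pi - `|y|).
  rewrite -(cos_norm y) (_ : 2 * pi - `|y| = - `|y| + pi *+ 2); last by ring.
  by rewrite cosD2pi cosN.
by rewrite ltr_cos// ?in_itv/=; lra.
Qed.

(** Inside the period, the ray from [a] is the arc from [a] to 2 pi. A function of the form A + B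
    cos (x - c) measures the distance to the midpoint of that arc, and the Brosowski-Deutsch
    polynomials sharpen it into an indicator. *)
Lemma tpoly1_ray (a : R) : exists q : nat -> R -> R,
  [/\ forall n, tpoly1 (q n), forall n x, 0 <= q n x <= 1 &
   forall x, 0 < x < 2 * pi -> x != a -> q n x @[n --> \oo] --> (\1_(`[a, +oo[%classic) x : R)].
Proof.
have [a0|a0] := leP a 0.
  exists (fun=> cst 1); split; [by move=> n; exact: tpoly1_cst|by move=> n x; rewrite /= ler01 lexx|].
  move=> x /andP[x0 _] _; rewrite indicE mem_set/=; first exact: cvg_cst.
  by rewrite in_itv/= andbT (le_trans a0)// ltW.
have [a1|a1] := leP (2 * pi) a.
  exists (fun=> cst 0); split; [by move=> n; exact: tpoly1_cst|by move=> n x; rewrite /= ler01 lexx|].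
  move=> x /andP[_ x1] _; rewrite indicE memNset/=; first exact: cvg_cst.
  by rewrite in_itv/= andbT; apply/negP; rewrite -ltNge (lt_le_trans x1).
(* [c] is the midpoint and [r] half the length of the arc [a, 2 pi]; being on the arc means cos (x -
   c) >= cos r. *)
pose c := (a + 2 * pi) / 2; pose r := (2 * pi - a) / 2.
have r0 : 0 < r by rewrite /r; lra.
have rpi : 0 <= r <= pi by rewrite /r; lra.
have cr : 0 < 1 - cos r by rewrite subr_gt0 -cos0 cos_near_lt// normr0.
(* [K] is large enough to keep [p], whose numerator is at most 2, below 1; its multiple [K p]
   crosses 1 exactly where cos (x - c) crosses cos r. *)
pose K := (Num.truncn (2 / (1 - cos r))).+1.
have K0 : 0 < K%:R :> R by rewrite ltr0n.
have KE : 2 <= K%:R * (1 - cos r).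
  rewrite -ler_pdivrMr// ltW//; exact: truncnS_gt.
pose p x := (K%:R * (1 - cos r))^-1 + (- (K%:R * (1 - cos r))^-1) * cos (x - c).
have pE x : p x = (1 - cos (x - c)) / (K%:R * (1 - cos r)) by rewrite /p; ring.
have Kc0 : 0 < K%:R * (1 - cos r) by rewrite mulr_gt0.
have p01 x : 0 <= p x <= 1.
  rewrite pE divr_ge0 ?(ltW Kc0) ?subr_ge0 ?cos_le1//=.
  rewrite ler_pdivrMr// mul1r; apply: le_trans KE.
  by have := cos_geN1 (x - c); lra.
have Kp x : K%:R * p x = (1 - cos (x - c)) / (1 - cos r).
  by rewrite pE; field; rewrite !gt_eqF.
exists (fun n x => brosowski K n (p x)); split.
- move=> n; have tp g : tpoly1 g -> tpoly1 (p \* g) by exact: tpoly1_cosM.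
  have tq g : tpoly1 g -> tpoly1 ((fun x => 1 - p x ^+ n) \* g).
    move=> tg; have := tpoly1_lin 1 (-1) tg (tpoly1_exprM n tp tg).
    by congr tpoly1; apply/funext => x /=; ring.
  have := tpoly1_exprM (K ^ n) tq (tpoly1_cst 1).
  by congr tpoly1; apply/funext => x /=; rewrite mulr1.
- by move=> n x; exact: brosowski_itv.
- move=> x /andP[x0 x1] xa; rewrite indicE; have [ax|xa'] := leP a x.
    rewrite mem_set/= ?in_itv/= ?ax//; apply: brosowski_cvg1 => //.
    rewrite Kp ltr_pdivrMr// mul1r ltrD2l ltrN2.
    apply: cos_near_lt => //; have {xa}ax : a < x by rewrite lt_neqAle eq_sym xa.
    by rewrite ltr_norml /c /r; lra.
  rewrite memNset/= ?in_itv/= ?andbT; last by apply/negP; rewrite -ltNge.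
  apply: brosowski_cvg0 => //.
  rewrite Kp ltr_pdivlMr// mul1r ltrD2l ltrN2.
  (* Left of the arc the distance to [c] exceeds [r], and x > 0 keeps it below c = 2 pi - r, so the
     cosine has not yet wrapped around. *)
  have xc : x < c by rewrite /c; lra.
  by apply: cos_far_lt => //; rewrite ltr0_norm ?subr_lt0// /c /r; lra.
Qed.

End TrigPoly1.

Section TrigPoly2.
Context {R : realType}.
Implicit Types (f g : R * R -> R).

(** A representation is demanded at every level M >= N: two polynomials then share a common level,
    and each can be compared with [fproj M] for all large M. *)
Definition tpoly2 f := exists N, forall M, (N <= M)%N ->
  exists c : modes M -> R, f = (fun x => \sum_k c k * harmN k x).

Lemma tpoly2D f g : tpoly2 f -> tpoly2 g -> tpoly2 (f \+ g).
Proof.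
move=> [N1 h1] [N2 h2]; exists (maxn N1 N2) => M; rewrite geq_max => /andP[/h1[c1 ->] /h2[c2 ->]].
exists (fun k => c1 k + c2 k); apply/funext => x /=.
by rewrite -big_split; apply: eq_bigr => k _; rewrite mulrDl.
Qed.

Lemma tpoly2Z a f : tpoly2 f -> tpoly2 (fun x => a * f x).
Proof.
move=> [N h]; exists N => M /h [c ->]; exists (fun k => a * c k); apply/funext => x.
by rewrite mulr_sumr; apply: eq_bigr => k _; rewrite mulrA.
Qed.

Lemma tpoly2_harm2 k : tpoly2 (harm2 k).
Proof.
case: k => [[n b] [m c]]; exists (maxn n m).+1 => M; rewrite gtn_max => /andP[nM mM].
pose k : modes M := ((Ordinal nM, b), (Ordinal mM, c)).
exists (fun j => (j == k)%:R); apply/funext => x.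
rewrite (bigD1 k)//= eqxx mul1r big1 ?addr0// => j /negbTE ->.
by rewrite mul0r.
Qed.

Lemma harm_const_neq0 n : harm_const n != 0 :> R.
Proof.
rewrite /harm_const; case: (n == 0%N); apply: lt0r_neq0; rewrite invr_gt0 sqrtr_gt0.
  exact: pi2_gt0.
exact: pi_gt0.
Qed.

Lemma tpoly2M (f g : R -> R) : tpoly1 f -> tpoly1 g -> tpoly2 (fun x => f x.1 * g x.2).
Proof.
move=> tf tg; elim: tf => [n b|f1 f2 _ IH1 _ IH2|c f1 _ IH].
- elim: tg => [m c|g1 g2 _ IH1 _ IH2|c g1 _ IH].
  + have := tpoly2Z ((harm_const n)^-1 * (harm_const m)^-1) (tpoly2_harm2 ((n, b), (m, c))).
    congr tpoly2; apply/funext => x; rewrite /harm2 /harm /=.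
    by field; rewrite !harm_const_neq0.
  + have := tpoly2D IH1 IH2; congr tpoly2; apply/funext => x /=; ring.
  + have := tpoly2Z c IH; congr tpoly2; apply/funext => x /=; ring.
- have := tpoly2D IH1 IH2; congr tpoly2; apply/funext => x /=; ring.
- have := tpoly2Z c IH; congr tpoly2; apply/funext => x /=; ring.
Qed.

Lemma tpoly2_bounded f : tpoly2 f -> bounded_fun leb2 cell f.
Proof.
move=> [N /(_ _ (leqnn N)) [c ->]]; apply: bounded_fun_comb => k; exact: bounded_harm2.
Qed.

End TrigPoly2.

#[local] Hint Resolve measurable_cell leb2_cell_lty : core.

Lemma ae_imply d (T : measurableType d) (R : realType) (mu : {measure set T -> \bar R})
    (P Q : T -> Prop) :
  {ae mu, forall x, P x} -> (forall x, P x -> Q x) -> {ae mu, forall x, Q x}.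
Proof. by move=> h PQ; apply: filterS h. Qed.

Lemma ae_imply2 d (T : measurableType d) (R : realType) (mu : {measure set T -> \bar R})
    (P1 P2 Q : T -> Prop) :
  {ae mu, forall x, P1 x} -> {ae mu, forall x, P2 x} ->
  (forall x, P1 x -> P2 x -> Q x) -> {ae mu, forall x, Q x}.
Proof. by move=> h1 h2 PQ; apply: filterS2 h1 h2. Qed.

Section Density.
Context {R : realType}.
Local Notation T := (measurableTypeR R * measurableTypeR R)%type.
Implicit Types (f g : R * R -> R) (A B : set T).
Notation bounded := (bounded_fun leb2 cell).
Variable w : R * R -> R.
Hypotheses (w0 : forall x, 0 <= w x) (wi : leb2.-integrable cell (EFin \o w)).

(** The squared L2 norm for the finite measure w dx. The weight 1 gives convergence of Fourier
    truncations, the weight 1 + |h| gives uniqueness for an integrable h. *)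
Definition wnorm2 f : R := \int[leb2]_(x in cell) (w x * f x ^+ 2).

Lemma wnorm2_integrable f : bounded f ->
  leb2.-integrable cell (EFin \o (fun x => w x * f x ^+ 2)).
Proof.
move=> bf; have := integrable_bounded_funM measurable_cell wi (bounded_funM bf bf).
by congr integrable.
Qed.

Lemma wnorm2_ge0 f : 0 <= wnorm2 f.
Proof. by apply: Rintegral_ge0 => x _; rewrite mulr_ge0// sqr_ge0. Qed.

Lemma wnorm2D f g : bounded f -> bounded g ->
  wnorm2 (f \+ g) <= 2 * wnorm2 f + 2 * wnorm2 g.
Proof.
move=> bf bg; have bfg := bounded_funD bf bg.
rewrite /wnorm2 -!RintegralZl//; [|exact: wnorm2_integrable|exact: wnorm2_integrable].
have i1 := wnorm2_integrable (bounded_funZ (Num.sqrt 2) bf).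
have i2 := wnorm2_integrable (bounded_funZ (Num.sqrt 2) bg).
have E h : (fun x => w x * (Num.sqrt 2 * h x) ^+ 2) = (fun x => 2 * (w x * h x ^+ 2)).
  by apply/funext => x; rewrite exprMn sqr_sqrtr//; ring.
rewrite !E in i1 i2.
rewrite -RintegralD//; apply: le_Rintegral => //.
- exact: wnorm2_integrable.
- by apply: eq_integrable (integrableD measurable_cell i1 i2).
move=> x _ /=; rewrite -subr_ge0 (_ : _ - _ = w x * (f x - g x) ^+ 2); last by ring.
by rewrite mulr_ge0// sqr_ge0.
Qed.

Lemma wnorm2Z c f : bounded f -> wnorm2 (fun x => c * f x) = c ^+ 2 * wnorm2 f.
Proof.
move=> bf; rewrite /wnorm2 -RintegralZl//; last exact: wnorm2_integrable.
by apply: eq_Rintegral => x _; rewrite exprMn mulrCA.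
Qed.

Definition approx f := bounded f /\
  forall e : R, 0 < e -> exists2 p, tpoly2 p & wnorm2 (f \- p) < e.

Lemma approx_tpoly2 p : tpoly2 p -> approx p.
Proof.
move=> tp; split; first exact: tpoly2_bounded.
move=> e e0; exists p => //; rewrite /wnorm2.
under eq_Rintegral do rewrite /= subrr expr0n mulr0.
by rewrite Rintegral_cst// mul0r.
Qed.

Lemma approx_lim f : bounded f ->
  (forall e, 0 < e -> exists2 g, approx g & wnorm2 (f \- g) < e) -> approx f.
Proof.
move=> bf h; split => // e e0.
have e4 : 0 < e / 4 by rewrite divr_gt0.
have [g [bg ag] fg] := h _ e4; have [p tp gp] := ag _ e4.
exists p => //; have bp := tpoly2_bounded tp.
have -> : f \- p = (f \- g) \+ (g \- p) by apply/funext => x /=; ring.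
apply: le_lt_trans (wnorm2D (bounded_funB bf bg) (bounded_funB bg bp)) _; lra.
Qed.

Lemma approxD f g : approx f -> approx g -> approx (f \+ g).
Proof.
move=> [bf af] [bg ag]; split; first exact: bounded_funD.
move=> e e0; have e4 : 0 < e / 4 by rewrite divr_gt0.
have [p tp fp] := af _ e4; have [q tq gq] := ag _ e4.
exists (p \+ q); first exact: tpoly2D.
have bp := tpoly2_bounded tp; have bq := tpoly2_bounded tq.
have -> : (f \+ g) \- (p \+ q) = (f \- p) \+ (g \- q) by apply/funext => x /=; ring.
apply: le_lt_trans (wnorm2D (bounded_funB bf bp) (bounded_funB bg bq)) _; lra.
Qed.

Lemma approxZ c f : approx f -> approx (fun x => c * f x).
Proof.
move=> [bf af]; split; first exact: bounded_funZ.
move=> e e0; have ec : 0 < e / (c ^+ 2 + 1) by rewrite divr_gt0// ltr_wpDl// sqr_ge0.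
have [p tp fp] := af _ ec; exists (fun x => c * p x); first exact: tpoly2Z.
have -> : (fun x => c * f x) \- (fun x => c * p x) = (fun x => c * (f \- p) x).
  by apply/funext => x /=; ring.
rewrite wnorm2Z; last by apply: bounded_funB => //; exact: tpoly2_bounded.
have c0 : 0 < c ^+ 2 + 1 by rewrite ltr_wpDl// sqr_ge0.
move: fp; rewrite ltr_pdivlMr//; apply: le_lt_trans.
by rewrite mulrC ler_wpM2l ?wnorm2_ge0// lerDl.
Qed.

Lemma approx_sum (s : seq nat) (f : nat -> R * R -> R) :
  (forall n, approx (f n)) -> approx (fun x => \sum_(i <- s) f i x).
Proof.
move=> h; elim: s => [|i s IH].
  rewrite (_ : (fun x => _) = (fun x => 0 * f 0%N x)); first exact: approxZ.
  by apply/funext => x; rewrite big_nil mul0r.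
by under eq_fun do rewrite big_cons; exact: approxD.
Qed.

(** Uniformly bounded almost everywhere limits converge in the weighted norm, the integrand being
    dominated by (2 K)^2 w. *)
Lemma approx_dct (f_ : nat -> R * R -> R) f (K : R) :
  (forall n, approx (f_ n)) -> (forall n x, `|f_ n x| <= K) ->
  measurable_fun cell (f : T -> R) -> (forall x, `|f x| <= K) ->
  {ae leb2, forall x, cell x -> f_ n x @[n --> \oo] --> f x} -> approx f.
Proof.
move=> af fB mf fB' cvgf.
have bf : bounded f by apply: (@bounded_fun_everywhere _ _ _ _ _ _ K).
apply: approx_lim => // e e0.
suff : wnorm2 (f \- f_ n) @[n --> \oo] --> (0 : R).
  move=> /cvgrPdist_lt /(_ _ e0) [n _ /(_ n (leqnn n))] /=.
  rewrite sub0r normrN ger0_norm ?wnorm2_ge0// => h.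
  by exists (f_ n).
have bfn n : bounded (f \- f_ n) by apply: bounded_funB => //; case: (af n).
have := @dominated_convergence _ T R leb2 cell measurable_cell
  (fun n x => (w x * (f x - f_ n x) ^+ 2)%:E) (cst 0%E)
  (fun x => (w x * (2 * K) ^+ 2)%:E) => H.
have [] := H.
- by move=> n; have := measurable_int _ (wnorm2_integrable (bfn n)).
- exact: measurable_cst.
- apply: (ae_imply cvgf) => x h /h {}h.
  apply/fine_cvgP; split; first by near=> n.
  have -> : (fine \o (fun n => (w x * (f x - f_ n x) ^+ 2)%:E)) = (fun n => w x * (f x - f_ n x) ^+ 2) by [].
  have hc : (fun n => f x - f_ n x) @ \oo --> (0 : R).
    by rewrite -(subrr (f x)); apply: cvgB => //; exact: cvg_cst.
  have hz : (fun n => w x * (f x - f_ n x) ^+ 2) @ \oo --> w x * (0 * 0).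
    under eq_fun do rewrite expr2.
    by apply: cvgM; [exact: cvg_cst|exact: cvgM].
  by move: hz; rewrite !mulr0.
- by apply: wnorm2_integrable; exact: bounded_fun_cst.
- apply: aeW => x n _; rewrite lee_fin ger0_norm; last by apply: mulr_ge0 => //; exact: sqr_ge0.
  rewrite ler_wpM2l// -(real_normK (num_real (f x - f_ n x))) lerXn2r ?nnegrE//.
    by rewrite mulr_ge0// (le_trans _ (fB' x)).
  by rewrite (le_trans (ler_normB _ _))//; have := fB n x; have := fB' x; lra.
move=> _ _; rewrite integral0 => /fine_cvg; apply: cvg_trans.
by apply: near_eq_cvg; near=> n.
Unshelve. all: by end_near. Qed.

Lemma measurable_indicT A : measurable A -> measurable_fun cell (\1_A : T -> R).
Proof. by move=> mA; apply: measurable_funTS; exact: measurable_indic. Qed.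

Lemma indic_norm_le1 A x : `|(\1_A : T -> R) x| <= 1.
Proof. by rewrite indicE; case: (_ \in _); rewrite ?normr1 ?normr0. Qed.

Lemma approx_indicC A B : measurable A -> measurable B -> A `<=` B ->
  approx \1_B -> approx \1_A -> approx \1_(B `\` A).
Proof.
move=> mA mB AB aB aA; have := approxD aB (approxZ (-1) aA).
congr approx; apply/funext => x /=; rewrite !indicE in_setD.
have [xA|xA] := boolP (x \in A).
  by rewrite (mem_set (AB _ (set_mem xA))) /=; lra.
by case: (x \in B) => /=; lra.
Qed.

Lemma approx_indic_bigcup (F : nat -> set T) : (forall n, measurable (F n)) ->
  trivIset setT F -> (forall n, approx \1_(F n)) -> approx \1_(\bigcup_n F n).
Proof.
move=> mF tF aF.
have mU : measurable (\bigcup_n F n) by exact: bigcupT_measurable.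
have E n x : \sum_(0 <= i < n) (\1_(F i) : T -> R) x =
    if `[< exists2 i, (i < n)%N & F i x >] then 1 else 0.
  elim: n => [|n IH].
    by rewrite big_geq//; case: asboolP => // -[].
  rewrite big_nat_recr//= IH indicE.
  case: asboolP => [[i ni Fix]|h1]; case: asboolP => [[j nj Fjx]|h2].
  - rewrite memNset ?addr0// => Fnx.
    have := tF i n Logic.I Logic.I (ex_intro _ x (conj Fix Fnx)) => ein.
    by rewrite ein ltnn in ni.
  - by exfalso; apply: h2; exists i => //; rewrite ltnS ltnW.
  - have : (j = n) by apply/eqP; move: nj; rewrite ltnS leq_eqVlt => /orP[//|jn]; exfalso; apply: h1; exists j.
    by move=> jn; rewrite jn in Fjx; rewrite mem_set//= add0r.
  - by rewrite memNset ?addr0// => Fnx; apply: h2; exists n.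
apply: (@approx_dct (fun n x => \sum_(0 <= i < n) (\1_(F i) : T -> R) x) _ 1).
- by move=> n; exact: approx_sum.
- by move=> n x; rewrite E; case: ifP => _; rewrite ?normr1 ?normr0.
- exact: measurable_indicT.
- by move=> x; exact: indic_norm_le1.
- apply: aeW => x _; rewrite indicE; have [xU|xU] := boolP (x \in _).
    have [i _ Fi] := set_mem xU.
    apply: cvg_near_cst; near=> n; rewrite E ifT//.
    by apply/asboolP; exists i => //; near: n; exists i.+1.
  apply: cvg_near_cst; near=> n; rewrite E ifF//.
  by apply/asboolP => -[i _ Fi]; rewrite notin_setE in xU; apply: xU; exists i.
Unshelve. all: by end_near. Qed.

(** A pi-lambda argument in one variable: [phi] is the coordinate whose sets are being enlarged from
    generators to all measurable sets, and [C] freezes a condition on the other coordinate. *)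
Lemma approx_dynkin d (X : measurableType d) (phi : T -> X) (C : set T) (G : set (set X)) :
  measurable_fun setT phi -> measurable C ->
  @measurable _ X = <<s G >> -> setI_closed G ->
  approx \1_C -> (forall E, G E -> approx \1_(phi @^-1` E `&` C)) ->
  forall E, measurable E -> approx \1_(phi @^-1` E `&` C).
Proof.
move=> mphi mC GE GI aC aG A mA.
have mp (B' : set X) : measurable B' -> measurable (phi @^-1` B' `&` C).
  by move=> mB; apply: measurableI => //; rewrite -[_ @^-1` _]setTI; exact: mphi.
have PT : approx \1_(phi @^-1` setT `&` C) by rewrite preimage_setT setTI.
have PC S : measurable S -> approx \1_(phi @^-1` S `&` C) -> approx \1_(phi @^-1` (~` S) `&` C).
  move=> mS aS; rewrite preimage_setC setIC -setDE.
  rewrite (_ : C `\` _ = C `\` (phi @^-1` S `&` C)); last first.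
    by rewrite setDIr setDv setU0.
  by apply: approx_indicC aC aS => //; exact: mp.
have PU (F : nat -> set X) : (forall n, measurable (F n)) -> trivIset setT F ->
    (forall n, approx \1_(phi @^-1` (F n) `&` C)) -> approx \1_(phi @^-1` (\bigcup_n F n) `&` C).
  move=> mF tF aF; rewrite preimage_bigcup setI_bigcupl.
  apply: approx_indic_bigcup => //; first by move=> n; exact: mp.
  apply/trivIsetP => i j _ _ ij; rewrite setIACA setIid -preimage_setI.
  by move/trivIsetP : tF => /(_ i j Logic.I Logic.I ij) ->; rewrite preimage_set0 set0I.
have sA : <<s G >> A by rewrite -GE.
exact: (@dynkin_induction _ X G (fun E : set X => approx \1_(phi @^-1` E `&` C)) GE GI PT aG PC PU A sA).
Qed.

Lemma ae_leb2_coord (N : set R) : measurable N -> lebesgue_measure N = 0%E ->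
  {ae leb2, forall x : R * R, ~ N x.1 /\ ~ N x.2}.
Proof.
move=> mN N0.
have h1 : {ae leb2, forall x : R * R, ~ N x.1}.
  exists (N `*` setT); split; first exact: measurableX.
    have -> : leb2 (N `*` setT) = (lebesgue_measure N * lebesgue_measure (@setT R))%E.
      exact: product_measure1E.
    by rewrite N0 mul0e.
  by move=> x /= /contrapT.
have h2 : {ae leb2, forall x : R * R, ~ N x.2}.
  exists (setT `*` N); split; first exact: measurableX.
    have -> : leb2 (setT `*` N) = (lebesgue_measure (@setT R) * lebesgue_measure N)%E.
      exact: product_measure1E.
    by rewrite N0 mule0.
  by move=> x /= /contrapT.
by apply: (ae_imply2 h1 h2).
Qed.

Lemma approx_rays (a b : R) : approx \1_(fst @^-1` `[a, +oo[ `&` snd @^-1` `[b, +oo[ ).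
Proof.
have [p [tp p01 pcvg]] := tpoly1_ray a; have [q [tq q01 qcvg]] := tpoly1_ray b.
apply: (@approx_dct (fun n x => p n x.1 * q n x.2) _ 1).
- by move=> n; apply: approx_tpoly2; exact: tpoly2M.
- move=> n x; have /andP[p0 p1] := p01 n x.1; have /andP[q0 q1] := q01 n x.2.
  by rewrite ger0_norm ?mulr_ge0// mulr_ile1.
- apply: measurable_indicT; apply: measurableI.
    by rewrite -[_ @^-1` _]setTI; apply: measurable_fst => //; exact: measurable_itv.
  by rewrite -[_ @^-1` _]setTI; apply: measurable_snd => //; exact: measurable_itv.
- by move=> x; exact: indic_norm_le1.
(* The lines over these points are excluded: at the ends of the period and at the jumps [a], [b] the
   one-dimensional approximants need not converge. *)
pose N : set R := [set 0] `|` [set 2 * pi] `|` [set a] `|` [set b].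
have mN : measurable N by do !apply: measurableU => //.
have N0 : lebesgue_measure N = 0%E.
  by apply: countable_lebesgue_measure0; apply: finite_set_countable; rewrite /N !finite_setU; repeat split.
apply: (ae_imply (ae_leb2_coord mN N0)) => -[x y] [/= h1 h2] [].
rewrite /= !in_itv/= => /andP[x0 x1] /andP[y0 y1].
have nN z : ~ N z -> [/\ z != 0, z != 2 * pi, z != a & z != b].
  by move=> h; split; apply/eqP => E; apply: h; rewrite E; rewrite /N /=; tauto.
have [x2 x3 x4 x5] := nN _ h1; have [y2 y3 y4 y5] := nN _ h2.
have -> : (\1_(fst @^-1` `[a, +oo[ `&` snd @^-1` `[b, +oo[) (x, y) : R) =
    \1_(`[a, +oo[%classic) x * \1_(`[b, +oo[%classic) y.
  by rewrite !indicE in_setI -natrM mulnb.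
apply: cvgM.
- by apply: pcvg => //; rewrite !lt_neqAle x0 x1 x3 eq_sym x2.
- by apply: qcvg => //; rewrite !lt_neqAle y0 y1 y3 eq_sym y2.
Qed.

Lemma approx_indicT : approx \1_setT.
Proof.
have := approx_tpoly2 (tpoly2M (tpoly1_cst 1) (tpoly1_cst 1)).
by congr approx; apply/funext => x; rewrite indicT mul1r.
Qed.

Lemma rays_setI_closed : setI_closed (@RGenCInfty.G R).
Proof.
move=> _ _ [x ->] [y ->]; exists (Num.max x y); apply/seteqP; split => z /=;
  rewrite !in_itv/= !andbT ge_max; first by move=> [-> ->].
by move=> /andP[].
Qed.

(** The Dynkin argument is applied to one coordinate, then to the other. In between, the remaining
    ray is removed by letting it start at -n, which is no restriction on the cell, where coordinates
    are nonnegative. *)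
Lemma approx_rect (A B : set R) : measurable A -> measurable B -> approx \1_(A `*` B).
Proof.
move=> mA mB.
have raysE : @measurable _ (measurableTypeR R) = <<s (@RGenCInfty.G R) >>.
  exact: RGenCInfty.measurableE.
have mC (b : R) : measurable (snd @^-1` `[b, +oo[ : set T).
  by rewrite -[_ @^-1` _]setTI; apply: measurable_snd => //; exact: measurable_itv.
have aC (b : R) : approx \1_(snd @^-1` `[b, +oo[ : set T).
  apply: (@approx_dct (fun n => \1_(fst @^-1` `[- n%:R, +oo[ `&` snd @^-1` `[b, +oo[)) _ 1).
  - by move=> n; exact: approx_rays.
  - by move=> n x; exact: indic_norm_le1.
  - exact: measurable_indicT.
  - by move=> x; exact: indic_norm_le1.
  apply: aeW => x [/= + _]; rewrite in_itv/= => /andP[x0 _].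
  apply: cvg_near_cst; near=> n; rewrite !indicE in_setI mem_set//=.
  by rewrite in_itv/= andbT (le_trans _ x0)// oppr_le0.
have step1 (b : R) : approx \1_(fst @^-1` A `&` snd @^-1` `[b, +oo[ : set T).
  apply: (approx_dynkin (G := @RGenCInfty.G R)) => //.
  - exact: rays_setI_closed.
  - by move=> _ [a ->]; exact: approx_rays.
have mA' : measurable (fst @^-1` A : set T).
  by rewrite -[_ @^-1` _]setTI; apply: measurable_fst.
have aA : approx \1_(fst @^-1` A : set T).
  apply: (@approx_dct (fun n => \1_(fst @^-1` A `&` snd @^-1` `[- n%:R, +oo[)) _ 1).
  - by move=> n; exact: step1.
  - by move=> n x; exact: indic_norm_le1.
  - exact: measurable_indicT.
  - by move=> x; exact: indic_norm_le1.
  apply: aeW => x [/= _]; rewrite in_itv/= => /andP[x0 _].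
  apply: cvg_near_cst; near=> n; rewrite !indicE in_setI [X in _ && X]mem_set ?andbT//=.
  by rewrite in_itv/= andbT (le_trans _ x0)// oppr_le0.
have : approx \1_(snd @^-1` B `&` fst @^-1` A : set T).
  apply: (approx_dynkin (G := @RGenCInfty.G R)) => //.
  - exact: rays_setI_closed.
  - by move=> _ [b ->]; rewrite setIC; exact: step1.
by rewrite setIC; congr (approx \1_(_)).
Unshelve. all: by end_near. Qed.

Lemma approx_indic A : measurable A -> approx \1_A.
Proof.
move=> mA; rewrite -[A]setIT.
apply: (approx_dynkin (phi := id) (G := [set A `*` B | A in measurable & B in measurable])) => //.
- exact: measurable_prod_measurableType.
- move=> _ _ [A1 mA1 [B1 mB1 <-]] [A2 mA2 [B2 mB2 <-]].
  exists (A1 `&` A2); first exact: measurableI.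
  exists (B1 `&` B2); first exact: measurableI.
  by rewrite setXI.
- exact: approx_indicT.
- by move=> _ [A1 mA1 [B1 mB1 <-]]; rewrite setIT; exact: approx_rect.
Qed.

(** The sum counts the positive integers up to y, so it is the integer part of y. *)
Lemma staircase (L : nat) (y : R) : 0 <= y <= L%:R ->
  \sum_(0 <= i < L) ((i.+1%:R <= y)%R%:R : R) <= y <= 1 + \sum_(0 <= i < L) ((i.+1%:R <= y)%R%:R : R).
Proof.
elim: L => [|L IH] /andP[y0 yL].
  by rewrite big_geq// y0/= addr0 (le_trans yL).
rewrite big_nat_recr//=; have [yl|yl] := leP y L%:R.
  have /andP[h1 h2] := IH (introT andP (conj y0 yl)).
  rewrite (_ : (L.+1%:R <= y) = false) ?addr0 ?h1//.
  by apply/negbTE; rewrite -ltNge (le_lt_trans yl)// ltr_nat.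
rewrite (eq_big_nat _ _ (F2 := fun=> 1)); last first.
  by move=> i /andP[_ iL]; rewrite (le_trans _ (ltW yl))// ler_nat.
rewrite sumr_const_nat subn0 -[1 *+ L]/(L%:R).
have y1 : y <= L%:R + 1 by rewrite natr1.
by have [h|h] := leP (L.+1%:R : R) y; [move: h; rewrite -natr1 => h|]; rewrite /=; lra.
Qed.

(** The function f + M is rounded down to multiples of 1/(n + 1). The rounded function is a finite
    combination of indicators of superlevel sets, and the rounding error is at most 1/(n + 1). *)
Lemma approx_bounded f M : measurable_fun setT (f : T -> R) -> (forall x, `|f x| <= M) -> approx f.
Proof.
move=> mf fM.
have M0 : 0 <= M by apply: le_trans (fM (0, 0)).
pose L n := (Num.truncn (n.+1%:R * (2 * M))).+1.
pose y n x := n.+1%:R * (f x + M).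
have y0L n x : 0 <= y n x <= (L n)%:R.
  have := fM x; rewrite ler_norml => /andP[h1 h2].
  have n0 : 0 < n.+1%:R :> R by rewrite ltr0n.
  rewrite mulr_ge0//=; last lra.
  rewrite ltW// (le_lt_trans _ (truncnS_gt _))// ler_pM2l//; lra.
pose A n i : set T := [set x | i.+1%:R <= y n x].
have mA n i : measurable (A n i).
  rewrite -[A n i]setTI; apply: measurable_fun_le => //.
  by apply: measurable_funM => //; exact: measurable_funD.
pose g n x := n.+1%:R^-1 * (\sum_(0 <= i < L n) (\1_(A n i) : T -> R) x) - M.
have gE n x : `|f x - g n x| <= n.+1%:R^-1.
  have n0 : 0 < n.+1%:R :> R by rewrite ltr0n.
  have /andP[h1 h2] := staircase (y0L n x).
  have E : \sum_(0 <= i < L n) ((i.+1%:R <= y n x)%R)%:R = \sum_(0 <= i < L n) (\1_(A n i) : T -> R) x.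
    by apply: eq_bigr => i _; rewrite indicE; congr ((nat_of_bool _)%:R); apply/idP/idP => [h|/set_mem//]; exact: mem_set.
  rewrite E in h1 h2; rewrite /g; set s := \sum_(0 <= i < L n) _ in h1 h2 *.
  have -> : f x - (n.+1%:R^-1 * s - M) = n.+1%:R^-1 * (y n x - s).
    by rewrite /y; field; rewrite gt_eqF.
  rewrite normrM gtr0_norm ?invr_gt0// -[leRHS]mulr1 ler_pM2l ?invr_gt0//.
  by rewrite ger0_norm ?subr_ge0//; lra.
apply: (@approx_dct g _ (M + 1)).
- move=> n; have a1 := approxZ (n.+1%:R^-1) (approx_sum (index_iota 0 (L n)) (fun i => approx_indic (mA n i))).
  have := approxD a1 (approxZ (- M) approx_indicT).
  by congr approx; apply/funext => x /=; rewrite indicT mulr1.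
- move=> n x; rewrite -[g n x](subKr (f x)) (le_trans (ler_normB _ _))//.
  apply: lerD; first exact: fM.
  by apply: le_trans (gE n x) _; rewrite invf_le1 ?ltr0n// ler1n.
- exact: measurable_funTS.
- by move=> x; rewrite (le_trans (fM x))// lerDl.
apply: aeW => x _; apply/cvgrPdist_le => e e0; near=> n.
apply: le_trans (gE n x) _; rewrite ltW//; near: n; exact: (near_infty_natSinv_lt (PosNum e0)).
Unshelve. all: by end_near. Qed.

(** Extending by 0 off the cell and clamping at the essential bound produces a measurable function
    bounded everywhere, equal to [f] almost everywhere on the cell. *)
Lemma approx_ae_bounded f : bounded f -> approx f.
Proof.
move=> bf; have [M [mf fM]] := bf.
pose M1 := Num.max M 0.
pose f' : T -> R := fun x => Num.max (- M1) (Num.min M1 ((f \_ cell) x)).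
have mf' : measurable_fun setT f'.
  apply: measurable_maxr; first exact: measurable_cst.
  apply: measurable_minr; first exact: measurable_cst.
  by apply/(measurable_restrictT _ _).1.
have M10 : 0 <= M1 by rewrite le_max lexx orbT.
have f'M x : `|f' x| <= M1.
  by rewrite ler_norml le_max lexx/= ge_max ge_min lexx andbT; lra.
have af' := approx_bounded mf' f'M.
apply: approx_lim => // e e0; exists f' => //.
suff -> : wnorm2 (f \- f') = 0 by [].
rewrite /wnorm2 /Rintegral (ae_eq_integral (cst 0%E)) ?integral0//.
  by apply: measurable_int (wnorm2_integrable (bounded_funB bf af'.1)).
apply: (ae_imply fM) => x h Dx /=; have := h Dx.
rewrite /f' patchE mem_set// => hx.
have hx' : `|f x| <= M1 by rewrite le_max hx.
move: hx'; rewrite ler_norml => /andP[h1 h2].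
by rewrite (min_idPr h2) (max_idPr h1) subrr expr0n mulr0.
Qed.

End Density.

(** * Convergence and uniqueness of Fourier series *)

Section L2Convergence.
Context d (T : measurableType d) (R : realType).
Variables (mu : {measure set T -> \bar R}) (D : set T).
Hypotheses (mD : measurable D) (fD : (mu D < +oo)%E).
Implicit Types (f g h u : T -> R) (F G : nat -> T -> R).
Local Notation bounded := (bounded_fun mu D).
Local Notation ip := (ip mu D).

Definition cvgL2 F f := [/\ forall n, bounded (F n), bounded f &
  (fun n => ip (f \- F n) (f \- F n)) @ \oo --> (0 : R)].

Lemma ae_eq_Rintegral f g : measurable_fun D f -> measurable_fun D g ->
  {ae mu, forall x, D x -> f x = g x} ->
  \int[mu]_(x in D) f x = \int[mu]_(x in D) g x.
Proof.
move=> mf mg fg; rewrite /Rintegral; congr fine; apply: ae_eq_integral => //.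
- exact/measurable_EFinP.
- exact/measurable_EFinP.
- by apply: filterS fg => x h Dx; rewrite h.
Qed.

Lemma cvg0_sqr (x : nat -> R) : (fun n => x n ^+ 2) @ \oo --> (0 : R) -> x @ \oo --> (0 : R).
Proof.
move=> h; apply/cvgrPdist_lt => e e0.
have e20 : 0 < e ^+ 2 by rewrite exprn_gt0.
have /cvgrPdist_lt /(_ _ e20) := h; apply: filterS => n.
by rewrite !sub0r !normrN normrX ltr_pXn2r ?nnegrE// ltW.
Qed.

Lemma cvg0_ip F G (a : R) : (forall n, bounded (F n)) -> (forall n, bounded (G n)) ->
  (fun n => ip (F n) (F n)) @ \oo --> a ->
  (fun n => ip (G n) (G n)) @ \oo --> (0 : R) ->
  (fun n => ip (F n) (G n)) @ \oo --> (0 : R).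
Proof.
move=> bF bG ha hb; apply: cvg0_sqr.
apply: (@squeeze_cvgr _ _ _ _ (cst 0) (fun n => ip (F n) (F n) * ip (G n) (G n))).
- by near=> n; rewrite sqr_ge0/= ip_CS.
- exact: cvg_cst.
- by rewrite -(mulr0 a); exact: cvgM.
Unshelve. all: by end_near. Qed.

Lemma cvgL2_cst f : bounded f -> cvgL2 (fun=> f) f.
Proof.
move=> bf; split => //; rewrite (_ : (fun n => _) = cst 0); first exact: cvg_cst.
by apply/funext => n; rewrite ip_sqrB//=; ring.
Qed.

(** Expanding around the limits leaves three error terms, each with a factor tending to 0 in norm,
    so Cauchy-Schwarz applies. *)
Lemma cvgL2_ip F G f g : cvgL2 F f -> cvgL2 G g ->
  (fun n => ip (F n) (G n)) @ \oo --> ip f g.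
Proof.
move=> [bF bf cf] [bG bg cg].
have bfF n := bounded_funB bf (bF n); have bgG n := bounded_funB bg (bG n).
have -> : (fun n => ip (F n) (G n)) = (fun n => ip f g - ip f (g \- G n) - ip g (f \- F n)
    + ip (f \- F n) (g \- G n)).
  apply/funext => n; rewrite ipBl// !ipBr// (ipC mu D g f) (ipC mu D g (F n)); ring.
rewrite -[X in _ --> X]addr0 -[X in _ --> X + _]subr0 -[X in _ --> X - _ + _]subr0.
apply: cvgD; first apply: cvgB; first apply: cvgB; first exact: cvg_cst.
- by apply: (@cvg0_ip (fun=> f) (fun n => g \- G n) (ip f f)) => //; exact: cvg_cst.
- by apply: (@cvg0_ip (fun=> g) (fun n => f \- F n) (ip g g)) => //; exact: cvg_cst.
- exact: (@cvg0_ip (fun n => f \- F n) (fun n => g \- G n) 0).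
Qed.

Lemma ip_ae_le f g K : ae_bounded mu D f K -> bounded g ->
  ip (f \* g) (f \* g) <= K ^+ 2 * ip g g.
Proof.
move=> hf bg; have bf : bounded f by exists K.
rewrite /ip -RintegralZl//; last exact: ip_integrable.
rewrite -lee_fin /Rintegral !fineK; last 2 first.
- apply: integrable_fin_num => //; have := ip_integrable mD fD (bounded_funZ (K ^+ 2) bg) bg.
  by congr integrable; apply/funext => x /=; rewrite mulrA.
- by apply: integrable_fin_num => //; apply: ip_integrable => //; exact: bounded_funM.
have mf := bounded_fun_measurable bf; have mg := bounded_fun_measurable bg.
apply: ae_ge0_le_integral => //.
- by move=> x _; rewrite lee_fin -expr2 sqr_ge0.
- by apply/measurable_EFinP; apply: measurable_funM; exact: measurable_funM.
- by move=> x _; rewrite lee_fin -expr2 mulr_ge0// sqr_ge0.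
- by apply/measurable_EFinP; apply: measurable_funM => //; exact: measurable_funM.
case: hf => _; apply: filterS => x h Dx; rewrite lee_fin /=.
rewrite mulrACA -!expr2 ler_wpM2r ?sqr_ge0// -(real_normK (num_real (f x))).
by rewrite lerXn2r ?nnegrE// ?h// (le_trans _ (h Dx)).
Qed.

Lemma cvgL2M u F f : bounded u -> cvgL2 F f -> cvgL2 (fun n => u \* F n) (u \* f).
Proof.
move=> bu [bF bf cf]; split.
- by move=> n; exact: bounded_funM.
- exact: bounded_funM.
have [K hu] := bu.
apply: (@squeeze_cvgr _ _ _ _ (cst 0) (fun n => K ^+ 2 * ip (f \- F n) (f \- F n))).
- near=> n; rewrite ip_ge0/=.
  have -> : (u \* f) \- (u \* F n) = u \* (f \- F n) by apply/funext => x /=; ring.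
  by apply: ip_ae_le => //; exact: bounded_funB.
- exact: cvg_cst.
- by rewrite -(mulr0 (K ^+ 2)); apply: cvgM => //; exact: cvg_cst.
Unshelve. all: by end_near. Qed.

End L2Convergence.

Section Fourier.
Context {R : realType}.
Implicit Types (f g h : R * R -> R) (u : R * R -> R).
Local Notation bounded := (bounded_fun leb2 cell).
Local Notation "'<|' f , g '|>'" := (ip leb2 cell f g).

(** A trigonometric polynomial close to [f] is a combination of the modes of every large level M,
    and [fproj M f] is at least as close. *)
Lemma fproj_cvgL2 f : bounded f -> cvgL2 leb2 cell (fun N => fproj N f) f.
Proof.
move=> bf; split => //; first by move=> n; exact: bounded_fproj.
have bff N := bounded_funB bf (bounded_fproj N f).
have [_ af] := approx_ae_bounded (w := cst 1) (fun=> ler01)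
  (bounded_fun_integrable measurable_cell leb2_cell_lty (bounded_fun_cst _ _ 1)) bf.
apply/cvgrPdist_lt => e e0; have [p [N hN] pe] := af _ e0.
near=> M; have NM : (N <= M)%N by near: M; exists N.
rewrite sub0r normrN ger0_norm ?ip_ge0//.
have [c pE] := hN _ NM.
apply: le_lt_trans pe; rewrite pE.
apply: le_trans (proj_best measurable_cell leb2_cell_lty (@bounded_harmN _ M) (@harmN_orth _ M) (@harmN_norm _ M) c bf) _.
rewrite /wnorm2 /ip le_eqVlt; apply/orP; left; apply/eqP.
by apply: eq_Rintegral => x _ /=; rewrite mul1r expr2.
Unshelve. all: by end_near. Qed.

Lemma Rintegral_norm_eq0 f : leb2.-integrable cell (EFin \o f) ->
  \int[leb2]_(x in cell) `|f x| = 0 -> {ae leb2, forall x, cell x -> f x = 0}.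
Proof.
move=> fi f0; have mf := measurable_int _ fi.
have := (ae_eq_integral_abs leb2 measurable_cell mf).1; rewrite /ae_eq => H.
have {}H := H _; apply: ae_imply; first apply: H.
  have h : (\int[leb2]_(x in cell) `|(EFin \o f) x|)%E \is a fin_num.
    by apply: integrable_fin_num => //; exact: integrable_abse.
  by rewrite -(fineK h); congr EFin.
by move=> x h Dx; have /= [] := h Dx.
Qed.

(* Weight the density of trigonometric polynomials by 1 + |h| and test with the sign of h. *)
Lemma fourier_uniqueness h : leb2.-integrable cell (EFin \o h) ->
  (forall k, <| h, harm2 k |> = 0) -> {ae leb2, forall x, cell x -> h x = 0}.
Proof.
move=> hi h0; pose w x := 1 + `|h x|.
have ai : leb2.-integrable cell (EFin \o (fun x => `|h x|)) by exact: integrable_norm.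
have wi : leb2.-integrable cell (EFin \o w).
  have := integrableD measurable_cell
    (bounded_fun_integrable measurable_cell leb2_cell_lty (bounded_fun_cst leb2 cell 1)) ai.
  by apply: eq_integrable.
have w0 x : 0 <= w x by rewrite addr_ge0.
have mh : measurable_fun cell h by apply/measurable_EFinP; exact: measurable_int hi.
pose s x : R := if 0 <= h x then 1 else -1.
have bs : bounded s.
  apply: (@bounded_fun_everywhere _ _ _ _ _ _ 1).
    by apply: measurable_fun_if => //; apply: measurable_fun_ler.
  by move=> x _; rewrite /s; case: ifP => _; rewrite ?normrN normr1.
have hM f : bounded f -> leb2.-integrable cell (EFin \o (h \* f)).
  exact: integrable_bounded_funM.
have hp p : tpoly2 p -> <| h, p |> = 0.
  move=> [N /(_ _ (leqnn N)) [c ->]].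
  suff E (r : seq (modes N)) : <| h, fun x => \sum_(k <- r) c k * harmN k x |> = 0 by exact: E.
  elim: r => [|k r IH].
    rewrite /ip; under eq_Rintegral do rewrite big_nil mulr0.
    by rewrite Rintegral_cst// mul0r.
  rewrite /ip; under eq_Rintegral do rewrite big_cons mulrDr mulrCA.
  rewrite RintegralD//; last 2 first.
  - have := integrable_bounded_funM measurable_cell hi (bounded_funZ (c k) (bounded_harmN k)).
    by congr integrable; apply/funext => x /=; rewrite mulrCA.
  - by apply: hM; apply: bounded_fun_sum => i; apply: bounded_funZ; exact: bounded_harmN.
  rewrite RintegralZl//; last by apply: hM; exact: bounded_harmN.
  by rewrite -/(ip leb2 cell h (harmN k)) h0 mulr0 add0r.
have [_ as_] := approx_ae_bounded w0 wi bs.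
apply: Rintegral_norm_eq0 => //.
have sE : \int[leb2]_(x in cell) `|h x| = <| h, s |>.
  by apply: eq_Rintegral => x _; rewrite /s; case: leP => hx; [rewrite ger0_norm// mulr1|rewrite ltr0_norm// mulrN1].
apply/eqP; rewrite eq_le; apply/andP; split; last by apply: Rintegral_ge0.
rewrite leNgt; apply/negP => I0; set I := \int[leb2]_(x in cell) `|h x| in I0 sE.
pose W := \int[leb2]_(x in cell) w x.
have W0 : 0 <= W by exact: Rintegral_ge0.
(* AM-GM: h (s - p) <= w / (2 c) + c w (s - p)^2 / 2 with c = (W + 1) / I. *)
pose c := (W + 1) / I.
have c0 : 0 < c by rewrite divr_gt0// ltr_wpDl.
have e0 : 0 < I / c by rewrite divr_gt0.
have [p tp pe] := as_ _ e0.
have bp := tpoly2_bounded tp; have bsp := bounded_funB bs bp.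
have : I <= \int[leb2]_(x in cell) ((2 * c)^-1 * w x + c / 2 * (w x * (s x - p x) ^+ 2)).
  rewrite sE -[X in X <= _]subr0 -(hp _ tp) /ip -RintegralB//; [|exact: hM|exact: hM].
  apply: le_Rintegral => //.
  - have := integrableB measurable_cell (hM _ bs) (hM _ bp); exact: eq_integrable.
  - have i1 := integrableZl measurable_cell ((2 * c)^-1) wi.
    have i2 := integrableZl measurable_cell (c / 2) (wnorm2_integrable wi bsp).
    by have := integrableD measurable_cell i1 i2; exact: eq_integrable.
  move=> x _ /=; rewrite -mulrBr.
  apply: (@le_trans _ _ (w x * `|s x - p x|)).
    apply: le_trans (ler_norm _) _; rewrite normrM ler_wpM2r// /w lerDr//.
  rewrite (_ : (2 * c)^-1 * w x + _ = w x * ((2 * c)^-1 + c / 2 * (s x - p x) ^+ 2)); last by ring.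
  rewrite ler_wpM2l// -(real_normK (num_real (s x - p x))); set y := `|_|.
  rewrite -subr_ge0 (_ : _ - _ = (c * y - 1) ^+ 2 / (2 * c)); last by field; rewrite gt_eqF.
  by rewrite divr_ge0 ?sqr_ge0// mulr_ge0// ltW.
rewrite RintegralD//; last 2 first.
- by have := integrableZl measurable_cell ((2 * c)^-1) wi; exact: eq_integrable.
- by have := integrableZl measurable_cell (c / 2) (wnorm2_integrable wi bsp); exact: eq_integrable.
rewrite !RintegralZl//; last exact: wnorm2_integrable.
rewrite -/W -/(wnorm2 w (s \- p)); apply/negP; rewrite -ltNge.
apply: (@lt_le_trans _ _ ((2 * c)^-1 * W + c / 2 * (I / c))).
  by rewrite ltrD2l ltr_pM2l// divr_gt0.
rewrite (_ : c / 2 * (I / c) = I / 2); last by field; rewrite gt_eqF.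
suff : (2 * c)^-1 * W <= I / 2 by lra.
have W1 : 0 < W + 1 by rewrite ltr_wpDl.
have -> : (2 * c)^-1 * W = I / 2 * (W / (W + 1)).
  by rewrite /c; field; rewrite !gt_eqF.
by rewrite ler_piMr ?divr_ge0 ?(ltW I0)// ler_pdivrMr// mul1r lerDl.
Qed.

Lemma coef_partialB i u v g h : L1_torus u -> L1_torus v -> L1_torus g -> L1_torus h ->
  coef_partial i u g -> coef_partial i v h -> coef_partial i (u \- v) (g \- h).
Proof.
move=> Lu Lv Lg Lh cu cv k.
have ipB a b l : L1_torus a -> L1_torus b -> <| a \- b, harm2 l |> = <| a, harm2 l |> - <| b, harm2 l |>.
  move=> La Lb; rewrite /ip -RintegralB//; [|exact: L1_torusM (bounded_harm2 _)|exact: L1_torusM (bounded_harm2 _)].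
  by apply: eq_Rintegral => x _; rewrite mulrBl.
by rewrite !ipB// cu cv; ring.
Qed.

Lemma coef_partial_unique i u g h : L1_torus g -> L1_torus h ->
  coef_partial i u g -> coef_partial i u h -> {ae leb2, forall x, cell x -> g x = h x}.
Proof.
move=> Lg Lh cg ch.
have gi : leb2.-integrable cell (EFin \o (g \- h)).
  by have := integrableB measurable_cell Lg.2 Lh.2; exact: eq_integrable.
apply: (ae_imply (fourier_uniqueness gi _)).
  move=> k; rewrite /ip; under eq_Rintegral do rewrite mulrBl.
  rewrite RintegralB//; [|exact: L1_torusM (bounded_harm2 _)|exact: L1_torusM (bounded_harm2 _)].
  by rewrite -/(ip leb2 cell g (harm2 k)) -/(ip leb2 cell h (harm2 k)) cg ch subrr.
by move=> x h0 Dx; apply/eqP; rewrite -subr_eq0; apply/eqP; exact: h0.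
Qed.

Lemma bounded_derivable_sqr i (phi dphi : R * R -> R) :
  (forall x, is_derive x (space_dir i) phi (dphi x)) ->
  'D_(space_dir i) (phi \* phi) = (fun x => 2 * (dphi x * phi x)).
Proof.
move=> dp; apply/funext => x; have [_ ->] := is_deriveM (dp x) (dp x).
by rewrite /GRing.scale /=; ring.
Qed.

Lemma test_torusM (phi psi : R * R -> R) : test_torus phi -> test_torus psi -> test_torus (phi \* psi).
Proof.
move=> [p1 c1] [p2 c2]; split; last by move=> k; exact: CkM.
by move=> x1 x2; have [h1 h2] := p1 x1 x2; have [h3 h4] := p2 x1 x2; rewrite /= h1 h2 h3 h4.
Qed.

(* For u divergence free, the integral of u . grad (phi^2 / 2) vanishes for the
   test functions phi = fproj N w, and N tends to infinity. *)
Lemma transport_eq0 (u gu : vfield R) (w : R * R -> R) (Dw : 'I_2 -> R * R -> R) :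
  (forall i, weak_partial i (u i) (gu i)) ->
  {ae leb2, forall x, \sum_(i < 2) gu i x = 0} ->
  (forall i, bounded (u i)) -> bounded w ->
  (forall i, coef_partial i w (Dw i)) -> (forall i, bounded (Dw i)) ->
  \sum_(i < 2) <| u i \* Dw i, w |> = 0.
Proof.
move=> wu du bu bw cw bD.
have key N : \sum_(i < 2) <| u i \* fproj N (Dw i), fproj N w |> = 0.
  set phi := fproj N w.
  have tphi : test_torus (phi \* phi) by apply: test_torusM; exact: test_torus_fproj.
  have bphi : bounded phi by exact: bounded_fproj.
  have bphi2 : bounded (phi \* phi) by exact: bounded_funM.
  have E i : 2 * <| u i \* fproj N (Dw i), phi |> = - <| gu i, phi \* phi |>.
    have [_ _ /(_ _ tphi)] := wu i; rewrite -/(ip leb2 cell (gu i) (phi \* phi)) => <-.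
    rewrite /ip -RintegralZl//; last first.
      exact: (ip_integrable measurable_cell leb2_cell_lty (bounded_funM (bu i) (bounded_fproj N (Dw i))) bphi).
    apply: eq_Rintegral => x _.
    have /(congr1 (@^~ x)) /= -> := bounded_derivable_sqr (fun x => is_derive_fproj N x (cw i)).
    rewrite /phi; ring.
  have : 2 * \sum_(i < 2) <| u i \* fproj N (Dw i), phi |> = 0.
    rewrite mulr_sumr (eq_bigr _ (fun i _ => E i)) sumrN.
    have gi i : leb2.-integrable cell (EFin \o (gu i \* (phi \* phi))).
      by have [_ Lg _] := wu i; exact: L1_torusM.
    rewrite big_ord_recl big_ord1 /ip -RintegralD//; [|exact: gi|exact: gi].
    rewrite (@ae_eq_Rintegral _ _ _ _ _ measurable_cell _ (cst 0)); first by rewrite Rintegral_cst// mul0r oppr0.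
    - by apply: measurable_funD; apply/measurable_EFinP; exact: measurable_int (gi _).
    - exact: measurable_cst.
    apply: (ae_imply du) => x; rewrite big_ord_recl big_ord1 => hx _.
    by rewrite -mulrDl hx mul0r.
  by move/eqP; rewrite mulf_eq0 pnatr_eq0 /= => /eqP.
have cvg0 : (fun N => \sum_(i < 2) <| u i \* fproj N (Dw i), fproj N w |>) @ \oo -->
    \sum_(i < 2) <| u i \* Dw i, w |>.
  rewrite big_ord_recl big_ord1; under eq_fun do rewrite big_ord_recl big_ord1.
  have hc i := cvgL2M measurable_cell leb2_cell_lty (bu i) (fproj_cvgL2 (bD i)).
  by apply: cvgD; apply: (cvgL2_ip measurable_cell leb2_cell_lty (hc _) (fproj_cvgL2 bw)).
have c0 : (fun N => \sum_(i < 2) <| u i \* fproj N (Dw i), fproj N w |>) @ \oo --> (0 : R).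
  by under eq_fun do rewrite key; exact: cvg_cst.
by apply: (cvg_unique _ cvg0 c0).
Qed.

(** Positivity of the total measure is what lets the norm with exponent [+oo] unfold to an essential
    supremum. *)
Lemma leb2_setT_gt0 : (0 < leb2 (setT : set (measurableTypeR R * measurableTypeR R)))%E.
Proof.
apply: (@lt_le_trans _ _ (leb2 (cell : set (measurableTypeR R * measurableTypeR R)))).
  by rewrite leb2_cell lte_fin exprn_gt0// pi2_gt0.
by apply: le_measure => //; rewrite inE//; exact: measurable_cell.
Qed.

Lemma Lnorm_infty_ae u M : ('N[leb2]_+oo[EFin \o (u \_ cell)] <= M%:E)%E ->
  {ae leb2, forall x, cell x -> `|u x| <= M}.
Proof.
rewrite unlock /= leb2_setT_gt0 => /ess_supP h.
apply: (ae_imply h) => x /= + Dx.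
by rewrite patchE mem_set// lee_fin.
Qed.

Lemma sobolev_ball1_bounded u M : sobolev_ball 1 +oo%E M u -> ae_bounded leb2 cell u M.
Proof.
move=> [_ mu Mu _]; split; first exact: measurable_funTS.
exact: Lnorm_infty_ae.
Qed.

(** The Sobolev ball bounds some weak derivative; the one occurring in the equation agrees with it
    almost everywhere because both have the same Fourier coefficients. *)
Lemma sobolev_ball1_partial u M i g : sobolev_ball 1 +oo%E M u -> weak_partial i u g ->
  ae_bounded leb2 cell g M.
Proof.
move=> [_ _ _ /(_ i) [g' wg' [_ mg' Mg' _]]] wg; have [_ Lg _] := wg; have [_ Lg' _] := wg'.
split; first by apply/measurable_EFinP; exact: measurable_int Lg.2.
apply: (ae_imply2 (coef_partial_unique Lg Lg' (weak_partial_coef wg) (weak_partial_coef wg'))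
  (Lnorm_infty_ae Mg')) => x h1 h2 Dx.
by rewrite h1// h2.
Qed.

End Fourier.

(** * The energy inequality at a fixed time *)

Section EnergyRate.
Context {R : realType}.
Implicit Types (f g h phi : R * R -> R) (u v w : vfield R).
Local Notation bounded := (bounded_fun leb2 cell).
Local Notation "'<|' f , g '|>'" := (ip leb2 cell f g).
Local Notation integrable_cell f := (leb2.-integrable cell (EFin \o f)).

(** This and the following rules for [ip] ask only one factor to be bounded: the time derivative and
    the pressure gradient are known only to be integrable. *)
Lemma ip1_integrable f phi : integrable_cell f -> bounded phi -> integrable_cell (f \* phi).
Proof. exact: integrable_bounded_funM. Qed.

Lemma ip1Dl f g phi : integrable_cell f -> integrable_cell g -> bounded phi ->
  <| f \+ g, phi |> = <| f, phi |> + <| g, phi |>.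
Proof.
move=> fi gi bp; rewrite /ip -RintegralD//; [|exact: ip1_integrable|exact: ip1_integrable].
by apply: eq_Rintegral => x _; rewrite mulrDl.
Qed.

Lemma ip1Bl f g phi : integrable_cell f -> integrable_cell g -> bounded phi ->
  <| f \- g, phi |> = <| f, phi |> - <| g, phi |>.
Proof.
move=> fi gi bp; rewrite /ip -RintegralB//; [|exact: ip1_integrable|exact: ip1_integrable].
by apply: eq_Rintegral => x _; rewrite mulrBl.
Qed.

Lemma ip1Zl c f phi : integrable_cell f -> bounded phi ->
  <| (fun x => c * f x), phi |> = c * <| f, phi |>.
Proof.
move=> fi bp; rewrite /ip -RintegralZl//; last exact: ip1_integrable.
by apply: eq_Rintegral => x _; rewrite mulrA.
Qed.

Lemma integrable_cellD f g : integrable_cell f -> integrable_cell g -> integrable_cell (f \+ g).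
Proof. by move=> fi gi; apply: eq_integrable (integrableD measurable_cell fi gi). Qed.

Lemma integrable_cellB f g : integrable_cell f -> integrable_cell g -> integrable_cell (f \- g).
Proof. by move=> fi gi; apply: eq_integrable (integrableB measurable_cell fi gi). Qed.

Lemma integrable_cellZ (c : R) f : integrable_cell f -> integrable_cell (fun x => c * f x).
Proof. by move=> fi; apply: eq_integrable (integrableZl measurable_cell c fi). Qed.

Lemma integrable_cell_measurable f : integrable_cell f -> measurable_fun cell f.
Proof. by move=> fi; apply/measurable_EFinP; exact: measurable_int fi. Qed.

Lemma ip1_ae f g phi : integrable_cell f -> integrable_cell g -> bounded phi ->
  {ae leb2, forall x, cell x -> f x = g x} -> <| f, phi |> = <| g, phi |>.
Proof.
move=> fi gi bp fg; apply: ae_eq_Rintegral => //.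
- by apply: integrable_cell_measurable; exact: ip1_integrable.
- by apply: integrable_cell_measurable; exact: ip1_integrable.
by apply: (ae_imply fg) => x h Dx; rewrite h.
Qed.

Lemma bounded_integrable f : bounded f -> integrable_cell f.
Proof. by move=> bf; exact: (bounded_fun_integrable measurable_cell leb2_cell_lty). Qed.

Lemma ip_self_le f (K : R) : ae_bounded leb2 cell f K -> <| f, f |> <= K ^+ 2 * (2 * pi) ^+ 2.
Proof.
move=> hf; have := ip_ae_le measurable_cell leb2_cell_lty hf (bounded_fun_cst leb2 cell 1).
have -> : f \* (fun=> 1) = f by apply/funext => x /=; rewrite mulr1.
move=> /le_trans; apply; rewrite le_eqVlt; apply/orP; left; apply/eqP; congr (_ * _).
rewrite /ip Rintegral_cst// !mul1r.
suff E : fine (leb2 (cell : set (measurableTypeR R * measurableTypeR R))) = (2 * pi) ^+ 2 by exact: E.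
by rewrite leb2_cell.
Qed.

Definition energyN N w : R := \sum_(j < 2) \sum_(k : modes N) <| w j, harmN k |> ^+ 2.

Definition rateN N w (wt : vfield R) : R :=
  \sum_(j < 2) \sum_(k : modes N) <| w j, harmN k |> * <| wt j, harmN k |>.

Definition energy w : R := \sum_(j < 2) <| w j, w j |>.

Lemma energyN_cvg w : (forall j, bounded (w j)) -> (fun N => energyN N w) @ \oo --> energy w.
Proof.
move=> bw; rewrite /energyN /energy big_ord_recl big_ord1.
under eq_fun do rewrite big_ord_recl big_ord1.
have h j : (fun N => \sum_(k : modes N) <| w j, harmN k |> ^+ 2) @ \oo --> <| w j, w j |>.
  under eq_fun do rewrite -(ip_proj_proj measurable_cell leb2_cell_lty (@bounded_harmN _ _)
    (@harmN_orth _ _) (@harmN_norm _ _) (bw j)).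
  by apply: (cvgL2_ip measurable_cell leb2_cell_lty); exact: fproj_cvgL2.
by apply: cvgD; exact: h.
Qed.

Definition advection u (Du : 'I_2 -> vfield R) : vfield R :=
  fun j x => \sum_(i < 2) u i x * Du i j x.

(** Subtracting the two equations removes the common force. Against a harmonic the Laplacian becomes
    multiplication by - [eigen k], and the pressure gradient moves onto the flipped harmonic. *)
Lemma momentum_coef (alpha epsilon : R) (f u ut v vt : vfield R) (p q : R * R -> R)
   (Du Dv : 'I_2 -> vfield R) (Lu Lv Dp Dq : vfield R) j k :
  (forall j, bounded (u j)) -> (forall j, bounded (v j)) ->
  (forall i j, bounded (Du i j)) -> (forall i j, bounded (Dv i j)) ->
  (forall j, weak_laplacian (fun x => epsilon * u j x) (Lu j)) ->
  (forall j, weak_laplacian (fun x => epsilon * v j x) (Lv j)) ->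
  (forall j, weak_partial j p (Dp j)) -> (forall j, weak_partial j q (Dq j)) ->
  (forall j, {ae leb2, forall x, ut j x + \sum_(i < 2) u i x * Du i j x - Lu j x + alpha * u j x
        + Dp j x = f j x}) ->
  (forall j, {ae leb2, forall x, vt j x + \sum_(i < 2) v i x * Dv i j x - Lv j x + alpha * v j x
        + Dq j x = f j x}) ->
  (forall j, integrable_cell (ut j)) -> (forall j, integrable_cell (vt j)) ->
  <| ut j \- vt j, harm2 k |> = - <| advection u Du j \- advection v Dv j, harm2 k |>
    - (alpha + epsilon * eigen k) * <| u j \- v j, harm2 k |>
    + freq j k * (<| p, harm2 (flip2 j k) |> - <| q, harm2 (flip2 j k) |>).
Proof.
move=> bu bv bDu bDv lu lv wp wq equ eqv uti vti.
have be : bounded (harm2 k : R * R -> R) := bounded_harm2 k.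
have bA (a : vfield R) (Da : 'I_2 -> vfield R) : (forall j, bounded (a j)) ->
    (forall i j, bounded (Da i j)) -> bounded (advection a Da j).
  by move=> ba bDa; apply: bounded_fun_sum => i; exact: bounded_funM.
have [_ Lui _] := lu j; have [_ Lvi _] := lv j.
have [_ Dpi _] := wp j; have [_ Dqi _] := wq j.
have iA := bounded_integrable (bA _ _ bu bDu); have iB := bounded_integrable (bA _ _ bv bDv).
have iu := bounded_integrable (bu j); have iv := bounded_integrable (bv j).
pose F a b c d : R * R -> R := (((fun x => (-1) * a x) \+ b) \- (fun x => alpha * c x)) \- d.
have iF a b c d : integrable_cell a -> integrable_cell b -> integrable_cell c -> integrable_cell d ->
    integrable_cell (F a b c d).
  move=> ia ib ic id; apply: integrable_cellB => //; apply: integrable_cellB; last exact: integrable_cellZ.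
  by apply: integrable_cellD => //; exact: integrable_cellZ.
have ipF a b c d : integrable_cell a -> integrable_cell b -> integrable_cell c -> integrable_cell d ->
    <| F a b c d, harm2 k |> = - <| a, harm2 k |> + <| b, harm2 k |> - alpha * <| c, harm2 k |> - <| d, harm2 k |>.
  move=> ia ib ic id; rewrite ip1Bl//; last first.
    apply: integrable_cellB; last exact: integrable_cellZ.
    by apply: integrable_cellD => //; exact: integrable_cellZ.
  rewrite ip1Bl//; [|by apply: integrable_cellD => //; exact: integrable_cellZ|exact: integrable_cellZ].
  by rewrite ip1Dl ?ip1Zl//; [ring|exact: integrable_cellZ].
have -> : <| ut j \- vt j, harm2 k |> = <| F (advection u Du j \- advection v Dv j)
     (Lu j \- Lv j) (u j \- v j) (Dp j \- Dq j), harm2 k |>.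
  apply: ip1_ae => //.
  - exact: integrable_cellB.
  - by apply: iF; apply: integrable_cellB => //; [exact: Lui.2|exact: Lvi.2|exact: Dpi.2|exact: Dqi.2].
  apply: (ae_imply2 (equ j) (eqv j)) => x h1 h2 _; rewrite /F /advection /=.
  by move: h2; rewrite -h1 => /eqP; rewrite -subr_eq0 => /eqP h; apply/eqP;
    rewrite -subr_eq0 -oppr_eq0; apply/eqP; rewrite -[RHS]h; ring.
rewrite ipF; [|exact: integrable_cellB|exact: (integrable_cellB Lui.2 Lvi.2)|exact: integrable_cellB|
  exact: (integrable_cellB Dpi.2 Dqi.2)].
rewrite (ip1Bl Lui.2 Lvi.2 be) (ip1Bl Dpi.2 Dqi.2 be) (ip1Bl iu iv be).
rewrite (weak_laplacian_coef k (lu j)) (weak_laplacian_coef k (lv j)).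
rewrite (weak_partial_coef (wp j) k) (weak_partial_coef (wq j) k).
by rewrite !ip1Zl//; ring.
Qed.

(** Integration by parts on the Fourier side: reindexing by the flip moves the factor [freq] from
    the pressure to [w], where it forms the coefficients of the divergence. The scalar family [c] is
    arbitrary, so no estimate on the pressure enters. *)
Lemma pressure_eq0 N (w gw : vfield R) (c : (nat * bool) * (nat * bool) -> R) :
  (forall j, coef_partial j (w j) (gw j)) ->
  (forall k, \sum_(j < 2) <| gw j, harm2 k |> = 0) ->
  \sum_(j < 2) \sum_(k : modes N) <| w j, harmN k |> *
    (freq j (mode_val k) * c (flip2 j (mode_val k))) = 0.
Proof.
move=> cw gw0.
under eq_bigr => j _ do rewrite (reindex_inj (inv_inj (@flipNK N j))) /=.
rewrite exchange_big/= big1// => k _.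
under eq_bigr => j _.
  rewrite /harmN mode_val_flipN flip2K freq_flip2.
  rewrite (_ : _ * _ = <| gw j, harm2 (mode_val k) |> * c (mode_val k)); first by over.
  by rewrite cw; ring.
by rewrite -mulr_suml gw0 mul0r.
Qed.

(** A bound for -2 (B, P_N w) by |B|^2 + |w|^2, where B is the difference of the advection terms:
    each component of B is at most 2 (M^2 + delta^2), each component of w at most M + delta, the
    cell has area (2 pi)^2, and there are two components. *)
Definition rate_bound (M delta : R) : R :=
  (((2 * (M * M + delta * delta)) ^+ 2 + (M + delta) ^+ 2) * (2 * pi) ^+ 2) *+ 2.

Lemma advection_ae_bounded u Du M j : (forall j, ae_bounded leb2 cell (u j) M) ->
  (forall i j, ae_bounded leb2 cell (Du i j) M) ->
  ae_bounded leb2 cell (advection u Du j) (2 * (M * M)).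
Proof.
move=> bu bDu.
have := ae_boundedD (ae_boundedM (bu 0) (bDu 0 j)) (ae_boundedM (bu 1) (bDu 1 j)).
rewrite (_ : 2 * (M * M) = M * M + M * M); last by ring.
congr ae_bounded; apply/funext => x.
have e1 : lift ord0 ord0 = 1 :> 'I_2 by exact: val_inj.
by rewrite /advection big_ord_recl big_ord1 e1.
Qed.

(** Expand 0 <= |f h + delta g|^2, bound |f h|^2 by delta^2 |f|^2, and divide by 2 delta. *)
Lemma stretching_le (delta : R) f g h : 0 < delta -> bounded f -> ae_bounded leb2 cell h delta ->
  bounded g -> - <| f \* h, g |> <= delta / 2 * (<| f, f |> + <| g, g |>).
Proof.
move=> d0 bf bh bg; have bh' : bounded h by exists delta.
have bfh := bounded_funM bf bh'.
pose dg x := delta * g x.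
have bdg : bounded dg := bounded_funZ delta bg.
have e1 : <| f \* h, dg |> = delta * <| f \* h, g |>.
  exact: (ipZr measurable_cell leb2_cell_lty delta bg bfh).
have e2 : <| dg, dg |> = delta * (delta * <| g, g |>).
  have e3 : <| dg, dg |> = delta * <| g, dg |>.
    exact: (ipZl measurable_cell leb2_cell_lty delta bg bdg).
  by rewrite e3; congr (_ * _); exact: (ipZr measurable_cell leb2_cell_lty delta bg bg).
have := ip_ge0 leb2 cell ((f \* h) \+ dg).
rewrite (ip_sqrD measurable_cell leb2_cell_lty bfh bdg) e1 e2.
have : <| f \* h, f \* h |> <= delta ^+ 2 * <| f, f |>.
  have := ip_ae_le measurable_cell leb2_cell_lty bh bf.
  by rewrite (_ : h \* f = f \* h)//; apply/funext => x /=; rewrite mulrC.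
move=> h1 h2; rewrite -(ler_pM2l (_ : 0 < 2 * delta)) ?mulr_gt0//.
have -> : 2 * delta * (delta / 2 * (<| f, f |> + <| g, g |>)) =
   delta ^+ 2 * <| f, f |> + delta ^+ 2 * <| g, g |> by field.
move: h1 h2; clear dg bdg e1 e2.
move: <| f \* h, f \* h |> <| f \* h, g |> <| f, f |> <| g, g |> => x y z t.
by rewrite expr2; clear; lra.
Qed.

(** The truncated rate is bounded by an expression [x N] which involves no time derivative and no
    pressure and converges as N grows; only the sign of its limit has to be checked. *)
Lemma energy_rate (alpha epsilon delta M : R) (f u ut v vt : vfield R) (p q : R * R -> R) :
  0 <= alpha -> 0 <= epsilon -> 0 < delta -> 4 * delta <= alpha + epsilon ->
  momentum_eq alpha epsilon f u ut p -> momentum_eq alpha epsilon f v vt q ->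
  div_free u -> div_free v -> mean_zero u -> mean_zero v ->
  (forall j, sobolev_ball 1 +oo%E M (u j)) -> (forall j, sobolev_ball 1 +oo%E delta (v j)) ->
  (forall j, integrable_cell (ut j)) -> (forall j, integrable_cell (vt j)) ->
  exists2 r : nat -> R, r @ \oo --> (0 : R) &
    forall N, 2 * rateN N (fun j => u j \- v j) (fun j => ut j \- vt j) +
       (alpha + epsilon) * energyN N (fun j => u j \- v j) <= r N /\
      0 <= r N <= rate_bound M delta.
Proof.
move=> a0 e0 d0 da [Du [Lu [Dp [wDu lu wp equ]]]] [Dv [Lv [Dq [wDv lv wq eqv]]]].
move=> [gu wgu du] [gv wgv dv] mu mv su sv uti vti.
set w : vfield R := fun j => u j \- v j.
have abu j := sobolev_ball1_bounded (su j); have abv j := sobolev_ball1_bounded (sv j).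
have abDu i j := sobolev_ball1_partial (su j) (wDu i j).
have abDv i j := sobolev_ball1_partial (sv j) (wDv i j).
have bu j : bounded (u j) by exists M. have bv j : bounded (v j) by exists delta.
have bDu i j : bounded (Du i j) by exists M. have bDv i j : bounded (Dv i j) by exists delta.
have bw j : bounded (w j) by exact: bounded_funB.
pose B : vfield R := fun j => advection u Du j \- advection v Dv j.
have abB j : ae_bounded leb2 cell (B j) (2 * (M * M + delta * delta)).
  have h1 := advection_ae_bounded j abu abDu; have [h2 h3] := advection_ae_bounded j abv abDv.
  have h4 : ae_bounded leb2 cell (fun x => - advection v Dv j x) (2 * (delta * delta)).
    split; first by apply: measurableT_comp h2 => //; exact: oppr_measurable.
    by apply: (ae_imply h3) => x h Dx; rewrite normrN h.
  by have := ae_boundedD h1 h4; rewrite mulrDr.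
have bB j : bounded (B j) by eexists; exact: abB.
have abw j : ae_bounded leb2 cell (w j) (M + delta).
  have [h2 h3] := abv j.
  have h4 : ae_bounded leb2 cell (fun x => - v j x) delta.
    split; first by apply: measurableT_comp h2 => //; exact: oppr_measurable.
    by apply: (ae_imply h3) => x h Dx; rewrite normrN h.
  exact: ae_boundedD (abu j) h4.
have L1 (a b : R * R -> R) i : weak_partial i a b -> L1_torus a /\ L1_torus b by case.
have cw i j : coef_partial i (w j) (Du i j \- Dv i j).
  have [l1 l2] := L1 _ _ _ (wDu i j); have [l3 l4] := L1 _ _ _ (wDv i j).
  by apply: coef_partialB => //; exact: weak_partial_coef.
have cgw j : coef_partial j (w j) (gu j \- gv j).
  have [l1 l2] := L1 _ _ _ (wgu j); have [l3 l4] := L1 _ _ _ (wgv j).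
  by apply: coef_partialB => //; exact: weak_partial_coef.
have gw0 k : \sum_(j < 2) <| gu j \- gv j, harm2 k |> = 0.
  have i1 j : integrable_cell (gu j \- gv j).
    by apply: integrable_cellB; [have [_ []] := L1 _ _ _ (wgu j)|have [_ []] := L1 _ _ _ (wgv j)].
  rewrite big_ord_recl big_ord1 -(ip1Dl (i1 _) (i1 _) (bounded_harm2 k)).
  rewrite (@ip1_ae _ (fun x => 0 * (cst 0 x)) _ _ _ (bounded_harm2 k)).
  - by rewrite ip1Zl ?mul0r//; [exact: bounded_integrable (bounded_fun_cst _ _ 0)|exact: bounded_harm2].
  - exact: integrable_cellD.
  - by apply: integrable_cellZ; exact: bounded_integrable (bounded_fun_cst _ _ 0).
  apply: (ae_imply2 du dv) => x; rewrite !big_ord_recl !big_ord0 !addr0 => h1 h2 _ /=.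
  by rewrite mul0r addrACA h1 -opprD h2 subr0.
have w0 j : \int[leb2]_(x in cell) w j x = 0.
  by rewrite RintegralB ?mu ?mv ?subrr//; exact: bounded_integrable.
pose adv N := \sum_(j < 2) <| B j, fproj N (w j) |>.
have rateE N : rateN N w (fun j => ut j \- vt j) <= - adv N - (alpha + epsilon) * energyN N w.
  rewrite /rateN.
  have E j k := momentum_coef j k bu bv bDu bDv lu lv wp wq equ eqv uti vti.
  have P0 := pressure_eq0 N (fun l => <| p, harm2 l |> - <| q, harm2 l |>) cgw gw0.
  have -> : \sum_(j < 2) \sum_(k : modes N) <| w j, harmN k |> * <| ut j \- vt j, harmN k |> =
    - adv N - \sum_(j < 2) \sum_(k : modes N) (alpha + epsilon * eigen (mode_val k)) * <| w j, harmN k |> ^+ 2.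
    have advE j : <| B j, fproj N (w j) |> = \sum_(k : modes N) <| w j, harmN k |> * <| B j, harmN k |>.
      rewrite ipC.
      exact: (ip_projl measurable_cell leb2_cell_lty (@bounded_harmN _ _) (bw j) (bB j)).
    rewrite -[RHS]addr0 -[X in _ = _ + X]P0 /adv -!sumrN -!big_split/=; apply: eq_bigr => j _.
    rewrite advE -!sumrN -!big_split/=; apply: eq_bigr => k _.
    rewrite E -/(B j) -/(w j) /harmN; ring.
  (* Poincare's inequality mode by mode: each eigenvalue is replaced by 1. *)
  rewrite lerD2l lerN2 /energyN mulr_sumr; apply: ler_sum => j _.
  rewrite mulr_sumr; apply: ler_sum => k _.
  rewrite !mulrDl lerD2l -mulrA ler_wpM2l//.
  by apply: poincare_coef => //; exact: bounded_integrable.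
(* Of the dissipation 2 (alpha + epsilon) E_N one half becomes the decay term of the claim; the
   other half stays here to absorb the stretching. *)
pose x N := - 2 * adv N - (alpha + epsilon) * energyN N w.
pose l := - 2 * (\sum_(j < 2) <| B j, w j |>) - (alpha + epsilon) * energy w.
have xl : x @ \oo --> l.
  apply: cvgB; last by apply: cvgM; [exact: cvg_cst|exact: energyN_cvg].
  apply: cvgM; first exact: cvg_cst.
  rewrite /adv big_ord_recl big_ord1; under eq_fun do rewrite big_ord_recl big_ord1.
  by apply: cvgD; apply: (cvgL2_ip measurable_cell leb2_cell_lty
    (cvgL2_cst measurable_cell leb2_cell_lty (bB _)) (fproj_cvgL2 (bw _))).
have l0 : l <= 0.
  have T j : \sum_(i < 2) <| u i \* (Du i j \- Dv i j), w j |> = 0.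
    by apply: (transport_eq0 wgu du) => // i; exact: bounded_funB.
  (* With w = u - v, the advection difference is u . grad w + w . grad v; the first part is pure
     transport by a divergence free field and vanishes. *)
  have BE j : <| B j, w j |> = \sum_(i < 2) <| w i \* Dv i j, w j |>.
    transitivity (\sum_(i < 2) (<| u i \* (Du i j \- Dv i j), w j |> + <| w i \* Dv i j, w j |>)); last first.
      by rewrite big_split/= T add0r.
    have -> : B j = (fun y => \sum_(i < 2) ((u i \* (Du i j \- Dv i j)) \+ (w i \* Dv i j)) y).
      apply/funext => y; rewrite /B /advection /w /= -sumrB; apply: eq_bigr => i _; ring.
    have b1 i : bounded (u i \* (Du i j \- Dv i j)) by apply: bounded_funM => //; exact: bounded_funB.
    have b2 i : bounded (w i \* Dv i j) by exact: bounded_funM.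
    rewrite (ip_suml measurable_cell leb2_cell_lty)//; last by move=> i; exact: bounded_funD.
    by apply: eq_bigr => i _; exact: (ipDl measurable_cell leb2_cell_lty (b1 i) (b2 i) (bw j)).
  have S : - (\sum_(j < 2) <| B j, w j |>) <= 2 * delta * energy w.
    under eq_bigr do rewrite BE.
    have S1 i j := stretching_le d0 (bw i) (abDv i j) (bw j).
    rewrite /energy !big_ord_recl !big_ord0 !addr0.
    have A4 (x1 x2 x3 x4 y1 y2 y3 y4 : R) : - x1 <= y1 -> - x2 <= y2 -> - x3 <= y3 -> - x4 <= y4 ->
      - (x1 + x2 + (x3 + x4)) <= y1 + y2 + (y3 + y4) by clear; lra.
    (* In the sum over i and j each |w_i|^2 is counted four times with weight delta / 2, hence the
       constant 2 delta. *)
    apply: le_trans (A4 _ _ _ _ _ _ _ _ (S1 _ _) (S1 _ _) (S1 _ _) (S1 _ _)) _.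
    rewrite le_eqVlt; apply/orP; left; apply/eqP; move: <| w ord0, w ord0 |> <| w _, w _ |>.
    by clear => x y; field.
  have E0 : 0 <= energy w by apply: sumr_ge0 => j _; exact: ip_ge0.
  have : 4 * delta * energy w <= (alpha + epsilon) * energy w by rewrite ler_wpM2r.
  by rewrite /l; move: S; move: (energy w) (\sum_(j < 2) _) => x1 x2; clear; lra.
(* Since the limit [l] is nonpositive, the positive part of [x N] is at most |x N - l|, which tends
   to 0. *)
exists (fun N => Num.max 0 (x N)).
  apply: (@squeeze_cvgr _ _ _ _ (cst 0) (fun N => `|x N - l|)).
  - near=> N; rewrite le_max lexx/= ge_max normr_ge0/=.
    by apply: le_trans (ler_norm _); rewrite lerDl oppr_ge0.
  - exact: cvg_cst.
  - by apply/norm_cvg0P; rewrite -(subrr l); apply: cvgB => //; exact: cvg_cst.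
move=> N; split.
  rewrite le_max; apply/orP; right; rewrite /x.
  have := rateE N; move: (rateN _ _ _) (adv N) (energyN _ _) => x1 x2 x3; clear; lra.
rewrite le_max lexx/= ge_max; apply/andP; split.
  by rewrite /rate_bound mulrn_wge0// mulr_ge0 ?addr_ge0 ?sqr_ge0.
have E0 : 0 <= (alpha + epsilon) * energyN N w.
  by apply: mulr_ge0; [exact: addr_ge0|apply: sumr_ge0 => j _; apply: sumr_ge0 => k _; exact: sqr_ge0].
(* The dissipation is dropped here; the advection term is bounded for all N at once by Bessel's
   inequality. *)
apply: (@le_trans _ _ (- 2 * adv N)); first by rewrite /x gerBl.
have h j : - 2 * <| B j, fproj N (w j) |> <=
    ((2 * (M * M + delta * delta)) ^+ 2 + (M + delta) ^+ 2) * (2 * pi) ^+ 2.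
  have bS := bounded_fproj N (w j).
  have := ip_ge0 leb2 cell (B j \+ fproj N (w j)).
  rewrite (ip_sqrD measurable_cell leb2_cell_lty (bB j) bS).
  have := ip_self_le (abB j); have := ip_self_le (abw j).
  have : <| fproj N (w j), fproj N (w j) |> <= <| w j, w j |>.
    rewrite (ip_proj_proj measurable_cell leb2_cell_lty (@bounded_harmN _ _)
      (@harmN_orth _ _) (@harmN_norm _ _) (bw j)).
    exact: (bessel measurable_cell leb2_cell_lty (@bounded_harmN _ _)
      (@harmN_orth _ _) (@harmN_norm _ _) (bw j)).
  move: <| fproj _ _, _ |> <| B j, B j |> <| w j, w j |> <| B j, _ |> => x1 x2 x3 x4.
  by rewrite mulrDl; clear; lra.
rewrite /adv mulr_sumr big_ord_recl big_ord1 /rate_bound mulr2n.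
exact: lerD.
Unshelve. all: by end_near. Qed.

End EnergyRate.

(** * Absolutely continuous functions of time *)

Section AbsoluteContinuity.
Context {R : realType}.
Notation leb := (@lebesgue_measure R).
Implicit Types (A B f g b : R -> R) (s t x y c : R).

Lemma ae_exists_itv (P : R -> Prop) x y : {ae leb, forall t, P t} -> x < y ->
  exists t, x < t < y /\ P t.
Proof.
move=> [N [mN N0 sN]] xy; apply: contrapT => nP.
have sub : `]x, y[%classic `<=` N.
  move=> t; rewrite /= in_itv/= => txy; apply: sN => /= Pt.
  by apply: nP; exists t.
have : (leb `]x, y[%classic <= leb N)%E by apply: le_measure => //; rewrite inE.
rewrite N0 lebesgue_measure_itv/= lte_fin xy -EFinB lee_fin.
by rewrite leNgt subr_gt0 xy.
Qed.

Lemma itv_integrableS s t x y f : s <= x -> y <= t -> leb.-integrable `[s, t] (EFin \o f) ->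
  leb.-integrable `[x, y] (EFin \o f).
Proof.
move=> sx yt; apply: integrableS => //.
by apply: subset_itv; rewrite bnd_simp.
Qed.

Lemma Rintegral_split s x y f : s <= x -> x <= y -> leb.-integrable `[s, y] (EFin \o f) ->
  \int[leb]_(z in `[s, y]) f z = \int[leb]_(z in `[s, x]) f z + \int[leb]_(z in `[x, y]) f z.
Proof.
move=> sx xy fi.
have := @Rintegral_itvB R f (BLeft s) (BRight y) x fi.
rewrite !bnd_simp => /(_ sx xy) h.
rewrite -(Rintegral_itv_obnd_cbnd (r := x)); last first.
  by apply: integrableS fi => //; apply: subset_itv; rewrite bnd_simp.
by rewrite -h; ring.
Qed.

(** Continuous induction: the supremum of the points up to which the estimate holds can be passed by
    the local estimate around it. Only intervals containing [c] are needed locally. *)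
Lemma local_to_global (F G : R -> R) s t : s <= t ->
  (forall c, s <= c <= t -> exists2 e, 0 < e & forall x y, s <= x -> x <= c -> c <= y -> y <= t ->
     c - e < x -> y < c + e -> `|F y - F x| <= G y - G x) ->
  `|F t - F s| <= G t - G s.
Proof.
move=> st H; pose S := [set x | s <= x <= t /\ `|F x - F s| <= G x - G s].
have Ss : S s by rewrite /S /= lexx st !subrr normr0.
have Sub : has_ubound S by exists t => x [/andP[]].
have hS : has_sup S by split => //; exists s.
set c := sup S.
have sc : s <= c by exact: ub_le_sup.
have ct : c <= t by apply: ge_sup; [exists s|move=> x [/andP[]]].
have [e e0 He] := H c (introT andP (conj sc ct)).
have [x Sx cx] := sup_adherent e0 hS.
have xc : x <= c by exact: ub_le_sup.
case: Sx => /andP[sx xt] Px.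
have step y : c <= y -> y <= t -> y < c + e -> `|F y - F s| <= G y - G s.
  move=> cy yt ye; have := He x y sx xc cy yt cx ye.
  move=> h; rewrite (_ : F y - F s = (F y - F x) + (F x - F s)); last by ring.
  apply: le_trans (ler_normD _ _) _; rewrite (_ : G y - G s = (G y - G x) + (G x - G s)); last by ring.
  exact: lerD.
have [ct'|tc] := ltP c t; last first.
  by apply: step => //; rewrite (le_lt_trans tc)// ltrDl.
pose y := Num.min t (c + e / 2).
have cy : c < y by rewrite lt_min ct' ltrDl divr_gt0.
have Sy : S y.
  split; first by rewrite (le_trans sc (ltW cy)) ge_min lexx.
  apply: step; [exact: ltW|by rewrite ge_min lexx|].
  by rewrite gt_min ltrD2l ltr_pdivrMr// ltr_pMr// ltr1n orbT.
by have := ub_le_sup Sub Sy; rewrite leNgt cy.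
Qed.

Lemma within_continuous_bounded s t A : {within `[s, t], continuous A} ->
  bounded_fun leb `[s, t] A.
Proof.
move=> cA; have := continuous_compact cA (segment_compact (a := s) (b := t)).
move=> /compact_bounded [M [_ /(_ (M + 1))]] h.
apply: (@bounded_fun_everywhere _ _ _ _ _ _ (M + 1)).
  by apply: subspace_continuous_measurable_fun.
by move=> x sx; apply: h; [rewrite ltrDl|exists x].
Qed.

Lemma within_continuous_near s t A c e : {within `[s, t], continuous A} -> s <= c <= t -> 0 < e ->
  exists2 d, 0 < d & forall x, s <= x <= t -> `|x - c| < d -> `|A x - A c| <= e.
Proof.
move=> /subspace_continuousP cA ct e0; have Ac : `[s, t]%classic c by rewrite /= in_itv.
have /cvgrPdist_le /(_ _ e0) := cA c Ac.
rewrite /within /= => -[d d0 hd]; exists d => // x xst xc.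
have := hd x; rewrite /ball_ /= in_itv/= => h; rewrite distrC; apply: h => //.
by rewrite distrC.
Qed.

(** Absolute continuity in integral form, with the density [b] carried along, so that no pointwise
    derivative of [A] is ever taken. *)
Definition is_AC s t A b := [/\ {within `[s, t], continuous A},
  leb.-integrable `[s, t] (EFin \o b) &
  forall x y, s <= x -> x <= y -> y <= t -> A y - A x = \int[leb]_(z in `[x, y]) b z].

Lemma AC_integrableM s t A b f : is_AC s t A b -> leb.-integrable `[s, t] (EFin \o f) ->
  leb.-integrable `[s, t] (EFin \o (f \* A)).
Proof.
move=> [cA _ _] fi; apply: integrable_bounded_funM => //; exact: within_continuous_bounded.
Qed.

Lemma itv_integrableD s t f g : leb.-integrable `[s, t] (EFin \o f) ->
  leb.-integrable `[s, t] (EFin \o g) -> leb.-integrable `[s, t] (EFin \o (f \+ g)).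
Proof. by move=> fi gi; apply: eq_integrable (integrableD _ fi gi). Qed.

Lemma itv_integrableZ s t (k : R) f : leb.-integrable `[s, t] (EFin \o f) ->
  leb.-integrable `[s, t] (EFin \o (fun x => k * f x)).
Proof. by move=> fi; apply: eq_integrable (integrableZl _ k fi). Qed.

Lemma itv_integrableZr s t (k : R) f : leb.-integrable `[s, t] (EFin \o f) ->
  leb.-integrable `[s, t] (EFin \o (fun x => f x * k)).
Proof. by move=> fi; apply: eq_integrable (integrableZr _ k fi). Qed.

(** The defect [F] of the product rule satisfies |F y - F x| <= e times the integral of |f| + |g| on
    short intervals, by continuity of [A] and [B]. This additive bound globalises, and e is
    arbitrary. *)
Lemma is_ACM s t A B f g : is_AC s t A f -> is_AC s t B g ->
  is_AC s t (A \* B) ((f \* B) \+ (g \* A)).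
Proof.
move=> aA aB; have [cA fi fA] := aA; have [cB gi gB] := aB.
have i1 := AC_integrableM aB fi; have i2 := AC_integrableM aA gi.
have i12 := itv_integrableD i1 i2.
split => //.
  move/subspace_continuousP : cA => cA; move/subspace_continuousP : cB => cB.
  by apply/subspace_continuousP => x xst; apply: (@cvgM _ _ _ _ A B); [exact: cA|exact: cB].
move=> x0 y0 sx0 xy0 yt0.
pose h := (f \* B) \+ (g \* A).
pose F x := A x * B x - \int[leb]_(z in `[s, x]) h z.
pose n x := `|f x| + `|g x|.
have nfi : leb.-integrable `[s, t] (EFin \o (fun x => `|f x|)) by exact: integrable_norm.
have ngi : leb.-integrable `[s, t] (EFin \o (fun x => `|g x|)) by exact: integrable_norm.
have ni : leb.-integrable `[s, t] (EFin \o n) by exact: itv_integrableD.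
have key e : 0 < e -> `|F y0 - F x0| <= e * \int[leb]_(z in `[x0, y0]) n z.
  move=> e0; pose G x := e * \int[leb]_(z in `[s, x]) n z.
  have GE x y : s <= x -> x <= y -> y <= t -> G y - G x = e * \int[leb]_(z in `[x, y]) n z.
    move=> sx xy yt; rewrite /G (Rintegral_split sx xy); first by ring.
    exact: itv_integrableS ni.
  rewrite -GE//; apply: local_to_global => // c /andP[xc cy].
  have cst : s <= c <= t by rewrite (le_trans sx0 xc) (le_trans cy yt0).
  (* Closeness e / 2 to the value at [c] gives oscillation at most e between any two points. *)
  have e2 : 0 < e / 2 by rewrite divr_gt0.
  have [d1 d10 h1] := within_continuous_near cA cst e2.
  have [d2 d20 h2] := within_continuous_near cB cst e2.
  exists (Num.min d1 d2); first by rewrite lt_min d10.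
  move=> x y x0x xc' cy' yy0 xd yd.
  have sx := le_trans sx0 x0x; have yt := le_trans yy0 yt0; have xy := le_trans xc' cy'.
  rewrite GE// /F (Rintegral_split sx xy); last exact: itv_integrableS i12.
  have near z : x <= z <= y -> `|A z - A c| <= e / 2 /\ `|B z - B c| <= e / 2.
    move=> /andP[xz zy]; have zst : s <= z <= t by rewrite (le_trans sx xz) (le_trans zy yt).
    have zc : `|z - c| < Num.min d1 d2.
      by rewrite ltr_norml; lra.
    by move: zc; rewrite lt_min => /andP[z1 z2]; split; [exact: h1|exact: h2].
  have osc z w : x <= z <= y -> x <= w <= y -> `|A z - A w| <= e /\ `|B z - B w| <= e.
    move=> /near [a1 b1] /near [a2 b2]; split.
      rewrite (_ : A z - A w = (A z - A c) - (A w - A c)); last by ring.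
      by apply: le_trans (ler_normB _ _) _; lra.
    rewrite (_ : B z - B w = (B z - B c) - (B w - B c)); last by ring.
    by apply: le_trans (ler_normB _ _) _; lra.
  have xyI := itv_integrableS sx yt.
  have ifx := xyI _ fi; have igx := xyI _ gi.
  have ih : leb.-integrable `[x, y] (EFin \o h) := xyI _ i12.
  have j1 := itv_integrableZr (B y) ifx; have j2 := itv_integrableZr (A x) igx.
  have j12 : leb.-integrable `[x, y] (EFin \o (fun z => f z * B y + g z * A x)) := itv_integrableD j1 j2.
  (* The increment A y B y - A x B x is (A y - A x) B y + A x (B y - B x), that is, the integral of
     f B y + g A x with [B y] and [A x] frozen. *)
  have E : A y * B y - (\int[leb]_(z in `[s, x]) h z + \int[leb]_(z in `[x, y]) h z) -
      (A x * B x - \int[leb]_(z in `[s, x]) h z) =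
      \int[leb]_(z in `[x, y]) ((f z * B y + g z * A x) - h z).
    have mxy : measurable (`[x, y]%classic : set (measurableTypeR R)) by exact: measurable_itv.
    rewrite (RintegralB mxy j12 ih) (RintegralD mxy j1 j2).
    rewrite (RintegralZr (B y) mxy ifx) (RintegralZr (A x) mxy igx).
    by rewrite -(fA _ _ sx xy yt) -(gB _ _ sx xy yt); ring.
  have i3 : leb.-integrable `[x, y] (EFin \o (fun z => (f z * B y + g z * A x) - h z)).
    by apply: eq_integrable (integrableB _ j12 ih).
  rewrite E; apply: le_trans (le_normr_Rintegral _ i3) _ => //.
  rewrite -RintegralZl//; last exact: xyI.
  apply: le_Rintegral => //.
  - exact: integrable_norm.
  - by apply: itv_integrableZ; exact: xyI.
  move=> z; rewrite /= in_itv/= => zxy.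
  have -> : f z * B y + g z * A x - h z = f z * (B y - B z) + g z * (A x - A z).
    by rewrite /h /=; ring.
  have [_ q1] := osc y z (introT andP (conj xy (lexx y))) zxy.
  have [q2 _] := osc x z (introT andP (conj (lexx x) xy)) zxy.
  apply: le_trans (ler_normD _ _) _; rewrite !normrM /n mulrDr.
  by apply: lerD; rewrite mulrC ler_wpM2r.
have F0 : F y0 - F x0 = 0.
  apply/eqP; rewrite -normr_le0; apply/ler_addgt0Pl => e e0; rewrite addr0.
  set K := \int[leb]_(z in `[x0, y0]) n z in key.
  have K0 : 0 <= K by apply: Rintegral_ge0 => z _; rewrite addr_ge0.
  have eK : 0 < e / (K + 1) by rewrite divr_gt0// ltr_wpDl.
  apply: le_trans (key _ eK) _.
  by rewrite mulrAC ler_pdivrMr ?ltr_wpDl// ler_pM2l// lerDl.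
move: F0; rewrite /F (Rintegral_split sx0 xy0); last exact: itv_integrableS i12.
by move=> F0; rewrite /= -/h -[RHS]add0r -F0; ring.
Qed.

Lemma is_ACD s t A B f g : is_AC s t A f -> is_AC s t B g -> is_AC s t (A \+ B) (f \+ g).
Proof.
move=> [cA fi fA] [cB gi gB]; split.
- move/subspace_continuousP : cA => cA; move/subspace_continuousP : cB => cB.
  by apply/subspace_continuousP => x xst; apply: (@cvgD _ _ _ _ _ A B); [exact: cA|exact: cB].
- exact: itv_integrableD.
move=> x y sx xy yt; rewrite RintegralD//; [|exact: itv_integrableS fi|exact: itv_integrableS gi].
by rewrite -fA// -gB//=; ring.
Qed.

Lemma is_AC_cst s t c : is_AC s t (fun=> c) (fun=> 0).
Proof.
split; first by move=> x; exact: cvg_cst.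
  by apply: eq_integrable (integrable0 _ _).
by move=> x y _ _ _; rewrite Rintegral_cst// mul0r subrr.
Qed.

Lemma is_ACB s t A B f g : is_AC s t A f -> is_AC s t B g -> is_AC s t (A \- B) (f \- g).
Proof.
move=> aA aB; have := is_ACD aA (is_ACM (is_AC_cst s t (-1)) aB).
by congr is_AC; apply/funext => x /=; ring.
Qed.

Lemma is_AC_sum (I : Type) (r : seq I) s t (A b : I -> R -> R) :
  (forall i, is_AC s t (A i) (b i)) ->
  is_AC s t (fun x => \sum_(i <- r) A i x) (fun x => \sum_(i <- r) b i x).
Proof.
move=> h; elim: r => [|i r IH].
  by under eq_fun do rewrite big_nil; under [X in is_AC _ _ _ X]eq_fun do rewrite big_nil; exact: is_AC_cst.
under eq_fun do rewrite big_cons; under [X in is_AC _ _ _ X]eq_fun do rewrite big_cons.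
exact: is_ACD.
Qed.

Lemma is_AC_C1 s t A b : (forall x, is_derive x (1 : R) A (b x)) -> continuous b -> is_AC s t A b.
Proof.
move=> dA cb; split.
- by apply: continuous_subspaceT; exact: is_derive_continuous dA.
- apply: continuous_compact_integrable; first exact: segment_compact.
  exact: continuous_subspaceT.
- by move=> x y _ xy _; rewrite (Rintegral_FTC2 xy dA cb).
Qed.

End AbsoluteContinuity.

(** * From weak derivatives in time to the integral formula *)

Section WeakTimeDerivative.
Context {R : realType}.
Notation leb := (@lebesgue_measure R).
Implicit Types (a b H h : R -> R) (s t T : R).

(** The kernels [h n] have mass 1 and live just to the right of [s], so only values of [a] at times
    after [s] and close to it count. *)
Lemma approx_identity a (h : nat -> R -> R) (e : nat -> R) s0 s T :
  s0 <= s -> (forall n, 0 < e n) -> e @ \oo --> (0 : R) ->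
  (forall n, continuous (h n)) -> (forall n x, 0 <= h n x) ->
  (forall n x, x <= s -> h n x = 0) -> (forall n x, s + e n <= x -> h n x = 0) ->
  (forall n, \int[leb]_(x in `[s0, T]) h n x = 1) ->
  {within `[s0, T], continuous a} -> s <= T ->
  (fun n => \int[leb]_(x in `[s0, T]) (h n x * a x)) @ \oo --> a s.
Proof.
move=> s0s e0 ec ch h0 hs hs' h1 ca sT.
have ba := within_continuous_bounded ca.
have hi n : leb.-integrable `[s0, T] (EFin \o h n).
  by apply: continuous_compact_integrable; [exact: segment_compact|exact: continuous_subspaceT].
have hai n : leb.-integrable `[s0, T] (EFin \o (fun x => h n x * a x)).
  exact: (integrable_bounded_funM _ (hi n) ba).
apply/cvgrPdist_le => z z0.
have sJ : s0 <= s <= T by rewrite s0s.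
have [d d0 hd] := within_continuous_near ca sJ z0.
have /cvgrPdist_lt /(_ _ d0) := ec; apply: filterS => n; rewrite sub0r normrN gtr0_norm// => ed.
have hci : leb.-integrable `[s0, T] (EFin \o (fun x => h n x * a s)) by exact: itv_integrableZr.
have mJ : measurable (`[s0, T]%classic : set (measurableTypeR R)) by exact: measurable_itv.
have -> : a s - \int[leb]_(x in `[s0, T]) (h n x * a x) =
    \int[leb]_(x in `[s0, T]) (h n x * a s - h n x * a x).
  by rewrite (RintegralB mJ hci (hai n)) (RintegralZr _ mJ (hi n)) h1 mul1r.
have i3 : leb.-integrable `[s0, T] (EFin \o (fun x => h n x * a s - h n x * a x)).
  by apply: eq_integrable (integrableB mJ hci (hai n)).
apply: le_trans (le_normr_Rintegral mJ i3) _.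
rewrite -[leRHS]mul1r -(h1 n) -(RintegralZr _ mJ (hi n)).
apply: le_Rintegral => //.
- exact: integrable_norm.
- exact: itv_integrableZr.
move=> x; rewrite /= in_itv/= => xJ; rewrite -mulrBr normrM ger0_norm//.
have [xs|sx] := leP x s; first by rewrite hs// !mul0r.
have [xe|xe] := leP (s + e n) x; first by rewrite hs'// !mul0r.
rewrite ler_wpM2l// distrC; apply: hd => //.
by rewrite gtr0_norm ?subr_gt0//; lra.
Qed.

Definition test_profile s T H h := [/\ forall x, is_derive x (1 : R) H (h x), continuous h,
  forall x, x <= s -> H x = 0 /\ h x = 0, forall x, T <= x -> H x = 0 /\ h x = 0 & smooth1 H].

(** Test with a step rising just after [s] minus a step rising just after [t]. The derivative side
    tends to a s - a t, and the other side to the integral over ]s, t] by dominated convergence.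
    Time beyond [t] is required for the second step to rise. *)
Lemma weak_FTC a b s t T : s < t -> t < T -> {within `[s, T], continuous a} ->
  leb.-integrable `[s, T] (EFin \o b) ->
  (forall H h, test_profile s T H h -> \int[leb]_(x in `[s, T]) (h x * a x) =
      - \int[leb]_(x in `[s, T]) (H x * b x)) ->
  a t - a s = \int[leb]_(x in `[s, t]) b x.
Proof.
move=> st tT ca bi W; have sT := lt_trans st tT.
have mJ : measurable (`[s, T]%classic : set (measurableTypeR R)) by exact: measurable_itv.
(* The width is at most T - t, so the second step is complete at [T] and the difference of the steps
   vanishes from there on. *)
pose e n : R := (T - t) * n.+1%:R^-1.
have Tt : 0 < T - t by rewrite subr_gt0.
have e0 n : 0 < e n by rewrite divr_gt0.
have eT n : e n <= T - t by rewrite ler_pdivrMr// ler_peMr ?(ltW Tt)// ler1n.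
have ec : e @ \oo --> (0 : R).
  rewrite -(mulr0 (T - t)); apply: cvgM; first exact: cvg_cst.
  exact: cvg_harmonic.
have stepE r n : exists p : (R -> R) * (R -> R), is_step r (r + e n) p.1 p.2.
  have [|H [h Hh]] := @smooth_step R r (r + e n); first by rewrite ltrDl.
  by exists (H, h).
have [P1 hP1] := choice (stepE s); have [P2 hP2] := choice (stepE t).
have int1 r n H h : s <= r -> r <= t -> is_step r (r + e n) H h -> \int[leb]_(x in `[s, T]) h x = 1.
  move=> sr rt [[dH ch _ [H0 H1] _] _].
  rewrite (Rintegral_FTC2 (ltW sT) dH ch) H1 ?H0 ?subr0//.
  by have := eT n; lra.
have W' n : \int[leb]_(x in `[s, T]) ((P1 n).2 x * a x) - \int[leb]_(x in `[s, T]) ((P2 n).2 x * a x) =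
   - \int[leb]_(x in `[s, T]) (((P1 n).1 x - (P2 n).1 x) * b x).
  have [[d1 c1 [p1 q1] [z1 o1] [y1 w1]] s1] := hP1 n.
  have [[d2 c2 [p2 q2] [z2 o2] [y2 w2]] s2] := hP2 n.
  have ba := within_continuous_bounded ca.
  have hi h : continuous h -> leb.-integrable `[s, T] (EFin \o (fun x => h x * a x)).
    move=> ch; apply: (integrable_bounded_funM _ _ ba) => //.
    by apply: continuous_compact_integrable; [exact: segment_compact|exact: continuous_subspaceT].
  rewrite -(RintegralB mJ (hi _ c1) (hi _ c2)) -(W _ (fun x => (P1 n).2 x - (P2 n).2 x)).
    by apply: eq_Rintegral => x _; rewrite mulrBl.
  have en := eT n; split.
  - by move=> x; exact: (is_deriveB (d1 x) (d2 x)).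
  - by move=> x; apply: cvgB; [exact: c1|exact: c2].
  - by move=> x xs; rewrite z1 ?z2 ?y1 ?y2 ?subrr//; lra.
  - by move=> x xs; rewrite o1 ?o2 ?w1 ?w2 ?subrr//; lra.
  - move=> V L k Lin Lc; apply: CkD; first exact: s1.
    rewrite (_ : (fun x => _) = (fun x => (-1) * (P2 n).1 (L x))); first by apply: CkZ; exact: s2.
    by apply/funext => x /=; rewrite mulN1r.
have L1 : (fun n => \int[leb]_(x in `[s, T]) ((P1 n).2 x * a x)) @ \oo --> a s.
  apply: (@approx_identity a (fun n => (P1 n).2) e s s T) => //; try exact: ltW.
  - by move=> n; case: (hP1 n) => -[].
  - by move=> n x; have [[_ _ [h _] _ _] _] := hP1 n; exact: h.
  - by move=> n x; have [[_ _ _ _ [h _]] _] := hP1 n; exact: h.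
  - by move=> n x; have [[_ _ _ _ [_ h]] _] := hP1 n; exact: h.
  - by move=> n; apply: int1 (hP1 n) => //; exact: ltW.
have L2 : (fun n => \int[leb]_(x in `[s, T]) ((P2 n).2 x * a x)) @ \oo --> a t.
  apply: (@approx_identity a (fun n => (P2 n).2) e s t T) => //; try exact: ltW.
  - by move=> n; case: (hP2 n) => -[].
  - by move=> n x; have [[_ _ [h _] _ _] _] := hP2 n; exact: h.
  - by move=> n x; have [[_ _ _ _ [h _]] _] := hP2 n; exact: h.
  - by move=> n x; have [[_ _ _ _ [_ h]] _] := hP2 n; exact: h.
  - by move=> n; apply: int1 (hP2 n) => //; exact: ltW.
(* The pointwise limit of the difference of steps is the indicator of the half-open interval: both
   steps are still 0 at [s], and the second is still 0 at [t]. *)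
pose g x : R := (b \_ `]s, t]) x.
have gE : \int[leb]_(x in `[s, T]) g x = \int[leb]_(x in `[s, t]) b x.
  rewrite /g -Rintegral_mkcondr -(Rintegral_itv_obnd_cbnd (r := s)); last first.
    by apply: integrableS bi => //; apply: subset_itv; rewrite bnd_simp// ltW.
  congr Rintegral; apply/seteqP; split => x /=; rewrite !in_itv/=.
    by move=> [_].
  by move=> /andP[sx xt]; rewrite sx xt (ltW sx) (le_trans xt (ltW tT)).
have L3 : (fun n => \int[leb]_(x in `[s, T]) (((P1 n).1 x - (P2 n).1 x) * b x)) @ \oo -->
    \int[leb]_(x in `[s, t]) b x.
  have mb : measurable_fun `[s, T] b by apply/measurable_EFinP; exact: measurable_int bi.
  have cH n : continuous (fun x => (P1 n).1 x - (P2 n).1 x).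
    move=> x; apply: cvgB.
      by case: (hP1 n) => -[d1 _ _ _ _] _; exact: is_derive_continuous d1 x.
    by case: (hP2 n) => -[d1 _ _ _ _] _; exact: is_derive_continuous d1 x.
  have [] := @dominated_convergence _ (measurableTypeR R) R leb `[s, T] mJ
    (fun n x => (((P1 n).1 x - (P2 n).1 x) * b x)%:E) (EFin \o g) (fun x => `|b x|%:E).
  - move=> n; apply/measurable_EFinP; apply: measurable_funM => //.
    by apply: measurable_funTS; exact: continuous_measurable_fun.
  - apply/measurable_EFinP; apply/(measurable_restrict _ _ _) => //.
    by apply: measurable_funS mb => // x [].
  - apply: aeW => x; rewrite /= in_itv/= => /andP[sx xT].
    apply: cvg_EFin; first by near=> n.
    have dlt r : 0 < r -> \forall n \near \oo, e n < r.
      move=> r0; have /cvgrPdist_lt /(_ _ r0) := ec; apply: filterS => n.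
      by rewrite sub0r normrN gtr0_norm.
    rewrite /g patchE; have [xs|xs] := eqVneq x s.
      rewrite memNset; last by rewrite /= in_itv/= xs ltxx.
      apply: cvg_near_cst; near=> n => /=.
      have [[_ _ _ [z1 _] _] _] := hP1 n; have [[_ _ _ [z2 _] _] _] := hP2 n.
      by rewrite z1 ?z2 ?subrr ?mul0r// xs// ltW.
    have {xs}sx : s < x by rewrite lt_neqAle eq_sym xs.
    have [xt|tx] := leP x t.
      rewrite mem_set; last by rewrite /= in_itv/= sx.
      have xs0 : 0 < x - s by rewrite subr_gt0.
      apply: cvg_near_cst; near=> n => /=.
      have [[_ _ _ [_ z1] _] _] := hP1 n; have [[_ _ _ [z2 _] _] _] := hP2 n.
      have en : e n < x - s by near: n; exact: dlt.
      by rewrite z1 ?z2 ?subr0 ?mul1r//; lra.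
    rewrite memNset; last by rewrite /= in_itv/= leNgt tx andbF.
    have xt0 : 0 < x - t by rewrite subr_gt0.
    apply: cvg_near_cst; near=> n => /=.
    have [[_ _ _ [_ z1] _] _] := hP1 n; have [[_ _ _ [_ z2] _] _] := hP2 n.
    have en : e n < x - t by near: n; exact: dlt.
    by rewrite z1 ?z2 ?subrr ?mul0r//; lra.
  - exact: integrable_norm.
  - apply: aeW => x n _; rewrite lee_fin normrM ler_piMl//.
    have [[_ _ [_ /(_ x) /andP[p1 q1]] _ _] _] := hP1 n.
    have [[_ _ [_ /(_ x) /andP[p2 q2]] _ _] _] := hP2 n.
    by rewrite ler_norml; lra.
  move=> gi _; rewrite -[X in _ --> X](fineK (integrable_fin_num mJ gi)) => /fine_cvg.
  by rewrite -gE.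
have L12 : (fun n => \int[leb]_(x in `[s, T]) ((P1 n).2 x * a x) -
    \int[leb]_(x in `[s, T]) ((P2 n).2 x * a x)) @ \oo --> a s - a t by exact: cvgB.
have L3' : (fun n => \int[leb]_(x in `[s, T]) ((P1 n).2 x * a x) -
    \int[leb]_(x in `[s, T]) ((P2 n).2 x * a x)) @ \oo --> - \int[leb]_(x in `[s, t]) b x.
  by under eq_fun do rewrite W'; exact: cvgN.
have := cvg_unique _ L12 L3' => /(_ (@norm_hausdorff _ _)) e12.
by rewrite -[LHS]opprB e12 opprK.
Unshelve. all: by end_near. Qed.

End WeakTimeDerivative.

(** * Absolute continuity of the Fourier coefficients in time *)

Section FourierCoefficients.
Context {R : realType}.
Notation leb := (@lebesgue_measure R).
Notation mode := ((nat * bool) * (nat * bool))%type.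
Implicit Types (u g : R * (R * R) -> R) (H h theta : R -> R) (s t T : R) (k : mode).

Definition coef u k t : R := ip leb2 cell (fun x => u (t, x)) (harm2 k).

Let mI s t : measurable (`[s, t]%classic : set (measurableTypeR R)).
Proof. exact: measurable_itv. Qed.

Lemma bounded_profile_harm2 s t k theta : continuous theta ->
  bounded_fun leb3 (`[s, t]%classic `*` cell) (fun z => theta z.1 * harm2 k z.2).
Proof.
move=> cth.
have [M [_ [Mr hM]]] : exists M, 0 <= M /\ (M \is Num.real /\ forall x, `[s, t]%classic x -> `|theta x| <= M).
  have := continuous_compact (continuous_subspaceT cth) (segment_compact (a := s) (b := t)).
  move=> /compact_bounded [M [Mr hM]]; exists (`|M| + 1); split; first by rewrite addr_ge0.
  split; first by rewrite realE addr_ge0.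
  by move=> x sx; apply: hM; [rewrite (le_lt_trans (ler_norm M))// ltrDl|exists x].
apply: (@bounded_fun_everywhere _ _ _ _ _ _ (M * harm2_bound k)).
  apply: measurable_funTS; apply: measurable_funM.
    by apply: measurableT_comp; [exact: continuous_measurable_fun|exact: measurable_fst].
  by apply: measurableT_comp; [exact: measurable_harm2|exact: measurable_snd].
by move=> z [z1 z2]; rewrite normrM; apply: ler_pM => //; [exact: hM|exact: harm2_le].
Qed.

Lemma integrable_coef s t k u : leb3.-integrable (`[s, t]%classic `*` cell) (EFin \o u) ->
  leb.-integrable `[s, t] (EFin \o coef u k).
Proof.
move=> ui.
have mJ : measurable (`[s, t]%classic `*` cell :
   set (measurableTypeR R * (measurableTypeR R * measurableTypeR R))) by exact: measurableX.
have b1 := bounded_profile_harm2 s t k (fun x => @cst_continuous R R 1 x).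
have ui1 := integrable_bounded_funM mJ ui b1.
have := fubini_box_integrable (mI s t) measurable_cell ui1.
by congr (_.-integrable); apply/funext => x /=; congr EFin; apply: eq_Rintegral => y _; rewrite /= mul1r.
Qed.

Lemma fubini_coef s t k u theta : continuous theta ->
  leb3.-integrable (`[s, t]%classic `*` cell) (EFin \o u) ->
  \int[leb3]_(z in `[s, t]%classic `*` cell) (u z * (theta z.1 * harm2 k z.2)) =
  \int[leb]_(x in `[s, t]) (theta x * coef u k x).
Proof.
move=> cth ui.
have mJ : measurable (`[s, t]%classic `*` cell :
   set (measurableTypeR R * (measurableTypeR R * measurableTypeR R))) by exact: measurableX.
have ui1 := integrable_bounded_funM mJ ui (bounded_profile_harm2 s t k cth).
rewrite (fubini_box (mI s t) measurable_cell ui1).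
have i2 := fubini_box_integrable (mI s t) measurable_cell ui1.
apply: ae_eq_Rintegral => //.
- by apply/measurable_EFinP; exact: measurable_int i2.
- apply: measurable_funM; first by apply: measurable_funTS; exact: continuous_measurable_fun.
  by apply/measurable_EFinP; exact: measurable_int (integrable_coef k ui).
apply: (ae_imply (fubini_box_ae (mI s t) measurable_cell ui)) => x hx /hx xi.
rewrite /coef /ip -RintegralZl//; last exact: (ip1_integrable xi (bounded_harm2 k)).
by apply: eq_Rintegral => y _ /=; ring.
Qed.

Lemma test_flow_profile (I : set R) s T H h k : test_profile s T H h -> `[s, T]%classic `<=` I° ->
  test_flow I (fun z => H z.1 * harm2 k z.2).
Proof.
move=> [dH ch h0 h1 sH] sI; split.
- by move=> t x1 x2 /=; have [-> ->] := periodic2_harm2 k x1 x2.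
- move=> n; apply: CkM; last apply: CkM.
  + by apply: sH => // z; exact: cvg_fst.
  + apply: (Ck_harm (L := fun z : R * (R * R) => z.2.1)) => // z.
    by apply: continuous_comp; [exact: cvg_snd|exact: cvg_fst].
  + apply: (Ck_harm (L := fun z : R * (R * R) => z.2.2)) => // z.
    by apply: continuous_comp; [exact: cvg_snd|exact: cvg_snd].
exists s, T; split => // t x; rewrite /= in_itv/= => /negP; rewrite negb_and -!ltNge.
by case/orP => tt; [have [-> _] := h0 _ (ltW tt)|have [-> _] := h1 _ (ltW tt)]; rewrite mul0r.
Qed.

Lemma derive_profile H h k : (forall x, is_derive x (1 : R) H (h x)) ->
  'D_time_dir (fun z : R * (R * R) => H z.1 * harm2 k z.2) = (fun z => h z.1 * harm2 k z.2).
Proof.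
move=> dH; apply/funext => z.
suff [_ ->] : is_derive z time_dir (fun z : R * (R * R) => H z.1 * harm2 k z.2) (h z.1 * harm2 k z.2) by [].
apply: is_derive_line => /=.
rewrite (_ : (fun _ => _) = (fun x => H (id x + z.1) * harm2 k z.2)); last first.
  apply/funext => x /=; rewrite /GRing.scale /= mulr1; congr (_ * harm2 k _).
  by rewrite -[RHS]add0r; congr (_ + _); exact: (@scaler0 R (R * R)%type x).
have d1 := is_derive_comp_affine (L := id) z.1 (0 : R) (1 : R) (fun _ _ _ => erefl) dH.
apply: is_derive_eq (is_deriveM d1 (is_derive_cst (harm2 k z.2) (0 : R) (1 : R))) _.
by rewrite /GRing.scale /= add0r; ring.
Qed.

Lemma Rintegral_support (I : set R) s T (f : R * (R * R) -> R) : `[s, T]%classic `<=` I ->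
  (forall z, ~ `[s, T]%classic z.1 -> f z = 0) ->
  \int[leb3]_(z in I `*` cell) f z = \int[leb3]_(z in `[s, T]%classic `*` cell) f z.
Proof.
move=> sI f0; rewrite Rintegral_mkcond [RHS]Rintegral_mkcond; congr Rintegral.
apply/funext => z; rewrite !patchE.
have [zJ|zJ] := pselect (`[s, T]%classic z.1).
  have [zc|zc] := pselect (cell z.2).
    by rewrite !mem_set//; split => //; exact: sI.
  by rewrite !memNset// => -[].
by rewrite f0//; case: ifP; case: ifP.
Qed.

(** A time profile times a harmonic is an admissible test function, and Fubini reduces the weak
    formulation to one in time alone. The continuity assumption makes the resulting identity hold at
    every pair of times instead of almost every pair. *)
Lemma weak_dt_AC (I : set R) u g k s t T : s < t -> t < T -> `[s, T]%classic `<=` I° ->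
  weak_dt I u g -> {within `[s, T], continuous (coef u k)} ->
  is_AC s t (coef u k) (coef g k).
Proof.
move=> st tT sI [[_ ui] [_ gi] W] ca; have sT := lt_trans st tT.
have {}ui := ui _ _ sI; have {}gi := gi _ _ sI.
have sI' : `[s, T]%classic `<=` I := subset_trans sI (@interior_subset _ I).
have gc := integrable_coef k gi.
have key x y : s <= x -> x < y -> y < T -> coef u k y - coef u k x = \int[leb]_(z in `[x, y]) coef g k z.
  move=> sx xy yT; apply: (weak_FTC (T := T)) => //.
  - by apply: continuous_subspaceW ca; apply: subset_itv; rewrite bnd_simp.
  - exact: itv_integrableS gc.
  move=> H h P.
  have xI : `[x, T]%classic `<=` I° by apply: subset_trans sI; apply: subset_itv; rewrite bnd_simp.
  have xI' : `[x, T]%classic `<=` I by apply: subset_trans sI'; apply: subset_itv; rewrite bnd_simp.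
  have xs : `[x, T]%classic `*` (cell : set (R * R)) `<=` `[s, T]%classic `*` (cell : set (R * R)).
    by case=> z1 z2 [h1 h2]; split => //=; move: h1; apply: subset_itv; rewrite bnd_simp.
  have mx : measurable (`[x, T]%classic `*` cell :
     set (measurableTypeR R * (measurableTypeR R * measurableTypeR R))) by exact: measurableX.
  have ms : measurable (`[s, T]%classic `*` cell :
     set (measurableTypeR R * (measurableTypeR R * measurableTypeR R))) by exact: measurableX.
  have ui' := integrableS ms mx xs ui; have gi' := integrableS ms mx xs gi.
  have W1 := W _ (test_flow_profile k P xI).
  have [dH ch h0 h1 _] := P.
  have off z : ~ `[x, T]%classic z -> H z = 0 /\ h z = 0.
    rewrite /= in_itv/= => /negP; rewrite negb_and -!ltNge.
    by case/orP => tt; [exact: (h0 _ (ltW tt))|exact: (h1 _ (ltW tt))].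
  have : \int[leb3]_(z in I `*` cell) (u z * (h z.1 * harm2 k z.2)) =
      - \int[leb3]_(z in I `*` cell) (g z * (H z.1 * harm2 k z.2)).
    rewrite -W1; apply: eq_Rintegral => z _; congr (_ * _).
    exact: (esym (congr1 (@^~ z) (derive_profile k dH))).
  rewrite (Rintegral_support xI'); last by move=> z /off [_ ->]; rewrite mul0r mulr0.
  rewrite (Rintegral_support (f := fun z => g z * _) xI'); last first.
    by move=> z /off [-> _]; rewrite mul0r mulr0.
  rewrite (fubini_coef k ch ui') (fubini_coef k _ gi') //.
  exact: is_derive_continuous dH.
split.
- by apply: continuous_subspaceW ca; apply: subset_itv; rewrite bnd_simp// ltW.
- exact: (itv_integrableS (lexx s) (ltW tT) gc).
- move=> x y sx; rewrite le_eqVlt => /orP[/eqP <- _|xy yt]; last by apply: key => //; exact: le_lt_trans tT.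
  by rewrite subrr set_itv1 Rintegral_set1.
Qed.

End FourierCoefficients.

(** * Gronwall's inequality for the truncated energies, in the limit of all modes *)

Section Gronwall.
Context {R : realType}.
Notation leb := (@lebesgue_measure R).
Notation mode := ((nat * bool) * (nat * bool))%type.
Variables (s t gamma K Es Et : R) (a b : 'I_2 -> mode -> R -> R).

Let EN N x := \sum_(j < 2) \sum_(k : modes N) a j (mode_val k) x ^+ 2.
Let RN N x := \sum_(j < 2) \sum_(k : modes N) a j (mode_val k) x * b j (mode_val k) x.

Hypotheses (st : s <= t) (g0 : 0 <= gamma) (aAC : forall j k, is_AC s t (a j k) (b j k)).
Hypothesis rate : {ae leb, forall x, s <= x <= t -> exists2 r : nat -> R, r @ \oo --> (0 : R) &
  forall N, 2 * RN N x + gamma * EN N x <= r N /\ 0 <= r N <= K}.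
Hypotheses (ENs : EN^~ s @ \oo --> Es) (ENt : EN^~ t @ \oo --> Et).

Let mJ : measurable (`[s, t]%classic : set (measurableTypeR R)).
Proof. exact: measurable_itv. Qed.

(** The density of exp (gamma x) E_N (x), by the product rule. *)
Let h N x := expR (gamma * x) * (2 * RN N x + gamma * EN N x).

Let EN_AC N : is_AC s t (fun x => expR (gamma * x) * EN N x) (h N).
Proof.
have e1 : is_AC s t (fun x : R => expR (gamma * x)) (fun x => gamma * expR (gamma * x)).
  apply: is_AC_C1 => x.
    have lin (c u v : R) : gamma * (c *: u + v) = c * (gamma * u) + gamma * v.
      by rewrite /GRing.scale /=; ring.
    have := is_derive_comp_affine (L := fun y : R => gamma * y) 0 x (1 : R) lin (@is_derive_expR R).
    by rewrite addr0 mulr1; under eq_fun do rewrite addr0.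
  by apply: cvgM; [exact: cvg_cst|apply: continuous_comp; [apply: cvgM; [exact: cvg_cst|exact: cvg_id]|exact: continuous_expR]].
have e2 : is_AC s t (EN N) (fun x => 2 * RN N x).
  have := is_AC_sum (index_enum 'I_2) (fun j => is_AC_sum (index_enum (modes N))
    (fun k => is_ACM (aAC j (mode_val k)) (aAC j (mode_val k)))).
  congr is_AC; apply/funext => x.
    rewrite /RN mulr_sumr; apply: eq_bigr => j _; rewrite mulr_sumr.
    by apply: eq_bigr => k _ /=; ring.
have := is_ACM e1 e2; congr is_AC; apply/funext => x; rewrite /h /=; ring.
Qed.

(* The positive part of [h N]: unlike [h N] itself it is dominated uniformly in [N]. *)
Let psi N x := (`|h N x| + h N x) / 2.

Let psi_int N : leb.-integrable `[s, t] (EFin \o psi N).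
Proof.
have [_ hi _] := EN_AC N; apply: itv_integrableZr; apply: itv_integrableD => //.
exact: integrable_norm hi.
Qed.

Let psi_le N x r : 2 * RN N x + gamma * EN N x <= r -> 0 <= r -> x <= t ->
  0 <= psi N x <= expR (gamma * t) * r.
Proof.
move=> hr r0 xt; have h1 := ler_norm (- h N x); rewrite normrN in h1.
have e0 := expR_ge0 (gamma * x).
have e1 : expR (gamma * x) * r <= expR (gamma * t) * r.
  by rewrite ler_wpM2r// ler_expR ler_wpM2l.
have h2 : h N x <= expR (gamma * x) * r by rewrite ler_wpM2l.
have h3 : 0 <= expR (gamma * x) * r by rewrite mulr_ge0.
apply/andP; split; first by rewrite /psi divr_ge0//; lra.
rewrite /psi; have [hh|hh] := ger0P (h N x); rewrite ?(ltW hh)//; lra.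
Qed.

Let psi_cvg : (fun N => \int[leb]_(x in `[s, t]) psi N x) @ \oo --> (0 : R).
Proof.
have [] := @dominated_convergence _ (measurableTypeR R) R leb `[s, t] mJ
  (fun N x => (psi N x)%:E) (fun=> 0%E) (fun=> (expR (gamma * t) * K)%:E).
- by move=> N; exact: measurable_int (psi_int N).
- exact: measurable_cst.
- apply: (ae_imply rate) => x hx; rewrite /= in_itv/= => xst.
  have [r r0 hr] := hx xst; apply: cvg_EFin; first by near=> n.
  have c : (fun N => expR (gamma * t) * r N) @ \oo --> (0 : R).
    by rewrite -(mulr0 (expR (gamma * t))); apply: cvgM => //; exact: cvg_cst.
  suff : (fun N => psi N x) @ \oo --> (0 : R) by [].
  apply: (squeeze_cvgr (f := fun=> 0) _ _ c); last exact: cvg_cst.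
  near=> N; have [h1 /andP[h2 _]] := hr N.
  by apply: psi_le => //; case/andP: xst.
- apply: continuous_compact_integrable; first exact: segment_compact.
  by apply: continuous_subspaceT => x; exact: cvg_cst.
- apply: (ae_imply rate) => x hx N; rewrite /= in_itv/= => xst.
  have [r r0 hr] := hx xst; have [h1 /andP[h2 h3]] := hr N.
  have /andP[p0 p1] := psi_le h1 h2 (proj2 (andP xst)).
  by rewrite lee_fin ger0_norm// (le_trans p1)// ler_wpM2l// expR_ge0.
move=> gi _; rewrite integral0 => /fine_cvg; exact.
Unshelve. all: by end_near. Qed.

(** The increment of exp (gamma x) E_N is the integral of [h N], hence at most that of its positive
    part, which tends to 0 by dominated convergence. *)
Lemma energy_decay : expR (gamma * t) * Et <= expR (gamma * s) * Es.
Proof.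
have L : (fun N => expR (gamma * s) * EN N s + \int[leb]_(x in `[s, t]) psi N x) @ \oo -->
    expR (gamma * s) * Es + 0.
  by apply: cvgD psi_cvg; exact: (cvgM (cvg_cst _) ENs).
have L' : (fun N => expR (gamma * t) * EN N t) @ \oo --> expR (gamma * t) * Et.
  by exact: (cvgM (cvg_cst _) ENt).
rewrite -[leRHS]addr0; apply: ler_cvg_to L' L _; near=> N.
have [_ hi /(_ s t (lexx _) st (lexx _))] := EN_AC N.
move=> /eqP; rewrite subr_eq addrC => /eqP ->; rewrite lerD2l.
apply: le_Rintegral => // x _; rewrite /psi.
by have := ler_norm (h N x); lra.
Unshelve. all: by end_near. Qed.

End Gronwall.

(** * The L2 norm of vector fields *)

Section L2norm.
Context {R : realType}.
Implicit Types (h g : vfield R).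
Local Notation bounded := (bounded_fun leb2 cell).
Local Notation "'<|' f , g '|>'" := (ip leb2 cell f g).
Local Notation integrable_cell f := (leb2.-integrable cell (EFin \o f)).

Lemma L2normE h : L2norm h = ((\int[leb2]_(x in cell) (\sum_(j < 2) h j x ^+ 2)%:E) `^ 2^-1)%E.
Proof.
rewrite /L2norm unlock; congr (_ `^ _)%E; rewrite [RHS]integral_mkcond.
apply: eq_integral => x _; rewrite /= !patchE; case: ifP => _.
  rewrite powR_mulrn// real_normK ?num_real// sqr_sqrtr//.
  by rewrite sumr_ge0// => j _; exact: sqr_ge0.
have p0 : point = 0 :> R by [].
by rewrite p0 normr0 powR0.
Qed.

Lemma energy_int_ge0 h : (0 <= \int[leb2]_(x in cell) (\sum_(j < 2) h j x ^+ 2)%:E)%E.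
Proof. by apply: integral_ge0 => x _; rewrite lee_fin sumr_ge0// => j _; exact: sqr_ge0. Qed.

Lemma L2norm_le_int h (r : R) : 0 <= r -> (L2norm h <= r%:E)%E ->
  (\int[leb2]_(x in cell) (\sum_(j < 2) h j x ^+ 2)%:E <= (r ^+ 2)%:E)%E.
Proof.
move=> r0; rewrite L2normE; have := energy_int_ge0 h.
case: (\int[leb2]_(x in cell) _)%E => [X| |] //; last by rewrite poweRyr// leye_eq.
move=> X0; rewrite lee_fin in X0; rewrite poweR_EFin powR12_sqrt// !lee_fin => hr.
by rewrite -(sqr_sqrtr X0) ler_pXn2r// nnegrE sqrtr_ge0.
Qed.

Lemma L2norm_bounded h : (forall j, bounded (h j)) -> L2norm h = (Num.sqrt (energy h))%:E.
Proof.
move=> bh; rewrite L2normE.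
have i2 j : integrable_cell (fun x => h j x ^+ 2).
  by apply: eq_integrable (bounded_integrable (bounded_funM (bh j) (bh j))) => // x _ /=; rewrite expr2.
have E : (\int[leb2]_(x in cell) (\sum_(j < 2) h j x ^+ 2)%:E)%E = (energy h)%:E.
  under eq_integral do rewrite big_ord_recl big_ord1 EFinD.
  rewrite integralD//; [|exact: i2|exact: i2].
  rewrite /energy big_ord_recl big_ord1 EFinD /ip /Rintegral; congr (_ + _)%E.
    by rewrite fineK; [|apply: integrable_fin_num => //; exact: bounded_integrable (bounded_funM _ _)];
      apply: eq_integral => x _; rewrite expr2.
  by rewrite fineK; [|apply: integrable_fin_num => //; exact: bounded_integrable (bounded_funM _ _)];
      apply: eq_integral => x _; rewrite expr2.
rewrite E /= powR12_sqrt// /energy sumr_ge0// => j _.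
exact: ip_ge0.
Qed.

Lemma L2normC h g : L2norm (fun j x => h j x - g j x) = L2norm (fun j x => g j x - h j x).
Proof.
rewrite !L2normE; congr (_ `^ _)%E; apply: eq_integral => x _; congr EFin.
by apply: eq_bigr => j _; rewrite -sqrrN opprB.
Qed.

Lemma euclid_triangle (a b c d : R) :
  Num.sqrt ((a + c) ^+ 2 + (b + d) ^+ 2) <= Num.sqrt (a ^+ 2 + b ^+ 2) + Num.sqrt (c ^+ 2 + d ^+ 2).
Proof.
set p := Num.sqrt (a ^+ 2 + b ^+ 2); set q := Num.sqrt (c ^+ 2 + d ^+ 2).
have p0 : 0 <= p by exact: sqrtr_ge0.
have q0 : 0 <= q by exact: sqrtr_ge0.
have p2 : p ^+ 2 = a ^+ 2 + b ^+ 2 by rewrite sqr_sqrtr// addr_ge0// sqr_ge0.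
have q2 : q ^+ 2 = c ^+ 2 + d ^+ 2 by rewrite sqr_sqrtr// addr_ge0// sqr_ge0.
have cs : a * c + b * d <= p * q.
  apply: le_trans (ler_norm _) _; rewrite -(ger0_norm (mulr_ge0 p0 q0)) -ler_sqr ?nnegrE//.
  rewrite -!normrX !ger0_norm ?sqr_ge0// exprMn p2 q2.
  by have := sqr_ge0 (a * d - b * c); nra.
rewrite -(ger0_norm (addr_ge0 p0 q0)) -sqrtr_sqr ler_wsqrtr//.
by clearbody p q; nra.
Qed.

Lemma measurable_density h : (forall j, measurable_fun cell (h j)) ->
  measurable_fun cell (fun x => \sum_(j < 2) h j x ^+ 2).
Proof. by move=> mh; apply: measurable_sum => j; apply: measurable_funX; exact: mh. Qed.

Lemma measurable_euclid h : (forall j, measurable_fun cell (h j)) ->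
  measurable_fun setT ((fun x => Num.sqrt (\sum_(j < 2) h j x ^+ 2)) \_ cell).
Proof.
move=> mh; apply/(measurable_restrictT _ measurable_cell).
apply: (@measurableT_comp _ _ _ _ _ _ (@Num.sqrt R)).
  by apply: continuous_measurable_fun; exact: sqrt_continuous.
exact: measurable_density.
Qed.

(** The pointwise Euclidean triangle inequality reduces this to Minkowski's inequality for the two
    scalar functions |h| and |g|. *)
Lemma L2norm_triangle h g : (forall j, measurable_fun cell (h j)) -> (forall j, measurable_fun cell (g j)) ->
  (L2norm (fun j x => h j x + g j x)%R <= L2norm h + L2norm g)%E.
Proof.
move=> mh mg; have mhE := measurable_euclid mh; have mgE := measurable_euclid mg.
have r1 : 1 <= 2 :> R by rewrite ler1n.
have := minkowski_EFin leb2 mhE mgE r1; apply: le_trans.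
rewrite L2normE Lnorm.unlock /=.
have aux (X Y : \bar R) : (0 <= X -> X <= Y -> X `^ 2^-1 <= Y `^ 2^-1)%E.
  move=> X0 XY; apply: gt0_ler_poweR => //; rewrite in_itv/= leey andbT//.
  exact: le_trans XY.
apply: aux; first exact: energy_int_ge0.
rewrite integral_mkcond; apply: ge0_le_integral => //.
- by move=> x _; rewrite patchE; case: ifP => // _; rewrite lee_fin sumr_ge0// => j _; exact: sqr_ge0.
- apply/(measurable_restrictT _ measurable_cell); apply/measurable_EFinP.
  by apply: (@measurable_density (fun j x => h j x + g j x)) => j; apply: measurable_funD.
- apply/measurable_EFinP; under eq_fun do rewrite powR_mulrn//.
  by apply: measurable_funX; apply: measurableT_comp => //; exact: measurable_funD.
move=> x _; rewrite /= !patchE; case: ifP => _; last by rewrite lee_fin powR_ge0.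
rewrite lee_fin ger0_norm ?addr_ge0 ?sqrtr_ge0// powR_mulrn ?addr_ge0 ?sqrtr_ge0//.
rewrite !big_ord_recl !big_ord0 !addr0.
set a := h _ _; set c := g _ _; set b := h _ _; set d := g _ _.
have X0 : 0 <= (a + c) ^+ 2 + (b + d) ^+ 2 by rewrite addr_ge0// sqr_ge0.
rewrite -{1}(sqr_sqrtr X0) ler_pXn2r ?nnegrE ?sqrtr_ge0 ?addr_ge0 ?sqrtr_ge0//.
exact: euclid_triangle.
Qed.

(** On a set of finite measure this follows from |y| <= 1 + y^2. *)
Lemma L2norm_integrable h (r : R) : (forall j, measurable_fun cell (h j)) -> 0 <= r ->
  (L2norm h <= r%:E)%E -> forall j, integrable_cell (h j).
Proof.
move=> mh r0 /(L2norm_le_int r0) hr j.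
have m2 := measurable_density mh.
have i2 : integrable_cell (fun x => \sum_(j < 2) h j x ^+ 2).
  apply/integrableP; split; first exact/measurable_EFinP.
  apply: le_lt_trans (ltry (r ^+ 2)); apply: le_trans hr; rewrite le_eqVlt; apply/orP; left; apply/eqP.
  by apply: eq_integral => x _; rewrite /= ger0_norm// sumr_ge0// => i _; exact: sqr_ge0.
have i1 : integrable_cell (fun x : R * R => 1 + \sum_(j < 2) h j x ^+ 2).
  exact: (integrable_cellD (bounded_integrable (bounded_fun_cst leb2 cell 1)) i2).
apply: (le_integrable measurable_cell _ _ i1).
  apply/measurable_EFinP.
  exact: mh.
move=> x _; rewrite /= lee_fin [leRHS]ger0_norm; last first.
  by rewrite addr_ge0// sumr_ge0// => i _; exact: sqr_ge0.
have : h j x ^+ 2 <= \sum_(i < 2) h i x ^+ 2.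
  by rewrite (bigD1 j)//= lerDl sumr_ge0// => i _; exact: sqr_ge0.
rewrite -(real_normK (num_real (h j x))).
by have := sqr_ge0 (`|h j x| - 1); have := normr_ge0 (h j x); nra.
Qed.

(** Here [h] is only measurable, not bounded, so the Cauchy-Schwarz inequality for bounded functions
    is replaced by a weighted arithmetic-geometric mean. Integrating r + S / r over the cell gives r
    (2 pi)^2 + r, still linear in [r]. *)
Lemma L2norm_coef_le h (r : R) j k : (forall j, measurable_fun cell (h j)) -> 0 < r ->
  (L2norm h <= r%:E)%E -> `|<| h j, harm2 k |>| <= r * (((2 * pi) ^+ 2 + 1) * harm2_bound k).
Proof.
move=> mh r0 hr; have hi := L2norm_integrable mh (ltW r0) hr.
have {}hr := L2norm_le_int (ltW r0) hr.
have m2 := measurable_density mh.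
have i2 : integrable_cell (fun x => \sum_(j < 2) h j x ^+ 2).
  apply/integrableP; split; first exact/measurable_EFinP.
  apply: le_lt_trans (ltry (r ^+ 2)); apply: le_trans hr; rewrite le_eqVlt; apply/orP; left; apply/eqP.
  by apply: eq_integral => x _; rewrite /= ger0_norm// sumr_ge0// => i _; exact: sqr_ge0.
have b2 : \int[leb2]_(x in cell) \sum_(j < 2) h j x ^+ 2 <= r ^+ 2.
  by rewrite -lee_fin /Rintegral fineK//; exact: integrable_fin_num.
have ih := ip1_integrable (hi j) (bounded_harm2 k).
have ic : integrable_cell (fun _ : R * R => r) := bounded_integrable (bounded_fun_cst leb2 cell r).
have i3 := integrable_cellZ r^-1 i2.
have i4 := integrable_cellZ (harm2_bound k) (integrable_cellD ic i3).
have B0 : 0 <= harm2_bound k :> R by apply: le_trans (harm2_le k (0, 0)).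
apply: le_trans (le_normr_Rintegral measurable_cell ih) _.
apply: le_trans (le_Rintegral measurable_cell (integrable_norm ih) i4 _) _.
  move=> x _; rewrite /= normrM mulrC; apply: ler_pM => //; first exact: harm2_le.
  have : h j x ^+ 2 <= \sum_(i < 2) h i x ^+ 2.
    by rewrite (bigD1 j)//= lerDl sumr_ge0// => i _; exact: sqr_ge0.
  (* AM-GM: |h j x| <= r + S / r *)
  set S := \sum_(i < 2) _ => hS; rewrite -(ler_pM2l r0) mulrDr mulrA divff ?gt_eqF// mul1r.
  move: hS; rewrite -(real_normK (num_real (h j x))).
  have := sqr_ge0 (`|h j x| - r); have := normr_ge0 (h j x); move: `|h j x| (S) => y z.
  clear -r0; nra.
rewrite (RintegralZl _ measurable_cell (integrable_cellD ic i3)) (RintegralD measurable_cell ic i3).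
rewrite (RintegralZl _ measurable_cell i2) (Rintegral_cst _ measurable_cell).
have -> : fine (leb2 (cell : set (measurableTypeR R * measurableTypeR R))) = (2 * pi) ^+ 2 by rewrite leb2_cell.
rewrite mulrCA mulrA [_ * harm2_bound k]mulrC mulrA ![harm2_bound k * _]mulrC -mulrA.
rewrite [X in _ <= X](_ : _ = harm2_bound k * (r * (2 * pi) ^+ 2 + r)); last by ring.
rewrite [X in X <= _](_ : _ = harm2_bound k * (r * (2 * pi) ^+ 2 + r^-1 * \int[leb2]_(x in cell) \sum_(j < 2) h j x ^+ 2)); last by ring.
rewrite ler_wpM2l// lerD2l -(ler_pM2l r0) mulrA divff ?gt_eqF// mul1r -expr2//.
Qed.

Lemma L2norm_eq0_ae h : (forall j, measurable_fun cell (h j)) -> (L2norm h <= 0)%E ->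
  forall j, {ae leb2, forall x, cell x -> h j x = 0}.
Proof.
move=> mh /(L2norm_le_int (lexx 0)); rewrite expr0n/= => h0 j.
have m2 := measurable_density mh.
have : ae_eq leb2 cell (fun x => (\sum_(j < 2) h j x ^+ 2)%:E) (cst 0%E).
  apply/(ae_eq_integral_abs leb2 measurable_cell); first exact/measurable_EFinP.
  apply/eqP; rewrite eq_le integral_ge0 ?andbT; last by move=> x _.
  apply: le_trans h0; rewrite le_eqVlt; apply/orP; left; apply/eqP.
  by apply: eq_integral => x _; rewrite /= ger0_norm// sumr_ge0// => i _; exact: sqr_ge0.
move=> H; apply: (ae_imply H) => x hx /hx [] /eqP.
rewrite psumr_eq0; last by move=> i _; exact: sqr_ge0.
by move=> /allP /(_ j); rewrite mem_index_enum sqrf_eq0 => /(_ isT) /eqP.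
Qed.

End L2norm.

(** * Comparison of solutions *)

Section Solution.
Context {R : realType}.
Notation leb := (@lebesgue_measure R).
Local Notation bounded := (bounded_fun leb2 cell).
Local Notation integrable_cell f := (leb2.-integrable cell (EFin \o f)).

(** Every right neighbourhood of [t] has positive measure. This exchanges an arbitrary time for a
    nearby good one, at which the almost everywhere bounds hold and which is still close in L2. *)
Lemma right_point (P Q : R -> Prop) t : {ae leb, forall x, t < x -> P x} ->
  (\forall x \near t^'+, Q x) -> exists x, [/\ t < x, x < t + 1, P x & Q x].
Proof.
move=> hP; rewrite near_withinE => /nbhs_ballP [d /= d0 hd].
have [|x [/andP[tx xd] hx]] := ae_exists_itv (x := t) (y := t + Num.min d 1) hP.
  by rewrite ltrDl lt_min d0 ltr01.
exists x; split => //; [| exact: hx|].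
  by apply: lt_le_trans xd _; rewrite lerD2l ge_min lexx orbT.
apply: hd => //; rewrite /ball/= distrC gtr0_norm ?subr_gt0// ltrBlDl.
by apply: lt_le_trans xd _; rewrite lerD2l ge_min lexx.
Qed.

Variables (alpha epsilon : R) (F : R -> vfield R) (I : set R) (v : flow R).
Hypotheses (mI : measurable (I : set (measurableTypeR R)))
  (up : forall s t, I s -> s <= t -> I t) (sol : solution alpha epsilon F I v)
  (bdd : forall t, exists M, {ae leb, forall x, I x -> x <= t ->
     forall j, sobolev_ball 1 +oo%E M (slice v x j)}).

Lemma slice_measurable j t : I t -> measurable_fun setT (slice v t j).
Proof.
move=> It; have [mv _ _ _ _] := sol.
have mIT : measurable (I `*` setT :
   set (measurableTypeR R * (measurableTypeR R * measurableTypeR R))) by exact: measurableX.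
by apply: (measurable_comp mIT _ (mv j) (pair1_measurable t)) => z [x _ <-].
Qed.

Lemma slice_measurable_cell j t : I t -> measurable_fun cell (slice v t j).
Proof. by move=> /(slice_measurable j); exact: measurable_funTS. Qed.

Lemma L2_near (t eta : R) : I t -> 0 < eta ->
  \forall x \near within I (nbhs t), (L2norm (fun j y => v j (x, y) - v j (t, y))%R <= eta%:E)%E.
Proof.
move=> It e0; have [_ cv _ _ _] := sol.
apply: (cv t It [set x | (x <= eta%:E)%E]); exists eta => //= r.
by rewrite /ball_ /= sub0r normrN lee_fin => /ltW; exact: le_trans (ler_norm r).
Qed.

Lemma L2_near_right (t eta : R) : I t -> 0 < eta ->
  \forall x \near t^'+, (L2norm (fun j y => v j (x, y) - v j (t, y))%R <= eta%:E)%E.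
Proof.
move=> It e0; have := L2_near It e0; rewrite !near_withinE; apply: filterS => x h tx.
by apply: h; exact: up (ltW tx).
Qed.

Lemma slice_bounded t : exists M, {ae leb, forall x, I x -> x <= t -> forall j, ae_bounded leb2 cell (slice v x j) M}.
Proof.
have [M hM] := bdd t; exists M; apply: (ae_imply hM) => x h Ix xt j.
exact: sobolev_ball1_bounded (h Ix xt j).
Qed.

(** Boundedness is known only at almost every time. At a given [t] the slice is a bounded slice at a
    nearby later time plus a difference of finite L2 norm. *)
Lemma slice_integrable j t : I t -> integrable_cell (slice v t j).
Proof.
move=> It; have [M hM] := slice_bounded (t + 1).
have hP : {ae leb, forall x, t < x -> x <= t + 1 -> forall j, bounded (slice v x j)}.
  by apply: (ae_imply hM) => x h tx xt i; exists M; apply: h => //; exact: up (ltW tx).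
have [x [tx xt Px Qx]] := right_point hP (L2_near_right It ltr01).
have Ix := up It (ltW tx).
have mh i : measurable_fun cell (fun y => v i (x, y) - v i (t, y)).
  by apply: measurable_funB; exact: slice_measurable_cell.
have := integrable_cellB (bounded_integrable (Px (ltW xt) j)) (L2norm_integrable mh ler01 Qx j).
by congr (_.-integrable); apply/funext => y /=; congr EFin; rewrite /slice; ring.
Qed.

Lemma coef_continuous j k s t : I s -> {within `[s, t], continuous (coef (v j) k)}.
Proof.
move=> Is; apply/subspace_continuousP => x; rewrite /= in_itv/= => /andP[sx xt].
have Ix := up Is sx.
apply/cvgrPdist_le => e e0; set B := ((2 * pi) ^+ 2 + 1) * harm2_bound k : R.
have B0 : 0 <= B.
  by rewrite mulr_ge0// ?addr_ge0 ?sqr_ge0//; apply: le_trans (harm2_le k (0, 0)).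
have eta0 : 0 < e / (B + 1) by rewrite divr_gt0// ltr_wpDl.
have := L2_near Ix eta0; rewrite !near_withinE; apply: filterS => y h.
rewrite /= in_itv/= => /andP[sy _]; have Iy := up Is sy.
have mh i : measurable_fun cell (fun z => v i (y, z) - v i (x, z)).
  by apply: measurable_funB; exact: slice_measurable_cell.
have := L2norm_coef_le j k mh eta0 (h Iy).
have -> : ip leb2 cell (fun z => v j (y, z) - v j (x, z)) (harm2 k) = coef (v j) k y - coef (v j) k x.
  by rewrite -(ip1Bl (slice_integrable j Iy) (slice_integrable j Ix) (bounded_harm2 k)).
rewrite distrC => /le_trans; apply; rewrite -/B mulrAC -mulrA ger_pMr// ler_pdivrMr ?mul1r ?lerDl//.
by rewrite ltr_wpDl.
Qed.

(** The gap between [s0] and [s] matters because the weak time derivative sees only the interior of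
    [I], which for a half-line does not contain the initial time. *)
Lemma sub_interior s0 s t : I s0 -> s0 < s -> `[s, t]%classic `<=` I°.
Proof.
move=> Is0 s0s x; rewrite /= in_itv/= => /andP[sx _].
have s0x := lt_le_trans s0s sx.
have : nbhs x [set y | s0 < y] by apply: open_nbhs_nbhs; split => //; exact: open_gt.
by apply: filterS => y /ltW; exact: up.
Qed.

(** This collects, on a closed interval strictly after [s0], what [energy_rate] asks of one solution
    at almost every time and what Gronwall's argument asks of its coefficients. *)
Lemma solution_data : exists (vt : flow R) (p : R * (R * R) -> R), forall s0 s t, I s0 -> s0 < s -> s < t ->
  (forall j k, is_AC s t (coef (v j) k) (coef (vt j) k)) /\
  exists M, {ae leb, forall x, s <= x <= t ->
    [/\ momentum_eq alpha epsilon (F x) (slice v x) (slice vt x) (fun y => p (x, y)),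
      div_free (slice v x), mean_zero (slice v x),
      forall j, sobolev_ball 1 +oo%E M (slice v x j) & forall j, integrable_cell (slice vt x j)]}.
Proof.
have [_ _ mz df [vt [p [wd _ me]]]] := sol; exists vt, p => s0 s t Is0 s0s st; split.
  move=> j k; apply: (weak_dt_AC (T := t + 1) st _ _ (wd j)); first by rewrite ltrDl.
    exact: sub_interior Is0 s0s.
  by apply: coef_continuous; exact: up (ltW s0s).
have [M hM] := bdd t; exists M.
have ii : {ae leb, forall x, s <= x <= t -> forall j, integrable_cell (slice vt x j)}.
  have h j : {ae leb, forall x, s <= x <= t -> integrable_cell (slice vt x j)}.
    have [_ [_ /(_ s t (sub_interior Is0 s0s)) gi] _] := wd j.
    have mJ : measurable (`[s, t]%classic : set (measurableTypeR R)) by exact: measurable_itv.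
    have := fubini_box_ae mJ measurable_cell gi.
    by move=> H; apply: (ae_imply H) => x hx xst; apply: hx; rewrite /= in_itv.
  apply: (ae_imply2 (h 0) (h 1)) => x h0 h1 xst j.
  by case: j => -[|[|//]] jP; [move: (h0 xst)|move: (h1 xst)]; congr (_.-integrable);
    apply/funext => y; congr (EFin (vt _ _)); exact: val_inj.
have h1 : {ae leb, forall x, I x -> momentum_eq alpha epsilon (F x) (slice v x) (slice vt x) (fun y => p (x, y)) /\
   div_free (slice v x)}.
  by apply: (ae_imply2 me df) => x a b Ix; split; [exact: a|exact: b].
have h2 : {ae leb, forall x, s <= x <= t -> I x -> (forall j, sobolev_ball 1 +oo%E M (slice v x j)) /\
    (forall j, integrable_cell (slice vt x j))}.
  by apply: (ae_imply2 hM ii) => x a b xst Ix; split; [apply: a => //; case/andP: xst|exact: b].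
apply: (ae_imply2 h1 h2).
move=> x a b xst; have Ix : I x by apply: up Is0 (ltW (lt_le_trans s0s _)); case/andP: xst.
by have [a1 a2] := a Ix; have [b1 b2] := b xst Ix; split => //; exact: mz.
Qed.

End Solution.

Section Comparison.
Context {R : realType}.
Notation leb := (@lebesgue_measure R).
Local Notation bounded := (bounded_fun leb2 cell).
Variables (alpha epsilon delta : R) (F : R -> vfield R) (I J : set R) (u v : flow R).
Hypotheses (a0 : 0 <= alpha) (e0 : 0 <= epsilon) (d0 : 0 < delta) (da : 4 * delta <= alpha + epsilon).
Hypotheses (mI : measurable (I : set (measurableTypeR R))) (mJ : measurable (J : set (measurableTypeR R)))
  (upI : forall s t, I s -> s <= t -> I t) (upJ : forall s t, J s -> s <= t -> J t)
  (su : solution alpha epsilon F I u) (sv : solution alpha epsilon F J v)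
  (bu : forall t, exists M, {ae leb, forall x, I x -> x <= t ->
     forall j, sobolev_ball 1 +oo%E M (slice u x j)})
  (bv : Linf_W1inf_le J delta v).

Let bv' : forall t, exists M, {ae leb, forall x, J x -> x <= t ->
     forall j, sobolev_ball 1 +oo%E M (slice v x j)}.
Proof. by move=> t; exists delta; apply: (ae_imply bv) => x h Jx _; exact: h. Qed.

Let gamma := alpha + epsilon.
Let w x : vfield R := fun j y => u j (x, y) - v j (x, y).

Let gamma_gt0 : 0 < gamma.
Proof. by apply: lt_le_trans da; rewrite mulr_gt0. Qed.

(** The end times must be good ones: boundedness of the two slices makes the truncated energies
    converge to the full energy there. *)
Lemma energy_decrease s0 s t : I s0 -> J s0 -> s0 < s -> s < t ->
  (forall j, bounded (w s j)) -> (forall j, bounded (w t j)) ->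
  expR (gamma * t) * energy (w t) <= expR (gamma * s) * energy (w s).
Proof.
move=> Is0 Js0 s0s st bs bt.
have [ut [p Hu]] := solution_data mI upI su bu; have [vt [q Hv]] := solution_data mJ upJ sv bv'.
have {Hu} [ACu [M Hu]] := Hu s0 s t Is0 s0s st; have {Hv} [ACv [M' Hv]] := Hv s0 s t Js0 s0s st.
have coefE j k x : s <= x -> (coef (u j) k \- coef (v j) k) x = ip leb2 cell (w x j) (harm2 k).
  move=> sx; have s0x := ltW (lt_le_trans s0s sx).
  rewrite /coef /= -(ip1Bl _ _ (bounded_harm2 k)) //.
    by apply: (slice_integrable mI upI su bu); exact: upI Is0 s0x.
  by apply: (slice_integrable mJ upJ sv bv'); exact: upJ Js0 s0x.
have cvg x : s <= x -> (forall j, bounded (w x j)) ->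
   (fun N => \sum_(j < 2) \sum_(k : modes N) (coef (u j) (mode_val k) \- coef (v j) (mode_val k)) x ^+ 2) @ \oo
   --> energy (w x).
  move=> sx bx; rewrite (_ : (fun N => _) = (fun N => energyN N (w x))); first exact: energyN_cvg.
  apply/funext => N; by apply: eq_bigr => j _; apply: eq_bigr => k _; rewrite coefE.
apply: (@energy_decay R s t gamma (rate_bound M delta) _ _ (fun j k => coef (u j) k \- coef (v j) k)
  (fun j k => coef (ut j) k \- coef (vt j) k)) => //; first exact: ltW.
- exact: ltW.
- by move=> j k; exact: is_ACB.
- have H := ae_imply2 Hv bv (fun x a b => conj a b).
  apply: (ae_imply2 Hu H) => x hu [hv hbv] xst; have sx : s <= x by case/andP: xst.
  have s0x := ltW (lt_le_trans s0s sx).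
  have [mu du zu bdu iu] := hu xst; have [mv dv zv _ iv] := hv xst; have bdv := hbv (upJ Js0 s0x).
  have [r r0 hr] := energy_rate a0 e0 d0 da mu mv du dv zu zv bdu bdv iu iv.
  exists r => // N; have [h1 h2] := hr N; split => //; apply: le_trans h1.
  have eb j k : (coef (ut j) k \- coef (vt j) k) x =
     ip leb2 cell (slice ut x j \- slice vt x j) (harm2 k).
    by rewrite /coef /= (ip1Bl (iu j) (iv j) (bounded_harm2 k)).
  rewrite le_eqVlt; apply/orP; left; apply/eqP; congr (_ * _ + _ * _).
    by apply: eq_bigr => j _; apply: eq_bigr => k _; rewrite coefE// eb.
  by apply: eq_bigr => j _; apply: eq_bigr => k _; rewrite coefE.
- exact: cvg.
- by apply: cvg => //; exact: ltW.
Qed.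

Lemma energy_bound T : exists K, 0 <= K /\ {ae leb, forall x, I x -> J x -> x <= T ->
  (forall j, bounded (w x j)) /\ energy (w x) <= K}.
Proof.
have [M hM] := slice_bounded bu T; have [M' hM'] := slice_bounded bv' T.
exists (((M + M') ^+ 2 * (2 * pi) ^+ 2) *+ 2); split.
  by rewrite mulrn_wge0// mulr_ge0// sqr_ge0.
apply: (ae_imply2 hM hM') => x hu hv Ix Jx xT.
have bw j : ae_bounded leb2 cell (w x j) (M + M').
  have [m1 b1] := hu Ix xT j; have [m2 b2] := hv Jx xT j.
  split; first exact: measurable_funB.
  apply: (ae_imply2 b1 b2) => y h1 h2 cy; apply: le_trans (ler_normB _ _) _.
  by apply: lerD; [exact: h1|exact: h2].
split; first by move=> j; exists (M + M').
rewrite /energy big_ord_recl big_ord1 mulr2n; apply: lerD; exact: ip_self_le.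
Qed.

(** A good time x slightly after [t] carries the bound, since exp (- gamma x / 2) <= exp (- gamma t
    / 2). L2 continuity of both solutions, each costing [eta / 2], brings it back to [t]. *)
Lemma L2norm_decay t (C : R) : I t -> J t -> 0 <= C ->
  {ae leb, forall x, t < x -> x <= t + 1 -> expR (gamma * x) * energy (w x) <= C ^+ 2} ->
  (L2norm (w t) <= (C * expR (- (gamma * t / 2)))%:E)%E.
Proof.
move=> It Jt C0 hE; apply/lee_addgt0Pr => eta eta0.
have eta20 : 0 < eta / 2 by rewrite divr_gt0.
have [K [_ hK]] := energy_bound (t + 1).
have hP : {ae leb, forall x, t < x -> x <= t + 1 -> (forall j, bounded (w x j)) /\
    expR (gamma * x) * energy (w x) <= C ^+ 2}.
  apply: (ae_imply2 hE hK) => x h1 h2 tx xt; split; last exact: h1.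
  by have [] := h2 (upI It (ltW tx)) (upJ Jt (ltW tx)) xt.
have Q := filterI (L2_near_right upI su It eta20) (L2_near_right upJ sv Jt eta20).
have [x [tx xt hx [Qu Qv]]] := right_point hP (Q _).
have {hx} [bx hx] := hx (ltW xt).
have [Ix Jx] := (upI It (ltW tx), upJ Jt (ltW tx)).
have mu y j : I y -> measurable_fun cell (fun z => u j (y, z)) by exact: (slice_measurable_cell mI su).
have mv y j : J y -> measurable_fun cell (fun z => v j (y, z)) by exact: (slice_measurable_cell mJ sv).
rewrite L2normC in Qu.
have -> : w t = (fun j y => w x j y + ((u j (t, y) - u j (x, y)) + (v j (x, y) - v j (t, y)))).
  by apply/funext => j; apply/funext => y; rewrite /w; ring.
have m1 j : measurable_fun cell (w x j) by apply: measurable_funB; [exact: mu|exact: mv].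
have m2 j : measurable_fun cell (fun y => u j (t, y) - u j (x, y)) by apply: measurable_funB; exact: mu.
have m3 j : measurable_fun cell (fun y => v j (x, y) - v j (t, y)) by apply: measurable_funB; exact: mv.
apply: le_trans (L2norm_triangle m1 (fun j => measurable_funD (m2 j) (m3 j))) _.
apply: leeD; last first.
  apply: le_trans (L2norm_triangle m2 m3) _.
  by rewrite (splitr eta) EFinD; exact: leeD.
rewrite (L2norm_bounded bx) lee_fin.
have P0 : 0 <= C * expR (- (gamma * t / 2)) by rewrite mulr_ge0// expR_ge0.
rewrite -(ger0_norm P0) -sqrtr_sqr ler_wsqrtr// exprMn -expRM_natl mulrN.
have -> : 2%:R * (gamma * t / 2) = gamma * t by field.
rewrite expRN ler_pdivlMr ?expR_gt0// mulrC; apply: le_trans hx.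
apply: ler_wpM2r; last by rewrite ler_expR ler_wpM2l ?(ltW gamma_gt0)// ltW.
by rewrite /energy sumr_ge0// => j _; exact: ip_ge0.
Qed.

(** The initial time itself need not be good, so decay starts at a good time [r] less than 1 later;
    before [r] the uniform energy bound [K] is used. The constant exp (gamma (s0 + 1)) K covers both
    ranges. *)
Lemma exponential_decay s0 : I s0 -> J s0 -> exists C, forall t, s0 <= t ->
  (L2norm (w t) <= (C * expR (- (gamma * t / 2)))%:E)%E.
Proof.
move=> Is Js; have [K [K0 hK]] := energy_bound (s0 + 1).
have [|r [/andP[s0r rs0] hr]] := ae_exists_itv (x := s0) (y := s0 + 1) hK; first by rewrite ltrDl.
have [Ir Jr] := (upI Is (ltW s0r), upJ Js (ltW s0r)).
have [br Er] := hr Ir Jr (ltW rs0).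
have L0 : 0 <= expR (gamma * (s0 + 1)) * K by rewrite mulr_ge0// expR_ge0.
exists (Num.sqrt (expR (gamma * (s0 + 1)) * K)) => t st.
apply: L2norm_decay; [exact: upI st|exact: upJ st|exact: sqrtr_ge0|rewrite sqr_sqrtr//].
have [K' [_ hK']] := energy_bound (t + 1).
apply: (ae_imply2 hK hK') => x h h' tx xt; have s0x := le_lt_trans st tx.
have [Ix Jx] := (upI Is (ltW s0x), upJ Js (ltW s0x)).
have E0 y : 0 <= energy (w y) by rewrite /energy sumr_ge0// => j _; exact: ip_ge0.
have [xr|rx] := leP x r.
  have [_ hx] := h Ix Jx (le_trans xr (ltW rs0)).
  apply: ler_pM; rewrite ?expR_ge0// ler_expR ler_wpM2l ?(ltW gamma_gt0)//.
  exact: le_trans xr (ltW rs0).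
have [bx _] := h' Ix Jx xt.
apply: le_trans (energy_decrease Is Js s0r rx br bx) _.
by apply: ler_pM; rewrite ?expR_ge0// ler_expR ler_wpM2l ?(ltW gamma_gt0)// ltW.
Qed.

(** This is the decay estimate with constant 0. If the energy were positive at some good time, going
    back in time would force it above the bound [K], which is uniform on the whole past. *)
Lemma entire_solutions_eq t : I = setT -> J = setT -> (L2norm (w t) <= 0)%E.
Proof.
move=> IT JT; have It x : I x by rewrite IT.
have Jt x : J x by rewrite JT.
have -> : 0%E = (0 * expR (- (gamma * t / 2)))%:E :> \bar R by rewrite mul0r.
apply: L2norm_decay => //; rewrite expr0n /=.
have [K [K0 hK]] := energy_bound (t + 1).
apply: (ae_imply hK) => x hx tx xt; have [bx _] := hx (It x) (Jt x) xt.
rewrite pmulr_rle0 ?expR_gt0// leNgt; apply/negP => Ex.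
(* Going back by at least [y] suffices: already 1 + gamma y <= exp (gamma y) gives an energy of at
   least energy (w x) + K. *)
pose y := K / (gamma * energy (w x)).
have y0 : 0 <= y by rewrite divr_ge0// mulr_ge0// ltW.
have [|s [/andP[ys sy] hs]] := ae_exists_itv (x := x - y - 1) (y := x - y) hK; first by rewrite gtrBl.
have sx : s < x by apply: lt_le_trans sy _; rewrite gerBl.
have [bs Es] := hs (It s) (Jt s) (le_trans (ltW sx) xt).
have s1 : s - 1 < s by rewrite gtrBl.
have := energy_decrease (It (s - 1)) (Jt (s - 1)) s1 sx bs bx.
apply/negP; rewrite -ltNge; apply: (@le_lt_trans _ _ (expR (gamma * s) * K)).
  by rewrite ler_wpM2l// expR_ge0.
have -> : gamma * x = gamma * s + gamma * (x - s) by ring.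
rewrite expRD -mulrA ltr_pM2l ?expR_gt0//.
have h1 := expR_ge1Dx (gamma * (x - s)).
apply: (@lt_le_trans _ _ ((1 + gamma * (x - s)) * energy (w x))); last by rewrite ler_wpM2r// ltW.
have gE : 0 < gamma * energy (w x) by rewrite mulr_gt0.
have KE : K = y * (gamma * energy (w x)) by rewrite /y divfK// gt_eqF.
clearbody y; rewrite -subr_gt0.
rewrite (_ : _ - _ = energy (w x) + (x - s - y) * (gamma * energy (w x))); last by rewrite {1}KE; ring.
by rewrite addr_gt0// mulr_gt0//; lra.
Qed.

End Comparison.

(** * Null sets of periodic functions *)

Section PeriodicNullSets.
Context {R : realType}.
Notation leb := (@lebesgue_measure R).
Implicit Types (c d : R).

Lemma measurable_shift c : measurable_fun setT ((fun x => x + c) : measurableTypeR R -> measurableTypeR R).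
Proof. by apply: measurable_funD. Qed.

Lemma lebesgue_measure_shift c (A : set R) : measurable A ->
  pushforward leb ((fun x => x + c) : _ -> measurableTypeR R) A = leb A.
Proof.
move=> mA; apply/esym/lebesgue_measure_unique => //=; first exact: measurable_shift.
move=> _ _ [[a b]] _ <-; rewrite /pushforward.
rewrite (_ : _ @^-1` _ = `]a - c, b - c]%classic); last first.
  by apply/seteqP; split => x /=; rewrite !in_itv/= ltrBlDr lerBrDr.
by rewrite !lebesgue_measure_itv/= !lte_fin ltrD2r -!EFinB opprB addrA subrK.
Qed.

Lemma ae_lebesgue_shift c (P : R -> Prop) : {ae leb, forall x, P x} -> {ae leb, forall x, P (x + c)}.
Proof.
move=> [N [mN N0 sN]]; exists ((fun x => x + c) @^-1` N); split.
- by rewrite -[X in measurable X]setTI; exact: (measurable_shift c).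
- by rewrite -N0 -(lebesgue_measure_shift c mN).
- by move=> x Px; exact: sN.
Qed.

Lemma leb2_eq0 (N : set (measurableTypeR R * measurableTypeR R)) : measurable N ->
  leb2 N = 0%E <-> {ae leb, forall x, leb (xsection N x) = 0%E}.
Proof.
move=> mN; have mf : measurable_fun setT (lebesgue_measure \o xsection N : measurableTypeR R -> \bar R).
  exact: measurable_fun_xsection.
have E : leb2 N = (\int[leb]_x `|(leb \o xsection N) x|)%E.
  by apply: eq_integral => x _; rewrite gee0_abs.
have H := ae_eq_integral_abs leb measurableT mf.
rewrite E; split => [/H h|h].
  by apply: (ae_imply h) => x; exact.
by apply/H; apply: (ae_imply h) => x hx _; exact: hx.
Qed.

(** A measurable set of the plane is null exactly when almost all its sections are, so invariance
    follows from one-dimensional translation invariance, used once for the base point and once in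
    the sections. *)
Lemma ae_leb2_shift c d (P : R * R -> Prop) : {ae leb2, forall x, P x} ->
  {ae leb2, forall x, P (x.1 + c, x.2 + d)}.
Proof.
move=> [N [mN N0 sN]]; pose f (z : measurableTypeR R * measurableTypeR R) :
   measurableTypeR R * measurableTypeR R := (z.1 + c, z.2 + d).
have mf : measurable_fun setT f.
  apply/measurable_fun_pairP; split; apply: measurable_funD => //.
have mN' : measurable (f @^-1` N) by rewrite -[X in measurable X]setTI; exact: mf.
exists (f @^-1` N); split => //; last by move=> x Px; exact: sN.
apply/leb2_eq0 => //; have := ae_lebesgue_shift c ((leb2_eq0 mN).1 N0).
move=> H; apply: (ae_imply H) => x hx.
rewrite -hx -(lebesgue_measure_shift d (measurable_xsection (x + c) mN)).
by rewrite /pushforward; congr (leb _); apply/seteqP; split => y; rewrite /xsection /= !inE.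
Qed.

Lemma periodic_int (h : R -> R) (m : int) x : (forall y, h (y + 2 * pi) = h y) ->
  h (x + m%:~R * (2 * pi)) = h x.
Proof.
move=> hp; have hn y (n : nat) : h (y + n%:R * (2 * pi)) = h y.
  elim: n => [|n IH]; first by rewrite mul0r addr0.
  by rewrite -addn1 natrD mulrDl mul1r addrA hp.
case: m => n; first exact: hn.
by rewrite -(hn (x + (Negz n)%:~R * (2 * pi)) n.+1) NegzE mulrNz mulNr subrK.
Qed.

Lemma fundamental_interval (x : R) : exists m : int, 0 <= x + m%:~R * (2 * pi) <= 2 * pi.
Proof.
have p0 := @pi2_gt0 R; exists (- Num.floor (x / (2 * pi))).
have /andP[h1 h2] := floor_itv (x / (2 * pi)).
rewrite ler_pdivlMr// in h1; rewrite ltr_pdivrMr// in h2.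
rewrite intrD1 mulrDl mul1r in h2.
by rewrite mulrNz mulNr subr_ge0 h1 /= lerBlDl ltW.
Qed.

(** The energy sees only one cell, whereas uniqueness is asserted almost everywhere in the plane;
    countably many translates of the cell cover the plane. *)
Lemma periodic_ae_eq0 (h : R * R -> R) : periodic2 h ->
  {ae leb2, forall x, cell x -> h x = 0} -> {ae leb2, forall x, h x = 0}.
Proof.
move=> hp h0.
(* The translates are enumerated by natural numbers to take a countable intersection; indices that
   code no lattice vector impose no condition. *)
have H (n : nat) : {ae leb2, forall x : R * R,
    if unpickle n is Some m then
      let y := (x.1 + (m : int * int).1%:~R * (2 * pi), x.2 + m.2%:~R * (2 * pi)) in cell y -> h y = 0
    else True}.
  by case: (unpickle n) => [m|]; [exact: (ae_leb2_shift _ _ h0)|exact: aeW].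
have {H} H := ae_foralln H; apply: (ae_imply H) => -[x1 x2] hx.
have [m1 i1] := fundamental_interval x1; have [m2 i2] := fundamental_interval x2.
have := hx (pickle (m1, m2)); rewrite pickleK /= => <-; last by split; rewrite /= in_itv.
rewrite (periodic_int (h := fun y => h (y, _))); last by move=> y; have [] := hp y (x2 + m2%:~R * (2 * pi)).
by rewrite (periodic_int (h := fun y => h (x1, y)))// => y; have [] := hp x1 y.
Qed.

End PeriodicNullSets.

Theorem theorem2 (R : realType) :
  exists a : R, 0 < a /\ exists m : nat,
  forall alpha epsilon G delta : R,
    0 <= alpha -> 0 <= epsilon -> 0 < Num.max alpha epsilon ->
    0 < delta -> delta <= 4^-1 * (alpha + a * epsilon) ->
  exists Omega0 : R, 0 < Omega0 /\
  forall F : R -> R -> vfield R, force_A m G F \/ force_B m G F ->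
  forall Omega : R, Omega0 <= Omega ->
  forall vper : flow R,
    regular_periodic_solution alpha epsilon (F Omega) (2 * pi / Omega) vper ->
    Linf_W1inf_le setT delta vper ->
  (forall (p0 : R) (v0 : vfield R) (v : flow R),
     3 < p0 -> (forall j, sobolev 2 p0%:E (v0 j)) ->
     div_free v0 -> mean_zero v0 ->
     cauchy_solution alpha epsilon (F Omega) v0 v ->
     exists C : R, forall t : R, 0 <= t ->
       (L2norm (fun j x => v j (t, x) - vper j (t, x))%R <=
        (C * expR (- ((alpha + epsilon) * t / 2)))%R%:E)%E) /\
  (forall u : flow R,
     regular_periodic_solution alpha epsilon (F Omega) (2 * pi / Omega) u ->
     forall t j, {ae leb2, forall x, u j (t, x) = vper j (t, x)}).
Proof.
exists 1; split => //; exists 0%N => alpha epsilon G delta a0 e0 _ d0 dle.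
exists 1; split => // F _ Omega _ vper [_ _ sper] bper.
(* With [a = 1] the smallness of [delta] is exactly what lets half of the dissipation absorb the
   stretching term; as [delta] is positive, it also makes the decay rate positive. *)
have da : 4 * delta <= alpha + epsilon.
  by move: dle; rewrite mul1r => h; lra.
split.
  move=> p0 v0 v _ _ _ _ [bv sv _].
  have up (s t : R) : `[0, +oo[%classic s -> s <= t -> `[0, +oo[%classic t.
    by rewrite /= !in_itv/= !andbT; exact: le_trans.
  have bv' (t : R) : exists M, {ae (@lebesgue_measure R), forall x, `[0, +oo[%classic x -> x <= t ->
     forall j, sobolev_ball 1 +oo%E M (slice v x j)}.
    have [M hM] := bv t; exists M; apply: (ae_imply hM) => x h; rewrite /= in_itv/= andbT => x0 xt.
    by apply: h; rewrite /= in_itv/= x0.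
  have m0 : measurable (`[0, +oo[%classic : set (measurableTypeR R)) by exact: measurable_itv.
  have [||C hC] := exponential_decay (s0 := 0) a0 e0 d0 da m0 measurableT up (fun _ _ _ _ => I) sv sper bv' bper.
  - by rewrite /= in_itv/= lexx.
  - by [].
  by exists C => t t0; exact: hC.
move=> u [_ [M bu] su] t j.
have bu' s : exists M, {ae (@lebesgue_measure R), forall x, [set: R] x -> x <= s ->
     forall j, sobolev_ball 1 +oo%E M (slice u x j)}.
  by exists M; apply: (ae_imply bu) => x h _ _; exact: h.
have up s r : [set: R] s -> s <= r -> [set: R] r by [].
have L0 := entire_solutions_eq a0 e0 d0 da measurableT measurableT up up su sper bu' bper t erefl erefl.
have mw i : measurable_fun cell (fun x => u i (t, x) - vper i (t, x)).
  by apply: measurable_funB; [exact: (slice_measurable_cell measurableT su)|exact: (slice_measurable_cell measurableT sper)].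
(* Spatial periodicity of each slice is part of the local integrability clause in the weak time
   derivative. *)
have pw : periodic2 (fun x => u j (t, x) - vper j (t, x)).
  have [_ _ _ _ [ut [_ [/(_ j) [[pu _] _ _] _ _]]]] := su.
  have [_ _ _ _ [vt [_ [/(_ j) [[pv _] _ _] _ _]]]] := sper.
  move=> x1 x2; have [-> ->] := pu t I x1 x2; have [-> ->] := pv t I x1 x2.
  by split.
have H := periodic_ae_eq0 pw (L2norm_eq0_ae mw L0 j).
by apply: (ae_imply H) => x /eqP; rewrite subr_eq0 => /eqP.
Qed.
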